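(* Let $d\ge 2$ and let $\tilde{\boldsymbol\mu}=(\tilde\mu_1,\dots,\tilde\mu_d)$ be a homogeneous, infinitely active completely random vector without fixed atoms, with equal marginals and finite second moments. Let $\tilde{\boldsymbol\mu}^{\mathrm{co}}$ and $\tilde{\boldsymbol\mu}^{\perp}$ denote the completely dependent and the independent completely random vectors with the same marginal distributions as $\tilde{\boldsymbol\mu}$, and define the Wasserstein index of dependence $$I_{\mathcal W}(\tilde{\boldsymbol\mu})=1-\frac{\mathcal D(\tilde{\boldsymbol\mu},\tilde{\boldsymbol\mu}^{\mathrm{co}})^2}{\sup_{\tilde{\boldsymbol\mu}'}\mathcal D(\tilde{\boldsymbol\mu}',\tilde{\boldsymbol\mu}^{\mathrm{co}})^2},\qquad \mathcal D(\tilde{\boldsymbol\mu}^1,\tilde{\boldsymbol\mu}^2)=\sup_A \mathcal W_*(\nu^1_A,\nu^2_A),$$ where the supremum in the denominator is over all completely random vectors $\tilde{\boldsymbol\mu}'$ with the same marginal distributions as $\tilde{\boldsymbol\mu}$ (that is, $\tilde\mu_i'=\tilde\mu_i$ in distribution for $i=1,\dots,d$), the supremum defining $\mathcal D$ is over all Borel sets $A$, and $\nu_A^1,\nu_A^2$ are the L\'evy intensities of $\tilde{\boldsymbol\mu}^1,\tilde{\boldsymbol\mu}^2$. Then: (i) $I_{\mathcal W}(\tilde{\boldsymbol\mu})\in[0,1]$; (ii) $I_{\mathcal W}(\tilde{\boldsymbol\mu})=1$ if and only if $\tilde{\boldsymbol\mu}=\tilde{\boldsymbol\mu}^{\mathrm{co}}$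 in distribution; (iii) $I_{\mathcal W}(\tilde{\boldsymbol\mu})=0$ if and only if $\tilde{\boldsymbol\mu}=\tilde{\boldsymbol\mu}^{\perp}$ in distribution.
   Context: Let $\mathbb X$ be a Polish space; ''set'' means Borel subset of $\mathbb X$. A vector of random measures $\tilde{\boldsymbol\mu}=(\tilde\mu_1,\dots,\tilde\mu_d)$ on $\mathbb X$ is a completely random vector (CRV) if for every $n\ge2$ and all pairwise disjoint sets $A_1,\dots,A_n$ the random vectors $\tilde{\boldsymbol\mu}(A_1),\dots,\tilde{\boldsymbol\mu}(A_n)$ in $[0,+\infty)^d$ are mutually independent, where $\tilde{\boldsymbol\mu}(A)=(\tilde\mu_1(A),\dots,\tilde\mu_d(A))$. Let $\Omega_d=[0,+\infty)^d\setminus\{\mathbf 0\}$. CRVs are considered without deterministic drift. For a CRV without fixed atoms, the L\'evy intensity $\nu_A$ of a set $A$ is the unique measure on $\Omega_d$ with $-\log\mathbb E(e^{-\boldsymbol\lambda\cdot\tilde{\boldsymbol\mu}(A)})=\int_{\Omega_d}(1-e^{-\boldsymbol\lambda\cdot\mathbf s})\,\nu_A(d\mathbf s)$ for all $\boldsymbol\lambda\in[0,+\infty)^d$. Homogeneous means (jumps independent of atoms) that $\nu_A=\alpha(A)\,\nu$ for all $A$, for some finite nonzero base measure $\alpha$ on $\mathbb X$ and some measure $\nu$ on $\Omega_d$ (the L\'evy measure). Equal marginals means that $\tilde\mu_1,\dots,\tilde\mu_d$ have the same law; then all one-dimensional marginals of $\nu$, restricted to $\Omega_1=(0,+\infty)$,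 equal a common measure $\overline\nu$. Infinitely active means that each $\tilde\mu_i$ has infinitely many jumps, i.e. $\overline\nu(\Omega_1)=+\infty$. Finite second moments means $\mathbb E(\|\tilde{\boldsymbol\mu}(A)\|^2)<+\infty$ for every set $A$. $\tilde{\boldsymbol\mu}^{\mathrm{co}}$ is the CRV with the same marginal laws as $\tilde{\boldsymbol\mu}$ whose components are almost surely all equal; $\tilde{\boldsymbol\mu}^\perp$ is the CRV with the same marginal laws as $\tilde{\boldsymbol\mu}$ whose components are independent. Extended Wasserstein distance: $\mathcal M_2(\Omega_d)$ is the set of positive Borel measures $\nu$ on $\Omega_d$ with $\int_{\Omega_d}\|\mathbf s\|^2d\nu(\mathbf s)<+\infty$. For $(\mathbf s,\mathbf s')\in[0,+\infty)^{2d}$ let $\pi_1(\mathbf s,\mathbf s')=\mathbf s$, $\pi_2(\mathbf s,\mathbf s')=\mathbf s'$. For $\nu^1,\nu^2\in\mathcal M_2(\Omega_d)$ let $\overline\Gamma(\nu^1,\nu^2)$ be the set of $\gamma\in\mathcal M_2(\Omega_{2d})$ such that the restriction to $\Omega_d$ of the pushforward ${\pi_i}_\#\gamma$ equals $\nu^i$, $i=1,2$, and $$\mathcal W_*(\nu^1,\nu^2)^2=\inf_{\gamma\in\overline\Gamma(\nu^1,\nu^2)}\iint_{\Omega_{2d}}\|\mathbf s-\mathbf s'\|^2\,d\gamma(\mathbf s,\mathbf s').$$ *)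

(* Defs.v *)
From HB Require Import structures.
From mathcomp Require Export all_boot all_order all_algebra.
From mathcomp Require Export all_classical all_reals all_analysis.
From mathcomp Require Export measurable_realfun.
Export Order.TTheory GRing.Theory Num.Theory.
Export numFieldNormedType.Exports.

Set Implicit Arguments.
Unset Strict Implicit.
Unset Printing Implicit Defensive.

Local Open Scope classical_set_scope.
Local Open Scope ring_scope.
Local Open Scope ereal_scope.

Definition separable (T : topologicalType) : Prop :=
  exists2 S : set T, countable S & dense S.

(* The complete pseudometric is a metric exactly when the space is Hausdorff. *)
Definition polish (R : realType) (X : completePseudoMetricType R) : Prop :=
  hausdorff_space X /\ separable X.

Notation borel X := (g_sigma_algebraType (@open X)).

Definition mutually_independent (R : realType) (dO : measure_display)
    (Om : measurableType dO) (P : probability Om R) (n : nat) (T : Type)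
    (G : set (set T)) (Y : 'I_n -> Om -> T) : Prop :=
  forall (J : {set 'I_n}) (E : 'I_n -> set T), (forall j, G (E j)) ->
    P (\bigcap_(j in [set` J]) (Y j @^-1` E j)) =
    \prod_(j in J) P (Y j @^-1` E j).

Definition eq_in_law (R : realType) (T : Type) (G : set (set T))
    (dO1 : measure_display) (Om1 : measurableType dO1)
    (P1 : probability Om1 R) (Y1 : Om1 -> T)
    (dO2 : measure_display) (Om2 : measurableType dO2)
    (P2 : probability Om2 R) (Y2 : Om2 -> T) : Prop :=
  forall E : set T, G E -> P1 (Y1 @^-1` E) = P2 (Y2 @^-1` E).

Section Vectors.
Context {R : realType} {d : nat}.
Local Open Scope ring_scope.

Definition dotv (s t : d.-tuple R) : R := \sum_(i < d) tnth s i * tnth t i.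

Definition sqnormv (s : d.-tuple R) : R := \sum_(i < d) tnth s i ^+ 2.

Definition sqdistv (s t : d.-tuple R) : R :=
  \sum_(i < d) (tnth s i - tnth t i) ^+ 2.

Definition nnegv (s : d.-tuple R) : Prop := forall i, 0 <= tnth s i.

Definition Omega : set (d.-tuple R) :=
  [set s | nnegv s /\ exists i, tnth s i != 0].

Definition Omega2 : set (d.-tuple R * d.-tuple R) :=
  [set p | [/\ nnegv p.1, nnegv p.2 &
               (exists i, tnth p.1 i != 0) \/ (exists i, tnth p.2 i != 0)]].

End Vectors.
Arguments Omega R d : clear implicits.
Arguments Omega2 R d : clear implicits.

(* A measure on [Omega R d] (resp. [Omega2 R d]) is encoded as a measure on the
   ambient space that vanishes on the complement. *)
Section ExtendedWasserstein.
Context {R : realType} {d : nat}.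

Definition on_Omega (nu : {measure set (d.-tuple R) -> \bar R}) : Prop :=
  nu (~` Omega R d) = 0.

Definition extended_coupling (nu1 nu2 : {measure set (d.-tuple R) -> \bar R})
    : set {measure set (d.-tuple R * d.-tuple R)%type -> \bar R} :=
  [set gamma |
    [/\ gamma (~` Omega2 R d) = 0,
        \int[gamma]_(p in Omega2 R d) (sqnormv p.1 + sqnormv p.2)%:E < +oo,
        (forall B, measurable B -> B `<=` Omega R d ->
          pushforward gamma fst B = nu1 B) &
        (forall B, measurable B -> B `<=` Omega R d ->
          pushforward gamma snd B = nu2 B)]].

Definition extended_wasserstein
    (nu1 nu2 : {measure set (d.-tuple R) -> \bar R}) : \bar R :=
  sqrte (ereal_inf
    [set \int[gamma]_(p in Omega2 R d) (sqdistv p.1 p.2)%:E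
    | gamma in extended_coupling nu1 nu2]).

End ExtendedWasserstein.

Section RandomMeasures.
Context {R : realType} (X : completePseudoMetricType R).

Local Notation M := {measure set (borel X) -> \bar R}.

(* The sigma-algebra generated by the evaluations m |-> m A, A Borel. *)
Definition measure_events : set (set M) :=
  <<s [set E | exists A : set (borel X), exists B : set (\bar R),
        [/\ measurable A, measurable B & E = [set m : M | B (m A)]]] >>.

(* The d-fold product of [measure_events]. *)
Definition measure_vector_events (d : nat) : set (set ('I_d -> M)) :=
  <<s [set F | exists i : 'I_d, exists2 E : set M, measure_events E &
        F = [set m : 'I_d -> M | E (m i)]] >>.

End RandomMeasures.

(* A vector of (finite) random measures on X is a family of finite transition
   kernels from the probability space to the Borel space of X. *)
Section CompletelyRandomVectors.
Context {R : realType} {X : completePseudoMetricType R} {d : nat}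
  {dO : measure_display} {Om : measurableType dO}.
Variables (P : probability Om R) (mu : 'I_d -> R.-ftker Om ~> borel X).

Definition evalv (A : set (borel X)) (w : Om) : d.-tuple R :=
  [tuple fine (mu i w A) | i < d].

Definition random_measure (i : 'I_d) (w : Om)
  : {measure set (borel X) -> \bar R} := mu i w.

Definition random_vector (w : Om)
  : 'I_d -> {measure set (borel X) -> \bar R} := random_measure ^~ w.

Definition completely_random : Prop :=
  forall (n : nat) (A : 'I_n -> set (borel X)), (2 <= n)%N ->
    (forall j, measurable (A j)) -> trivIset setT A ->
    mutually_independent P (@measurable _ (d.-tuple R)) (fun j => evalv (A j)).

Definition no_fixed_atoms : Prop :=
  forall (x : X) (i : 'I_d), {ae P, forall w, mu i w [set x] = 0}.

Definition is_levy_intensity (A : set (borel X))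
    (nu : {measure set (d.-tuple R) -> \bar R}) : Prop :=
  on_Omega nu /\
  forall lam : d.-tuple R, nnegv lam ->
    - lne 'E_P[fun w => expR (- dotv lam (evalv A w))%R] =
    \int[nu]_(s in Omega R d) (1 - expR (- dotv lam s))%:E.

(* In the Levy-Khintchine representation of the Laplace exponent of mu(A), a
   deterministic drift would contribute an additional term linear in lam. *)
Definition driftless : Prop :=
  forall A : set (borel X), measurable A ->
    exists nu, is_levy_intensity A nu.

Definition crv : Prop := [/\ completely_random, no_fixed_atoms & driftless].

(* Levy intensities are unique, so the choice made by [cid] is immaterial. *)
Definition levy_intensity (A : set (borel X))
    : {measure set (d.-tuple R) -> \bar R} :=
  match pselect (exists nu, is_levy_intensity A nu) with
  | left h => projT1 (cid h)
  | right _ => mzero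
  end.

(* The product is the one of \bar R, where 0 * +oo = 0. *)
Definition homogeneous (alpha : {finite_measure set (borel X) -> \bar R})
    (nu : {measure set (d.-tuple R) -> \bar R}) : Prop :=
  [/\ alpha setT != 0, on_Omega nu &
      forall (A : set (borel X)) (B : set (d.-tuple R)),
        measurable A -> measurable B ->
        levy_intensity A B = alpha A * nu B].

Definition equal_marginals : Prop :=
  forall i j, eq_in_law (measure_events (X := X))
    P (random_measure i) P (random_measure j).

Definition finite_second_moments : Prop :=
  forall A : set (borel X), measurable A ->
    'E_P[fun w => sqnormv (evalv A w)] < +oo.

Definition components_ae_equal : Prop :=
  {ae P, forall w, forall i j (A : set (borel X)), measurable A ->
    mu i w A = mu j w A}.

Definition components_independent : Prop :=
  mutually_independent P (measure_events (X := X)) random_measure.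

End CompletelyRandomVectors.

Definition levy_marginal (R : realType) (d : nat)
    (nu : {measure set (d.-tuple R) -> \bar R}) (i : 'I_d) (B : set R) : \bar R :=
  pushforward nu (fun s : d.-tuple R => tnth s i) (B `&` `]0%R, +oo[).

Definition infinitely_active (R : realType) (d : nat)
    (nu : {measure set (d.-tuple R) -> \bar R}) : Prop :=
  forall i : 'I_d, levy_marginal nu i setT = +oo.

Section Index.
Context {R : realType} {X : completePseudoMetricType R} {d : nat}.

Definition same_law
    (dO1 : measure_display) (Om1 : measurableType dO1)
    (P1 : probability Om1 R) (mu1 : 'I_d -> R.-ftker Om1 ~> borel X)
    (dO2 : measure_display) (Om2 : measurableType dO2)
    (P2 : probability Om2 R) (mu2 : 'I_d -> R.-ftker Om2 ~> borel X) : Prop :=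
  eq_in_law (@measure_vector_events R X d)
    P1 (random_vector mu1) P2 (random_vector mu2).

Definition same_marginals
    (dO1 : measure_display) (Om1 : measurableType dO1)
    (P1 : probability Om1 R) (mu1 : 'I_d -> R.-ftker Om1 ~> borel X)
    (dO2 : measure_display) (Om2 : measurableType dO2)
    (P2 : probability Om2 R) (mu2 : 'I_d -> R.-ftker Om2 ~> borel X) : Prop :=
  forall i, eq_in_law (measure_events (X := X))
    P1 (random_measure mu1 i) P2 (random_measure mu2 i).

Definition crv_distance
    (dO1 : measure_display) (Om1 : measurableType dO1)
    (P1 : probability Om1 R) (mu1 : 'I_d -> R.-ftker Om1 ~> borel X)
    (dO2 : measure_display) (Om2 : measurableType dO2)
    (P2 : probability Om2 R) (mu2 : 'I_d -> R.-ftker Om2 ~> borel X) : \bar R :=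
  ereal_sup
    [set extended_wasserstein (levy_intensity P1 mu1 A) (levy_intensity P2 mu2 A)
    | A in [set A : set (borel X) | measurable A]].

(* The competitors mu' may live on arbitrary probability spaces. *)
Definition max_sq_distance
    (dO : measure_display) (Om : measurableType dO)
    (P : probability Om R) (mu : 'I_d -> R.-ftker Om ~> borel X)
    (dOc : measure_display) (Omc : measurableType dOc)
    (Pc : probability Omc R) (mu_co : 'I_d -> R.-ftker Omc ~> borel X) : \bar R :=
  ereal_sup
    [set D2 | exists (dO' : measure_display) (Om' : measurableType dO')
       (P' : probability Om' R) (mu' : 'I_d -> R.-ftker Om' ~> borel X),
       [/\ crv P' mu', same_marginals P' mu' P mu &
           D2 = crv_distance P' mu' Pc mu_co ^+ 2]].

(* Division is the one of \bar R; its degenerate values (0 / 0 = +oo / +oo = 0)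
   do not occur for the vectors of interest, whose maximal distance is positive
   and finite. *)
Definition wasserstein_index
    (dO : measure_display) (Om : measurableType dO)
    (P : probability Om R) (mu : 'I_d -> R.-ftker Om ~> borel X)
    (dOc : measure_display) (Omc : measurableType dOc)
    (Pc : probability Omc R) (mu_co : 'I_d -> R.-ftker Omc ~> borel X) : \bar R :=
  1 - crv_distance P mu Pc mu_co ^+ 2 / max_sq_distance P mu Pc mu_co.

End Index.

(* Main.v *)
(* Let psi_A(lam) be the Laplace exponent of mu(A).  Uniqueness of Laplace
   transforms determines the Levy intensity from psi_A, and the atoms of the
   algebra generated by A_1, ..., A_n reduce the law of a completely random
   vector to the exponents psi_A.  Hence equality in law means equality of all
   Levy intensities.  The intensity k of mu_co lives on the diagonal, because
   2 psi(e_i + e_j) - psi(2 e_i) - psi(2 e_j) is the integral of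
   (e^(-s_i) - e^(-s_j))^2, and the one of mu_perp lives on the axes.  By
   homogeneity the suprema over A are attained at A = X.

   A coupling of n with k, whose second marginal is s' = (t, ..., t), costs
   the fixed second moments minus 2 E[sigma t], sigma = s_1 + ... + s_d, and
   E[sigma t] is the integral over b of E[sigma 1_{t > b}].  With V(b) the
   k-mass of {t > b} and l any level, E[sigma 1_{t > b}] is at most
   E[(sigma - l)^+] + l V(b), with equality for the comonotone coupling if
   n{sigma > l} <= V(b) <= n{sigma >= l}.  Superadditivity of r |-> (r - l)^+
   makes E[(sigma - l)^+] minimal, among intensities with given marginals,
   exactly on the axes; so the intensity of mu_perp is the farthest from k,
   and any mass off the axes strictly decreases the distance. *)
From HB Require Import structures.
Require Import Defs.
From mathcomp Require Import ring lra.

Set Implicit Arguments.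
Unset Strict Implicit.
Unset Printing Implicit Defensive.

Local Open Scope classical_set_scope.
Local Open Scope ring_scope.
Local Open Scope ereal_scope.

(** The intensities have infinite mass near the origin, and this shapes most steps. Uniqueness of
    Laplace transforms is proved with an integrable weight and used with 1 - e^(-n |s|), |s| the sum
    of the coordinates: psi(lam + n 1) - psi(lam) integrates this weight against e^(-lam.s).
    Quantiles count mass from the top, and atoms of sigma are split by an auxiliary uniform
    variable, so the comonotone coupling exists without any continuity of the tails. No optimal
    coupling of the axes intensity with k is constructed, so the strict inequality needs one gap
    valid for all its couplings. It is found uniformly on an interval [b0, 2 b0] of layers and
    carried to the correlation by Riemann sums in b. Competitors need not be homogeneous: at each A
    they are compared with mu_perp at the same A, and only then is A replaced by X. Sets of zero
    base mass, where infinite activity fails, are treated apart. Second moments are given for mu(A),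
    not for its intensity; they are transferred by second differences of psi and Fatou's lemma. *)

Section Integration.
Context {R : realType}.

(** The measure structure on [pushforward] depends on a proof of measurability, which unification
    leaves open; the tactic term fills it with [mf]. *)
Definition image_measure d1 d2 (T1 : measurableType d1) (T2 : measurableType d2)
    (m : {measure set T1 -> \bar R}) (f : T1 -> T2)
    (mf : measurable_fun [set: T1] f) : {measure set T2 -> \bar R} :=
  ltac:(refine (pushforward m f : {measure set T2 -> \bar R}); exact: mf).

Lemma integral_image_measure d1 d2 (T1 : measurableType d1)
    (T2 : measurableType d2) (m : {measure set T1 -> \bar R}) (f : T1 -> T2)
    (mf : measurable_fun [set: T1] f) (g : T2 -> \bar R) :
  measurable_fun [set: T2] g -> (forall y, 0 <= g y) ->
  \int[image_measure m mf]_y g y = \int[m]_x g (f x).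
Proof.
move=> mg g0.
rewrite (_ : \int[image_measure m mf]_y g y = \int[pushforward m f]_y g y)//.
by rewrite ge0_integral_pushforward// preimage_setT.
Qed.

(** The laws are compared inside [D] only, because the marginals met later agree off the origin but
    may give it different, even infinite, masses; in return [f] has to vanish off [D]. *)
Lemma eq_law_integral d1 d2 d3 (T1 : measurableType d1) (T2 : measurableType d2)
    (S : measurableType d3) (m1 : {measure set T1 -> \bar R})
    (m2 : {measure set T2 -> \bar R}) (Y1 : T1 -> S) (Y2 : T2 -> S) (D : set S)
    (f : S -> \bar R) :
  measurable_fun [set: T1] Y1 -> measurable_fun [set: T2] Y2 -> measurable D ->
  (forall B, measurable B -> B `<=` D -> m1 (Y1 @^-1` B) = m2 (Y2 @^-1` B)) ->
  measurable_fun [set: S] f -> (forall y, 0 <= f y) ->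
  (forall y, ~ D y -> f y = 0) ->
  \int[m1]_x f (Y1 x) = \int[m2]_x f (Y2 x).
Proof.
move=> mY1 mY2 mD m12 mf f0 fD.
rewrite -(integral_image_measure m1 mY1)// -(integral_image_measure m2 mY2)//.
have fE (m : {measure set S -> \bar R}) : \int[m]_y f y = \int[m]_(y in D) f y.
  rewrite [RHS]integral_mkcond; apply: eq_integral => y _.
  by rewrite patchE; case: ifPn => // /negP; rewrite inE => /fD.
by rewrite !fE; apply: eq_measure_integral => A mA AD; apply: m12.
Qed.

Lemma ge0_integral_ae0 d (T : measurableType d) (m : {measure set T -> \bar R})
    (N : set T) (f g : T -> \bar R) :
  measurable N -> m N = 0 -> measurable_fun setT f -> measurable_fun setT g ->
  (forall x, 0 <= f x) -> (forall x, 0 <= g x) ->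
  (forall x, ~ N x -> f x = g x) -> \int[m]_x f x = \int[m]_x g x.
Proof.
move=> mN N0 mf mg f0 g0 fg; apply: ge0_ae_eq_integral => //.
exists N; split => // x /= /not_implyP[_ fgx].
by apply: contrapT => /fg.
Qed.

Lemma ge0_le_integral_ae0 d (T : measurableType d)
    (m : {measure set T -> \bar R}) (N : set T) (f g : T -> \bar R) :
  measurable N -> m N = 0 -> measurable_fun setT f -> measurable_fun setT g ->
  (forall x, 0 <= f x) -> (forall x, 0 <= g x) ->
  (forall x, ~ N x -> f x <= g x) -> \int[m]_x f x <= \int[m]_x g x.
Proof.
move=> mN N0 mf mg f0 g0 fg; apply: ae_ge0_le_integral => //.
exists N; split => // x /= /not_implyP[_ fgx].
by apply: contrapT => /fg.
Qed.

Lemma ge0_integral_eq0 d (T : measurableType d) (m : {measure set T -> \bar R})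
    (f : T -> \bar R) (E : set T) :
  measurable_fun setT f -> (forall x, 0 <= f x) -> \int[m]_x f x = 0 ->
  measurable E -> (forall x, E x -> f x != 0) -> m E = 0.
Proof.
move=> mf f0 if0 mE Ef; have : ae_eq m setT f (cst 0).
  apply/ae_eq_integral_abs => //.
  by under eq_integral do rewrite gee0_abs//.
move=> [N [mN N0 sN]]; apply: (subset_measure0 mE mN) => // x Ex.
by apply: sN => /=; apply/not_implyP; split => //; apply/eqP/Ef.
Qed.

Lemma measurable_forall d (T : measurableType d) (n : nat)
    (P : 'I_n -> set T) :
  (forall i, measurable (P i)) -> measurable [set x | forall i, P i x].
Proof.
move=> mP; rewrite (_ : mkset _ = \bigcap_(i in [set: 'I_n]) P i).
  by apply: fin_bigcap_measurable.
by apply/seteqP; split => x /= h i; [move=> _; exact: h | exact: h].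
Qed.

Lemma measurable_exists d (T : measurableType d) (n : nat)
    (P : 'I_n -> set T) :
  (forall i, measurable (P i)) -> measurable [set x | exists i, P i x].
Proof.
move=> mP; rewrite (_ : mkset _ = \bigcup_(i in [set: 'I_n]) P i).
  by apply: fin_bigcup_measurable.
by apply/seteqP; split => x /= [i]; [exists i | move=> _ ?; exists i].
Qed.

End Integration.

(** * Measurability and linear algebra of vectors *)

Section VectorMeasurability.
Context {R : realType} {d : nat}.
Implicit Types s lam : d.-tuple R.

Definition coord (i : 'I_d) s : R := tnth s i.

Lemma measurable_coord i : measurable_fun setT (coord i).
Proof. exact: measurable_tnth. Qed.

Lemma measurable_tupleP d1 (T : measurableType d1) (f : T -> d.-tuple R) :
  (forall i, measurable_fun setT (fun x => tnth (f x) i)) -> measurable_fun setT f.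
Proof. by move=> h; apply/measurable_fun_tnthP => i; exact: h. Qed.

Lemma measurable_dotv lam : measurable_fun setT (dotv lam).
Proof.
apply: measurable_sum => i; apply: measurable_funM => //.
exact: measurable_coord.
Qed.

Lemma measurable_sqnormv : measurable_fun setT (@sqnormv R d).
Proof.
apply: measurable_sum => i; apply: measurable_funX; exact: measurable_coord.
Qed.

Lemma measurable_nnegv : measurable [set s : d.-tuple R | nnegv s].
Proof.
apply: measurable_forall => i.
have := measurable_coord i measurableT (measurable_itv `[0%R, +oo[).
by rewrite setTI; congr measurable; apply/seteqP; split => s /=;
  rewrite in_itv/= andbT.
Qed.

Lemma measurable_coord_neq0 i : measurable [set s : d.-tuple R | (tnth s i != 0)%R].
Proof.
have := measurable_coord i measurableT (measurableC (measurable_set1 (0%R : R))).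
by rewrite setTI; congr measurable; apply/seteqP; split => s /= /eqP.
Qed.

Lemma measurable_Omega : measurable (Omega R d).
Proof.
rewrite (_ : Omega R d = [set s | nnegv s] `&`
  [set s | exists i, (tnth s i != 0)%R]); last by apply/seteqP; split => s [].
apply: measurableI; first exact: measurable_nnegv.
exact (measurable_exists measurable_coord_neq0).
Qed.

Lemma dotv_ge0 lam s : nnegv lam -> nnegv s -> (0 <= dotv lam s)%R.
Proof. by move=> l0 s0; apply: sumr_ge0 => i _; apply: mulr_ge0. Qed.

Definition vone : d.-tuple R := [tuple 1%R | i < d].
Definition vunit (i : 'I_d) (a : R) : d.-tuple R := [tuple (if j == i then a else 0%R) | j < d].
Definition vadd s lam : d.-tuple R := [tuple (tnth s i + tnth lam i)%R | i < d].
Definition vscale (a : R) s : d.-tuple R := [tuple (a * tnth s i)%R | i < d].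
Definition vsum s : R := (\sum_(i < d) tnth s i)%R.

Lemma dotv_one s : dotv vone s = vsum s.
Proof. by apply: eq_bigr => i _; rewrite tnth_mktuple mul1r. Qed.

Lemma dotv_unit i a s : dotv (vunit i a) s = (a * tnth s i)%R.
Proof.
rewrite /dotv (bigD1 i)//= tnth_mktuple eqxx big1 ?addr0// => j ji.
by rewrite tnth_mktuple (negbTE ji) mul0r.
Qed.

Lemma dotvD lam lam' s : dotv (vadd lam lam') s = (dotv lam s + dotv lam' s)%R.
Proof.
by rewrite /dotv -big_split/=; apply: eq_bigr => i _; rewrite tnth_mktuple mulrDl.
Qed.

Lemma dotvZ a lam s : dotv (vscale a lam) s = (a * dotv lam s)%R.
Proof.
by rewrite /dotv big_distrr/=; apply: eq_bigr => i _; rewrite tnth_mktuple mulrA.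
Qed.

Lemma nnegv_one : nnegv vone.
Proof. by move=> i; rewrite tnth_mktuple ler01. Qed.
Lemma nnegv_unit i a : (0 <= a)%R -> nnegv (vunit i a).
Proof. by move=> a0 j; rewrite tnth_mktuple; case: ifP. Qed.
Lemma nnegvD lam lam' : nnegv lam -> nnegv lam' -> nnegv (vadd lam lam').
Proof. by move=> h h' i; rewrite tnth_mktuple addr_ge0. Qed.
Lemma nnegvZ a lam : (0 <= a)%R -> nnegv lam -> nnegv (vscale a lam).
Proof. by move=> h h' i; rewrite tnth_mktuple mulr_ge0. Qed.

Lemma vsum_ge0 s : nnegv s -> (0 <= vsum s)%R.
Proof. by move=> s0; apply: sumr_ge0. Qed.

Lemma le_vsum s i : nnegv s -> (tnth s i <= vsum s)%R.
Proof.
move=> s0; rewrite /vsum (bigD1 i)//= lerDl; exact: sumr_ge0.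
Qed.

Lemma Omega_vsum s : Omega R d s -> (0 < vsum s)%R.
Proof.
move=> [s0 [i si]]; apply: lt_le_trans (le_vsum i s0).
by rewrite lt0r si s0.
Qed.

Lemma notOmega s : nnegv s -> ~ Omega R d s -> forall i, tnth s i = 0%R.
Proof.
move=> s0 nO i; apply/eqP; apply: contrapT => /negP si; apply: nO.
by split => //; exists i.
Qed.

Lemma measurable_vsum : measurable_fun setT vsum.
Proof. by apply: measurable_sum => i; exact: measurable_coord. Qed.

End VectorMeasurability.

(** * Uniqueness of Laplace transforms and of Levy measures *)

Section RayApproximation.
Context {R : realType} {d : nat}.
Local Open Scope ring_scope.

(** Since e^(n x) is the square of e^(n x / 2), it is at least (n x / 2)^2, so the sequence is at
    most 4 / (n x^2). *)
Lemma nat_expR_cvg0 (x : R) : (0 < x)%R ->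
  (n%:R * expR (- (n%:R * x)))%R @[n --> \oo] --> (0 : R).
Proof.
move=> x0; apply/cvgrPdist_le => e e0; near=> n.
have n0 : (0 < n%:R :> R)%R by rewrite ltr0n; near: n; exists 1%N.
rewrite sub0r normrN ger0_norm ?mulr_ge0 ?expR_ge0//.
have h : ((n%:R * x / 2) ^+ 2 <= expR (n%:R * x))%R.
  rewrite [in leRHS](_ : n%:R * x = 2%:R * (n%:R * x / 2)); last by field.
  rewrite expRM_natl lerXn2r ?nnegrE ?expR_ge0//.
    by rewrite divr_ge0// mulr_ge0 ?ltW.
  by apply: le_trans (expR_ge1Dx _); rewrite lerDr.
have h2 : (4 / (e * x ^+ 2) <= n%:R)%R.
  near: n; exists (Num.truncn (4 / (e * x ^+ 2))).+1 => // m /= mn.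
  by apply/ltW; apply: lt_le_trans (truncnS_gt _) _; rewrite ler_nat.
rewrite expRN ler_pdivrMr ?expR_gt0//.
apply: le_trans (_ : e * ((n%:R * x / 2) ^+ 2) <= _)%R; last first.
  by rewrite ler_wpM2l// ltW.
have ex0 : (0 < e * x ^+ 2)%R by rewrite mulr_gt0// exprn_gt0.
move: h2; rewrite ler_pdivrMr// => h2.
have -> : (e * (n%:R * x / 2) ^+ 2 = n%:R * (n%:R * (e * x ^+ 2)) / 4)%R by field.
rewrite ler_pdivlMr ?ltr0n// ler_wpM2l// ltW//.
Unshelve. all: by end_near. Qed.

(** The exponent k slightly exceeds n e^(n a), so (1 - e^(-n x))^k behaves like exp(-n e^(n (a -
    x))): it tends to 1 for x > a and to 0 for x <= a. The factor n is what forces the limit 0 at x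
    = a as well. *)
Definition ray_exponent (a : R) (n : nat) : nat :=
  (n * (Num.truncn (expR (n%:R * a))).+1)%N.

Definition ray_approx (a : R) (n : nat) (x : R) : R :=
  ((1 - expR (- (n%:R * x))) ^+ ray_exponent a n)%R.

Lemma expR_bern (y : R) (m : nat) : 0 <= y <= 1 -> 1 - m%:R * y <= (1 - y) ^+ m.
Proof.
move=> /andP[y0 y1]; elim: m => [|m ih]; first by rewrite mul0r subr0 expr0.
rewrite exprS; apply: le_trans (_ : (1 - y) * (1 - m%:R * y) <= _)%R; last first.
  by rewrite ler_wpM2l// subr_ge0.
rewrite -natr1; have : (0 <= m%:R * y ^+ 2)%R by rewrite mulr_ge0// exprn_ge0.
lra.
Qed.

Lemma ray_approx01 a n x : (0 <= x)%R -> (0 <= ray_approx a n x <= 1)%R.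
Proof.
move=> x0; have h : 0 <= 1 - expR (- (n%:R * x)) <= 1.
  by rewrite subr_ge0 expR_le1 oppr_le0 mulr_ge0//= gerBl expR_ge0.
by case/andP: h => h0 h1; rewrite exprn_ge0//= exprn_ile1.
Qed.

Lemma ray_approx_cvg (a x : R) : (0 <= a)%R -> (0 <= x)%R ->
  ray_approx a n x @[n --> \oo] --> ((a < x)%R%:R : R).
Proof.
move=> a0 x0; have [ax|xa] := ltP a x.
  (* Bernoulli's inequality bounds the power below by 1 - k e^(-n x). The factor 2 absorbs the
     rounding in [ray_exponent]: truncation plus one is at most 2 e^(n a), because e^(n a) >= 1. *)
  have : (1 - 2 * (n%:R * expR (- (n%:R * (x - a)))))%R @[n --> \oo] --> (1 - 2 * 0 : R).
    apply: cvgB; first exact: cvg_cst.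
    by apply: cvgMr; apply: nat_expR_cvg0; rewrite subr_gt0.
  rewrite mulr0 subr0 => h.
  apply: squeeze_cvgr h (cvg_cst (1 : R)) => //.
  near=> n; have /andP[r0 ->] := ray_approx01 a n x0; rewrite andbT.
  apply: le_trans (expR_bern _ _); last first.
    by rewrite expR_ge0 expR_le1 oppr_le0 mulr_ge0.
  rewrite lerD2l lerN2 natrM.
  have -> : expR (- (n%:R * (x - a))) = (expR (n%:R * a) * expR (- (n%:R * x)))%R :> R.
    by rewrite -expRD; congr expR; ring.
  rewrite -mulrA [leRHS]mulrCA ler_wpM2l// mulrA ler_wpM2r ?expR_ge0//.
  have : (1 <= expR (n%:R * a))%R by apply: le_trans (expR_ge1Dx _); rewrite lerDl mulr_ge0.
  rewrite -natr1 => e1; have := @truncn_le R (expR (n%:R * a)).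
  by rewrite expR_ge0 => ?; lra.
rewrite mulr0n; apply: squeeze_cvgr (cvg_cst (0 : R)) (@cvgn_expR R).
near=> n; have /andP[-> _] := ray_approx01 a n x0 => /=.
(* From 1 - y <= e^(-y) with y = e^(-n x), the power is at most e^(-k y), and k y >= n when x <=
   a. *)
apply: le_trans (_ : expR (- expR (- (n%:R * x))) ^+ ray_exponent a n <= _)%R.
  rewrite lerXn2r ?nnegrE ?expR_ge0//; last first.
    by apply: le_trans (expR_ge1Dx _).
  by rewrite subr_ge0 expR_le1 oppr_le0 mulr_ge0.
rewrite -expRM_natl ler_expR mulrN lerN2 natrM -mulrA.
rewrite -[leLHS]mulr1 ler_wpM2l//.
apply: le_trans (_ : expR (n%:R * a) * expR (- (n%:R * x)) <= _)%R.
  by rewrite -expRD; apply: le_trans (expR_ge1Dx _); rewrite lerDl -mulrBr mulr_ge0// subr_ge0.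
by rewrite ler_wpM2r ?expR_ge0// ltW// truncnS_gt.
Unshelve. all: by end_near. Qed.

End RayApproximation.

Lemma measure_conegligible_setI d (T : measurableType d) (R : realType)
    (m : {measure set T -> \bar R}) (N B : set T) :
  measurable N -> measurable B -> m (~` N) = 0 -> m (N `&` B) = m B.
Proof.
move=> mN mB N0; rewrite [RHS](measureDI m mB mN) setIC.
rewrite [X in _ = X + _](_ : _ = 0) ?add0e//.
apply: (subset_measure0 _ _ _ N0); [exact: measurableD|exact: measurableC|].
by move=> x [].
Qed.

Section WeightedMeasure.
Context {R : realType} d (T : measurableType d) (m : {measure set T -> \bar R})
  (w : T -> R).

(** The two proofs are arguments of the definition so that the measure instance can be found from
    the term alone. *)
Definition weighted_measure of measurable_fun setT w & (forall x, 0 <= w x)%R :=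
  fun B : set T => \int[m]_(x in B) (w x)%:E.

Variables (mw : measurable_fun setT w) (w0 : forall x, (0 <= w x)%R).
Local Notation wm := (weighted_measure mw w0).

Let wm0 : wm set0 = 0. Proof. exact: integral_set0. Qed.
Let wm_ge0 B : 0 <= wm B.
Proof. by apply: integral_ge0 => x _; rewrite lee_fin. Qed.
Let wm_sigma_additive : semi_sigma_additive wm.
Proof.
move=> F mF tF mUF; rewrite /weighted_measure ge0_integral_bigcup//.
- by apply: is_cvg_nneseries => n _ _; exact: wm_ge0.
- by apply/measurable_EFinP; exact: measurable_funTS.
- by move=> x _; rewrite lee_fin.
Qed.

HB.instance Definition _ := isMeasure.Build _ _ _ wm wm0 wm_ge0 wm_sigma_additive.

Lemma weighted_measure_indic B : measurable B ->
  wm B = \int[m]_x (w x * \1_B x)%:E.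
Proof.
move=> mB; rewrite /weighted_measure integral_mkcond; apply: eq_integral => x _.
by rewrite patchE indicE; case: (x \in B); rewrite ?mulr1 ?mulr0.
Qed.

End WeightedMeasure.

Section LaplaceUniqueness.
Context {R : realType} {d : nat}.
Local Open Scope ring_scope.

Definition upper_orthant (a : 'I_d -> R) : set (d.-tuple R) :=
  [set s | forall i, a i < tnth s i].

Definition upper_orthants : set (set (d.-tuple R)) := range upper_orthant.

Lemma measurable_upper_orthants : @measurable _ (d.-tuple R) = <<s upper_orthants >>.
Proof.
apply/seteqP; split => [A|]; last first.
  apply: smallest_sub; first exact: sigma_algebra_measurable.
  move=> _ [a _ <-]; apply: measurable_forall => i.
  have := measurable_coord i measurableT (measurable_itv `]a i, +oo[).
  by rewrite setTI; congr measurable; apply/seteqP; split => s /=;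
    rewrite in_itv/= andbT.
apply: smallest_sub; first exact: smallest_sigma_algebra.
move=> B; rewrite -bigcup_seq => -[i _ [C mC <-]].
suff : @measurable _ R `<=`
    image_set_system setT (fun s : d.-tuple R => tnth s i) <<s upper_orthants >>.
  by move=> /(_ _ mC).
have -> : @measurable _ R = <<s @RGenOInfty.G R >> by exact: RGenOInfty.measurableE.
apply: smallest_sub; first exact/sigma_algebra_image/smallest_sigma_algebra.
move=> _ [x ->]; rewrite /image_set_system /=.
(* A half-space is a countable union of orthants whose other bounds -k go to minus infinity. *)
rewrite (_ : _ `&` _ = \bigcup_k
    (upper_orthant (fun j => if j == i then x else - k%:R))).
  apply: sigma_algebra_bigcup => k; apply: sub_sigma_algebra.
  by exists (fun j => if j == i then x else - k%:R).
apply/seteqP; split => s /=.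
  rewrite in_itv/= andbT => -[_ xs].
  exists (Num.truncn (\sum_(j < d) `|tnth s j|)).+1 => // j.
  case: ifPn => [/eqP-> //|_].
  rewrite ltrNl; apply: le_lt_trans (truncnS_gt _).
  rewrite (bigD1 j)//= -[leLHS]addr0 lerD ?sumr_ge0//.
  by rewrite -normrN ler_norm.
by move=> [k _ /(_ i)]; rewrite eqxx in_itv/= andbT.
Qed.

Lemma upper_orthants_setI : setI_closed upper_orthants.
Proof.
move=> _ _ [a _ <-] [b _ <-]; exists (fun i => Num.max (a i) (b i)) => //.
apply/seteqP; split => s /=.
  by move=> h; split => i; have := h i; rewrite gt_max => /andP[].
by move=> [h1 h2] i; rewrite gt_max h1 h2.
Qed.

Section Class.
Variables (m1 m2 : {measure set (d.-tuple R) -> \bar R}) (w : d.-tuple R -> R).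
Hypotheses (mw : measurable_fun setT w) (w0 : forall s, 0 <= w s)
  (w_nneg : forall s, ~ nnegv s -> w s = 0)
  (wfin : (\int[m1]_s (w s)%:E < +oo)%E)
  (laplaceE : forall lam, nnegv lam ->
    (\int[m1]_s (w s * expR (- dotv lam s))%:E =
     \int[m2]_s (w s * expR (- dotv lam s))%:E)%E).

(* [laplace_determined] is stable under multiplication by (1 - e^(-n s_i))^k and
   under bounded limits, so it reaches the indicators of upper orthants. *)
Definition laplace_determined (f : d.-tuple R -> R) : Prop :=
  [/\ measurable_fun setT f, forall s, nnegv s -> 0 <= f s <= 1 &
   forall lam, nnegv lam ->
    (\int[m1]_s (w s * f s * expR (- dotv lam s))%:E =
     \int[m2]_s (w s * f s * expR (- dotv lam s))%:E)%E].

Let measurable_exp_dotv (lam : d.-tuple R) :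
  measurable_fun setT (fun s => expR (- dotv lam s)).
Proof.
apply: measurableT_comp; first exact: measurable_expR.
by apply: measurable_funN; exact: measurable_dotv.
Qed.

Let wfin2 : (\int[m2]_s (w s)%:E < +oo)%E.
Proof.
have h0 : nnegv [tuple (0 : R) | i < d] by move=> i; rewrite tnth_mktuple.
have := laplaceE h0.
have e s : dotv [tuple (0 : R) | i < d] s = 0.
  by rewrite /dotv big1// => i _; rewrite tnth_mktuple mul0r.
under eq_integral do rewrite e oppr0 expR0 mulr1.
by under [in RHS]eq_integral do rewrite e oppr0 expR0 mulr1; move=> <-.
Qed.

Let integrable_w (m : {measure set (d.-tuple R) -> \bar R}) :
  (\int[m]_s (w s)%:E < +oo)%E -> m.-integrable setT (fun s => (w s)%:E).
Proof.
move=> h; apply/integrableP; split; first exact/measurable_EFinP.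
by under eq_integral do rewrite gee0_abs ?lee_fin//.
Qed.

Let wf_ge0 f lam s : laplace_determined f -> 0 <= w s * f s * expR (- dotv lam s).
Proof.
move=> [_ f01 _]; have [s0|/w_nneg->] := pselect (nnegv s); last by rewrite !mul0r.
by rewrite !mulr_ge0 ?expR_ge0//; case/andP: (f01 _ s0).
Qed.

Let mwf f lam : laplace_determined f ->
  measurable_fun setT (fun s => (w s * f s * expR (- dotv lam s))%:E).
Proof.
move=> [mf _ _]; apply/measurable_EFinP.
by apply: measurable_funM; [exact: measurable_funM|exact: measurable_exp_dotv].
Qed.

Let wf_le f lam s : laplace_determined f -> nnegv lam ->
  w s * f s * expR (- dotv lam s) <= w s.
Proof.
move=> [_ f01 _] lam0.
have [s0|/w_nneg->] := pselect (nnegv s); last by rewrite !mul0r.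
have /andP[f0 f1] := f01 _ s0.
rewrite -mulrA ler_piMr// mulr_ile1 ?expR_ge0// expR_le1 oppr_le0.
exact: dotv_ge0.
Qed.

Let wf_fin f lam (m : {measure set (d.-tuple R) -> \bar R}) :
  (\int[m]_s (w s)%:E < +oo)%E -> laplace_determined f -> nnegv lam ->
  (\int[m]_s (w s * f s * expR (- dotv lam s))%:E)%E \is a fin_num.
Proof.
move=> h lf l0; rewrite ge0_fin_numE; last first.
  by apply: integral_ge0 => s _; rewrite lee_fin wf_ge0.
apply: le_lt_trans h; apply: ge0_le_integral => //.
- by move=> s _; rewrite lee_fin wf_ge0.
- exact: mwf.
- exact/measurable_EFinP.
- by move=> s _; rewrite lee_fin wf_le.
Qed.

Lemma laplace_determined1 : laplace_determined (cst 1).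
Proof.
split=> [|s _|lam l0]; [exact: measurable_cst|by rewrite /= ler01 lexx|].
under eq_integral do rewrite mulr1; rewrite laplaceE//.
by under [in RHS]eq_integral do rewrite mulr1.
Qed.

(** A factor e^(-n s_i) merely shifts [lam] by n e_i. The new integral is thus a difference of two
    that agree for [m1] and [m2], and the subtraction is legitimate because [w] has finite
    integral. *)
Lemma laplace_determinedM f (i : 'I_d) (n : nat) : laplace_determined f ->
  laplace_determined (fun s => f s * (1 - expR (- (n%:R * tnth s i)))).
Proof.
move=> lf; have [mf f01 fE] := lf.
have mg : measurable_fun setT
    (fun s : d.-tuple R => 1 - expR (- (n%:R * tnth s i))).
  apply: measurable_funB => //; apply: measurableT_comp => //.
  apply: measurable_funN; apply: measurable_funM => //.
  exact: (measurable_coord i).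
have g01 (s : d.-tuple R) : nnegv s -> 0 <= 1 - expR (- (n%:R * tnth s i)) <= 1.
  by move=> s0; rewrite subr_ge0 expR_le1 oppr_le0 gerBl expR_ge0 andbT mulr_ge0.
split.
- exact: measurable_funM.
- move=> s s0; have /andP[f0 f1] := f01 s s0; have /andP[g0 g1] := g01 s s0.
  by rewrite mulr_ge0//= mulr_ile1.
- move=> lam l0.
  pose lam' := vadd lam (vunit i n%:R).
  have l'0 : nnegv lam' by apply: nnegvD => //; exact: nnegv_unit.
  have split_ (m : {measure set (d.-tuple R) -> \bar R}) :
    (\int[m]_s (w s * f s * expR (- dotv lam s))%:E =
     \int[m]_s (w s * (f s * (1 - expR (- (n%:R * tnth s i)))) * expR (- dotv lam s))%:E +
     \int[m]_s (w s * f s * expR (- dotv lam' s))%:E)%E.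
    rewrite -ge0_integralD//.
    + apply: eq_integral => s _; rewrite -EFinD; congr EFin.
      by rewrite dotvD dotv_unit opprD expRD; ring.
    + move=> s _; rewrite lee_fin.
      have [s0|/w_nneg->] := pselect (nnegv s); last by rewrite !mul0r.
      have /andP[f0 f1] := f01 s s0; have /andP[g0 g1] := g01 s s0.
      by rewrite !mulr_ge0 ?expR_ge0.
    + apply/measurable_EFinP; apply: measurable_funM; last exact: measurable_exp_dotv.
      by apply: measurable_funM => //; exact: measurable_funM.
    + by move=> s _; rewrite lee_fin wf_ge0.
    + exact: mwf.
  have := fE _ l0; rewrite (split_ m1) (split_ m2) (fE _ l'0) => e.
  have fin := wf_fin wfin2 lf l'0.
  by rewrite -[LHS](addeK _ fin) e addeK.
Qed.

Lemma laplace_determinedX f (i : 'I_d) (n k : nat) : laplace_determined f ->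
  laplace_determined (fun s => f s * (1 - expR (- (n%:R * tnth s i))) ^+ k).
Proof.
move=> lf; elim: k => [|k ih].
  by rewrite (_ : (fun _ => _) = f)//; apply/funext => s; rewrite expr0 mulr1.
rewrite (_ : (fun _ => _) = (fun s => (f s * (1 - expR (- (n%:R * tnth s i))) ^+ k) *
    (1 - expR (- (n%:R * tnth s i))))); first exact: laplace_determinedM.
by apply/funext => s; rewrite exprSr mulrA.
Qed.

(** Dominated convergence, with [w] itself as dominating function. Convergence is asked on
    nonnegative vectors only, since [w] vanishes elsewhere. *)
Lemma laplace_determined_lim (f_ : nat -> d.-tuple R -> R) (f : d.-tuple R -> R) :
  (forall n, laplace_determined (f_ n)) -> measurable_fun setT f ->
  (forall s, nnegv s -> f_ n s @[n --> \oo] --> f s) ->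
  laplace_determined f.
Proof.
move=> lf mf f_f; split => //.
- move=> s s0; have h := f_f s s0; have lf01 n : 0 <= f_ n s <= 1.
    by have [_ + _] := lf n; exact.
  rewrite -(cvg_lim _ h)//; apply/andP; split.
    by apply: limr_ge; [exact: cvgP h|apply: nearW => n; case/andP: (lf01 n)].
  by apply: limr_le; [exact: cvgP h|apply: nearW => n; case/andP: (lf01 n)].
- move=> lam l0.
  have cvg_ (m : {measure set (d.-tuple R) -> \bar R}) :
    (\int[m]_s (w s)%:E < +oo)%E ->
    (\int[m]_s (w s * f_ n s * expR (- dotv lam s))%:E @[n --> \oo] -->
     \int[m]_s (w s * f s * expR (- dotv lam s))%:E)%E.
    move=> hm; have [] // := @dominated_convergence _ _ _ m setT measurableT
      (fun n s => (w s * f_ n s * expR (- dotv lam s))%:E)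
      (fun s => (w s * f s * expR (- dotv lam s))%:E) (fun s => (w s)%:E).
    + by move=> n; exact: mwf.
    + apply/measurable_EFinP; apply: measurable_funM; last exact: measurable_exp_dotv.
      exact: measurable_funM.
    + apply: aeW => s _; apply: cvg_EFin; first exact: nearW.
      have [s0|/w_nneg->] := pselect (nnegv s).
        by apply: cvgMl; apply: cvgMr; exact: f_f.
      by rewrite !mul0r; under eq_fun do rewrite !mul0r; exact: cvg_cst.
    + exact: integrable_w.
    + by apply: aeW => s n _; rewrite gee0_abs lee_fin ?wf_ge0// wf_le.
  have h1 := cvg_ _ wfin; have h2 := cvg_ _ wfin2.
  apply: cvg_unique h2 => //.
  apply: cvg_trans h1; apply: near_eq_cvg; apply: nearW => n.
  by have [_ _ ->] := lf n.
Qed.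

Lemma laplace_determined_eq (f g : d.-tuple R -> R) : laplace_determined f ->
  measurable_fun setT g -> (forall s, nnegv s -> f s = g s) -> laplace_determined g.
Proof.
move=> lf mg fg; apply: (laplace_determined_lim (fun=> lf) mg) => s s0.
by rewrite fg//; exact: cvg_cst.
Qed.

Lemma measurable_coord_gt (i : 'I_d) (a : R) :
  measurable_fun setT (fun s : d.-tuple R => (a < tnth s i)%R%:R : R).
Proof.
rewrite (_ : (fun _ => _) = \1_(coord i @^-1` `]a, +oo[)).
  apply: measurable_indic; rewrite -[X in measurable X]setTI.
  exact: measurable_coord.
apply/funext => s; rewrite indicE; congr (nat_of_bool _)%:R.
by apply/idP/idP => [h|/set_mem/=]; [apply/mem_set|]; rewrite /= in_itv/= andbT.
Qed.

Lemma laplace_determined_ray f (i : 'I_d) (a : R) : laplace_determined f ->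
  laplace_determined (fun s => f s * (a < tnth s i)%R%:R).
Proof.
move=> lf; have [mf _ _] := lf.
have mg : measurable_fun setT (fun s : d.-tuple R => f s * (a < tnth s i)%R%:R).
  by apply: measurable_funM => //; exact: measurable_coord_gt.
(* For a negative bound the indicator is constantly 1 on nonnegative vectors; [ray_approx_cvg]
   covers the other case. *)
have [a0|a0] := leP 0 a; last first.
  apply: laplace_determined_eq lf mg _ => s s0.
  by rewrite (lt_le_trans a0)// mulr1.
apply: (laplace_determined_lim
  (f_ := fun n s => f s * (1 - expR (- (n%:R * tnth s i))) ^+ ray_exponent a n)) => //.
  by move=> n; exact: laplace_determinedX.
move=> s s0; apply: cvgMr; exact: ray_approx_cvg.
Qed.

Lemma laplace_determined_orthant (a : 'I_d -> R) :
  laplace_determined (\1_(upper_orthant a)).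
Proof.
have h (r : seq 'I_d) : laplace_determined (fun s => \prod_(i <- r) (a i < tnth s i)%R%:R).
  elim: r => [|i r ih].
    apply: laplace_determined_eq laplace_determined1 _ _ => [|s _].
      by under eq_fun do rewrite big_nil; exact: measurable_cst.
    by rewrite big_nil.
  rewrite (_ : (fun _ => _) = (fun s => (\prod_(j <- r) (a j < tnth s j)%R%:R) *
      (a i < tnth s i)%R%:R)); first exact: laplace_determined_ray.
  by apply/funext => s; rewrite big_cons mulrC.
rewrite (_ : \1_ _ = (fun s : d.-tuple R => \prod_(i < d) (a i < tnth s i)%R%:R))//.
apply/funext => s; rewrite indicE.
have [/set_mem sa|/negP sa] := boolP (s \in upper_orthant a).
  by rewrite big1// => i _; rewrite sa.
have [i /negbTE si] : exists i, ~~ (a i < tnth s i).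
  apply: contrapT => /forallNP h0; apply: sa; rewrite inE => i.
  by apply/negPn/negP/h0.
by rewrite (bigD1 i)//= si mul0r.
Qed.

(** The measures with density [w] are finite and agree on upper orthants, a pi-system generating the
    Borel sets. The weight makes this usable for measures that are infinite themselves. *)
Theorem laplace_unique B : measurable B ->
  (\int[m1]_(s in B) (w s)%:E = \int[m2]_(s in B) (w s)%:E)%E.
Proof.
move=> mB.
apply: (measure_unique upper_orthants (fun k => upper_orthant (fun=> - k%:R))
  _ _ _ _ (weighted_measure m1 mw w0) (weighted_measure m2 mw w0)) => //.
- exact: measurable_upper_orthants.
- exact: upper_orthants_setI.
- by move=> k; exists (fun=> - k%:R).
- apply/seteqP; split => // s _.
  exists (Num.truncn (\sum_(j < d) `|tnth s j|)).+1 => // j.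
  rewrite ltrNl; apply: le_lt_trans (truncnS_gt _).
  rewrite (bigD1 j)//= -[leLHS]addr0 lerD ?sumr_ge0//.
  by rewrite -normrN ler_norm.
- move=> A [a _ <-].
  have mA : measurable (upper_orthant a).
    by rewrite measurable_upper_orthants; apply: sub_sigma_algebra; exists a.
  transitivity (weighted_measure m1 mw w0 (upper_orthant a)) => //.
  transitivity (weighted_measure m2 mw w0 (upper_orthant a)) => //.
  rewrite !weighted_measure_indic//.
  have [_ _] := laplace_determined_orthant a.
  have h0 : nnegv [tuple (0 : R) | i < d] by move=> i; rewrite tnth_mktuple.
  have e s : dotv [tuple (0 : R) | i < d] s = 0.
    by rewrite /dotv big1// => i _; rewrite tnth_mktuple mul0r.
  move=> /(_ _ h0) h; have eqm (m : {measure set (d.-tuple R) -> \bar R}) :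
      (\int[m]_s (w s * \1_(upper_orthant a) s)%:E = \int[m]_s
      (w s * \1_(upper_orthant a) s * expR (- dotv [tuple (0 : R) | i < d] s))%:E)%E.
    by apply: eq_integral => s _; rewrite e oppr0 expR0 mulr1.
  by rewrite !eqm.
- move=> k; apply: le_lt_trans wfin; apply: ge0_subset_integral => //.
  + rewrite measurable_upper_orthants; apply: sub_sigma_algebra.
    by exists (fun=> - k%:R).
  + exact/measurable_EFinP.
  + by move=> s _; rewrite lee_fin.
Qed.

End Class.
Lemma eq_finite_measure_laplace (m1 m2 : {measure set (d.-tuple R) -> \bar R}) :
  (m1 (~` [set s | nnegv s]) = 0)%E -> (m2 (~` [set s | nnegv s]) = 0)%E ->
  (m1 setT < +oo)%E ->
  (forall lam, nnegv lam -> (\int[m1]_s (expR (- dotv lam s))%:E =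
    \int[m2]_s (expR (- dotv lam s))%:E)%E) ->
  forall B, measurable B -> m1 B = m2 B.
Proof.
move=> m10 m20 m1fin lE B mB; pose N := [set s : d.-tuple R | nnegv s].
have mN : measurable N := measurable_nnegv.
have mexp (lam : d.-tuple R) : measurable_fun setT (fun s => expR (- dotv lam s)).
  apply: measurableT_comp; first exact: measurable_expR.
  by apply: measurable_funN; exact: measurable_dotv.
have intE (m : {measure set (d.-tuple R) -> \bar R}) lam : (m (~` N) = 0)%E ->
    (\int[m]_s (\1_N s * expR (- dotv lam s))%:E = \int[m]_s (expR (- dotv lam s))%:E)%E.
  move=> mN0; apply: (ge0_integral_ae0 (measurableC mN) mN0) => //.
  - by apply/measurable_EFinP; apply: measurable_funM => //; exact: measurable_indic.
  - exact/measurable_EFinP.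
  - by move=> s /contrapT Ns; rewrite indicE mem_set// mul1r.
have mE (m : {measure set (d.-tuple R) -> \bar R}) : (m (~` N) = 0)%E ->
    (m B = \int[m]_(s in B) (\1_N s)%:E)%E.
  by move=> mN0; rewrite integral_indic// measure_conegligible_setI.
rewrite (mE m1)// (mE m2)//.
apply: laplace_unique => //.
- by move=> s sN; rewrite indicE memNset.
- rewrite integral_indic// setIT.
  by apply: le_lt_trans m1fin; apply: le_measure; rewrite ?inE.
- by move=> lam l0; rewrite !intE// lE.
Qed.

Lemma one_sub_exp_ge0 (lam s : d.-tuple R) : nnegv lam -> nnegv s ->
  0 <= 1 - expR (- dotv lam s).
Proof. by move=> l0 s0; rewrite subr_ge0 expR_le1 oppr_le0 dotv_ge0. Qed.

Lemma measurable_exp_dotv (lam : d.-tuple R) (D : set (d.-tuple R)) :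
  measurable_fun D (fun s => expR (- dotv lam s)).
Proof.
apply: measurable_funTS; apply: measurableT_comp; first exact: measurable_expR.
by apply: measurable_funN; exact: measurable_dotv.
Qed.

Lemma measurable_one_sub_exp (lam : d.-tuple R) (D : set (d.-tuple R)) :
  measurable_fun D (fun s => (1 - expR (- dotv lam s))%:E).
Proof.
by apply/measurable_EFinP; apply: measurable_funB => //; exact: measurable_exp_dotv.
Qed.

(** With [w n] = 1 - e^(-n |s|) on [Omega], the difference of the exponents at lam + n 1 and lam is
    the Laplace transform of the finite measure of density [w n]; so these measures agree for the
    two intensities. As n grows, [w n] increases to the indicator of [Omega], and monotone
    convergence recovers the intensities. *)
Lemma eq_levy_measure (m1 m2 : {measure set (d.-tuple R) -> \bar R}) :
  on_Omega m1 -> on_Omega m2 ->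
  (forall lam, nnegv lam ->
    (\int[m1]_(s in Omega R d) (1 - expR (- dotv lam s))%:E < +oo)%E) ->
  (forall lam, nnegv lam ->
    (\int[m1]_(s in Omega R d) (1 - expR (- dotv lam s))%:E =
     \int[m2]_(s in Omega R d) (1 - expR (- dotv lam s))%:E)%E) ->
  forall B, measurable B -> m1 B = m2 B.
Proof.
move=> m10 m20 psi_fin psiE B mB; have mO := @measurable_Omega R d.
pose w (n : nat) (s : d.-tuple R) := (1 - expR (- (n%:R * vsum s))) * \1_(Omega R d) s.
have mw n : measurable_fun setT (w n).
  apply: measurable_funM; last exact: measurable_indic.
  apply: measurable_funB => //; apply: measurableT_comp => //.
  by apply: measurable_funN; apply: measurable_funM => //; exact: measurable_vsum.
have w0 n s : 0 <= w n s.
  rewrite /w indicE; case: (boolP (s \in Omega R d)) => /= [/set_mem[s0 _]|]; last by rewrite mulr0.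
  by rewrite mulr1 subr_ge0 expR_le1 oppr_le0 mulr_ge0// vsum_ge0.
have vone_n (n : nat) : nnegv (vscale n%:R (@vone R d)).
  by apply: nnegvZ => //; exact: nnegv_one.
have key (m : {measure set (d.-tuple R) -> \bar R}) n lam : nnegv lam ->
   (\int[m]_(s in Omega R d) (1 - expR (- dotv (vadd (vscale n%:R vone) lam) s))%:E =
    \int[m]_s (w n s * expR (- dotv lam s))%:E +
    \int[m]_(s in Omega R d) (1 - expR (- dotv lam s))%:E)%E.
  move=> l0; rewrite [X in (_ = X + _)%E](_ : _ = (\int[m]_(s in Omega R d)
      ((1 - expR (- (n%:R * vsum s))) * expR (- dotv lam s))%:E)%E); last first.
    rewrite [RHS]integral_mkcond; apply: eq_integral => s _.
    rewrite patchE /w indicE; case: ifPn => _; rewrite ?mulr1 ?mulr0 ?mul0r//.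
  rewrite -ge0_integralD//.
  - apply: eq_integral => s _; rewrite -EFinD; congr EFin.
    by rewrite dotvD dotvZ dotv_one opprD expRD; ring.
  - move=> s [s0 _]; rewrite /= lee_fin mulr_ge0 ?expR_ge0//.
    by rewrite subr_ge0 expR_le1 oppr_le0 mulr_ge0// vsum_ge0.
  - apply/measurable_EFinP; apply: measurable_funM; last exact: measurable_exp_dotv.
    apply: measurable_funTS; apply: measurable_funB => //; apply: measurableT_comp => //.
    by apply: measurable_funN; apply: measurable_funM => //; exact: measurable_vsum.
  - by move=> s [s0 _]; rewrite /= lee_fin one_sub_exp_ge0.
  - by apply/measurable_EFinP; apply: measurable_funB => //; exact: measurable_exp_dotv.
have psi_ge0 (m : {measure set (d.-tuple R) -> \bar R}) lam : nnegv lam ->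
    (0 <= \int[m]_(s in Omega R d) (1 - expR (- dotv lam s))%:E)%E.
  by move=> l0; apply: integral_ge0 => s [s0 _]; rewrite /= lee_fin one_sub_exp_ge0.
have wE n : (\int[m1]_(s in B) (w n s)%:E = \int[m2]_(s in B) (w n s)%:E)%E.
  apply: laplace_unique => //.
  - move=> s sN; rewrite /w indicE memNset ?mulr0// => -[s0 _]; exact: sN.
  - apply: le_lt_trans (psi_fin _ (vone_n n)).
    rewrite [leRHS]integral_mkcond; apply: ge0_le_integral => //.
    + by move=> s _; rewrite lee_fin.
    + exact/measurable_EFinP.
    + by apply/(measurable_restrictT _ mO); exact: measurable_one_sub_exp.
    + move=> s _; rewrite patchE /w indicE; case: ifPn => _; rewrite ?mulr1 ?mulr0//.
      by rewrite dotvZ dotv_one.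
  - move=> lam l0; have l'0 := nnegvD (vone_n n) l0.
    have := psiE _ l'0; rewrite (key m1 n)// (key m2 n)// psiE// => e.
    have fin : (\int[m2]_(s in Omega R d) (1 - expR (- dotv lam s))%:E)%E \is a fin_num.
      by rewrite ge0_fin_numE ?psi_ge0// -psiE// psi_fin.
    by rewrite -[LHS](addeK _ fin) e addeK.
have lim (m : {measure set (d.-tuple R) -> \bar R}) : on_Omega m ->
    ((\int[m]_(s in B) (w n s)%:E)%E @[n --> \oo] --> m B)%E.
  move=> mO0.
  have -> : (m B = \int[m]_(s in B) (\1_(Omega R d) s)%:E)%E.
    by rewrite integral_indic// measure_conegligible_setI.
  rewrite (_ : (\int[m]_(s in B) (\1_(Omega R d) s)%:E)%E =
     (\int[m]_(s in B) limn (fun n => (w n s)%:E))%E).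
    apply: cvg_monotone_convergence => //.
    - by move=> n; apply/measurable_EFinP; exact: measurable_funTS.
    - by move=> n s _; rewrite /= lee_fin.
    - move=> s _ n k nk; rewrite /= lee_fin /w indicE.
      case: (boolP (s \in Omega R d)) => /= [/set_mem[s0 _]|]; last by rewrite !mulr0.
      rewrite !mulr1 lerD2l lerN2 ler_expR lerN2 ler_wpM2r ?ler_nat//.
      exact: vsum_ge0.
  apply: eq_integral => s _; apply/esym/cvg_lim => //.
  apply: cvg_EFin; first exact: nearW.
  rewrite /w indicE; case: (boolP (s \in Omega R d)) => /= [/set_mem Os|]; last first.
    by move=> _; under eq_fun do rewrite mulr0; exact: cvg_cst.
  under eq_fun do rewrite mulr1.
  rewrite (_ : true%:R = 1 - 0 :> R); last by rewrite subr0.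
  apply: cvgB; first exact: cvg_cst.
  have s0 := Omega_vsum Os.
  apply/cvgrPdist_le => e e0; have := nat_expR_cvg0 s0.
  move=> /cvgrPdist_le/(_ _ e0) h; near=> n.
  have : `|0 - n%:R * expR (- (n%:R * vsum s))| <= e by near: n.
  rewrite !sub0r !normrN ger0_norm ?mulr_ge0 ?expR_ge0// ger0_norm ?expR_ge0//.
  apply: le_trans; rewrite -[leLHS]mul1r ler_wpM2r ?expR_ge0// ler1n.
  by near: n; exists 1%N.
have h1 := lim m1 m10; have h2 := lim m2 m20.
apply: cvg_unique h2 => //.
by apply: cvg_trans h1; apply: near_eq_cvg; apply: nearW => n; rewrite wE.
Unshelve. all: by end_near. Qed.

End LaplaceUniqueness.

(** * Comonotone coupling with a diagonal measure *)

Section Tails.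
Context {R : realType} d (T : measurableType d) (m : {measure set T -> \bar R})
  (f : T -> R) (mf : measurable_fun setT f).
Local Open Scope ring_scope.

Local Notation above r := [set x | (r < f x)%R].
Local Notation atleast r := [set x | (r <= f x)%R].

Lemma measurable_gt_level r : measurable (above r).
Proof.
have := mf measurableT (measurable_itv `]r, +oo[); rewrite setTI.
by congr measurable; apply/seteqP; split => x /=; rewrite in_itv/= andbT.
Qed.

Lemma measurable_ge_level r : measurable (atleast r).
Proof.
have := mf measurableT (measurable_itv `[r, +oo[); rewrite setTI.
by congr measurable; apply/seteqP; split => x /=; rewrite in_itv/= andbT.
Qed.

Lemma cvg_gt_level_right r :
  (m (above (r + n.+1%:R^-1)) @[n --> \oo] --> m (above r))%E.
Proof.
rewrite (_ : (above r) = \bigcup_n (above (r + n.+1%:R^-1))).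
  apply: nondecreasing_cvg_mu => [n||].
  - exact: measurable_gt_level.
  - by apply: bigcupT_measurable => n; exact: measurable_gt_level.
  - move=> i j ij; apply/subsetPset => x /=; apply: le_lt_trans.
    by rewrite lerD2l lef_pV2 ?posrE ?ltr0n// ler_nat ltnS.
apply/seteqP; split => x /=.
  move=> rf; exists (Num.truncn (f x - r)^-1) => //=.
  rewrite -ltrBrDl invf_plt ?posrE ?ltr0n ?subr_gt0//.
  exact: truncnS_gt.
by move=> [n _ /=]; apply: lt_trans; rewrite ltrDl invr_gt0 ltr0n.
Qed.

Hypothesis fin : forall r, 0 < r -> (m (atleast r) < +oo)%E.

(** Only positive levels carry information: where the mass is infinite, as it is at 0 below, [fine]
    returns 0. *)
Definition tail r : R := fine (m (above r)).

Lemma tail_fin r : 0 < r -> m (above r) = (tail r)%:E.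
Proof.
move=> r0; rewrite fineK// ge0_fin_numE//.
apply: le_lt_trans (fin r0); apply: le_measure; rewrite ?inE.
- exact: measurable_gt_level.
- exact: measurable_ge_level.
- by move=> x /= /ltW.
Qed.

Lemma tail_ge0 r : 0 <= tail r.
Proof. by apply: fine_ge0. Qed.

Lemma tail_nincr r r' : 0 < r -> r <= r' -> tail r' <= tail r.
Proof.
move=> r0 rr'; rewrite -lee_fin -!tail_fin ?(lt_le_trans r0)//.
apply: le_measure; rewrite ?inE; [exact: measurable_gt_level..|].
by move=> x /=; apply: le_lt_trans.
Qed.

(** Right-continuity of the tail, in the one-sided form that suprema and infima require. *)
Lemma tail_gt_right r y : 0 < r -> y < tail r -> exists2 r', r < r' & y < tail r'.
Proof.
move=> r0; rewrite -lte_fin -tail_fin// => yr.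
have := @cvg_gt_level_right r; set u := (X in (X x @[x --> _] --> _)%E -> _) => h.
have ndu : nondecreasing_seq u.
  move=> i j ij; apply: le_measure; rewrite ?inE; [exact: measurable_gt_level..|].
  move=> x /=; apply: le_lt_trans.
  by rewrite lerD2l lef_pV2 ?posrE ?ltr0n// ler_nat ltnS.
have [n yn] : exists n, (y%:E < u n)%E.
  apply: contrapT => /forallNP nu; move: yr; apply/negP; rewrite -leNgt.
  rewrite -(cvg_lim _ h)//; apply: lime_le; first exact: cvgP h.
  by apply: nearW => n; rewrite leNgt; apply/negP/nu.
exists (r + n.+1%:R^-1); first by rewrite ltrDl invr_gt0 ltr0n.
by rewrite -lte_fin -tail_fin// addr_gt0// invr_gt0 ltr0n.
Qed.

(** The left limit of the tail at r is the mass of {f >= r}, by continuity from above along levels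
    increasing to r. *)
Lemma tail_lt_left r y : 0 < r -> (m (atleast r) < y%:E)%E ->
  exists2 r', 0 < r' < r & tail r' < y.
Proof.
move=> r0 ry.
(* Denominators start at 2 so that every level stays positive, where masses are finite and
   continuity from above applies. *)
pose r_ n := r - r / n.+2%:R.
have r_lt n : r_ n < r by rewrite gtrBl divr_gt0// ltr0n.
have r_gt0 n : 0 < r_ n.
  by rewrite subr_gt0 ltr_pdivrMr ?ltr0n// ltr_pMr// ltr1n.
have h : (m (above (r_ n)) @[n --> \oo] --> m (atleast r))%E.
  rewrite (_ : (atleast r) = \bigcap_n (above (r_ n))).
    apply: nonincreasing_cvg_mu => [|||].
    - by rewrite tail_fin// ltry.
    - by move=> n; exact: measurable_gt_level.
    - by apply: bigcapT_measurable => n; exact: measurable_gt_level.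
    - move=> i j ij; apply/subsetPset => x /=; apply: le_lt_trans.
      by rewrite lerD2l lerN2 ler_pM2l// lef_pV2 ?posrE ?ltr0n// ler_nat ltnS.
  apply/seteqP; split => x /=.
    by move=> rf n _; apply: lt_le_trans rf.
  move=> rf; rewrite leNgt; apply/negP => fr.
  pose n := Num.truncn ((r - f x) / r)^-1.
  have := rf n Logic.I => /=; apply/negP; rewrite -leNgt.
  have h : ((r - f x) / r)^-1 < n.+2%:R.
    by apply: lt_trans (truncnS_gt _) _; rewrite ltr_nat.
  rewrite lerBrDl -lerBrDr ler_pdivrMr ?ltr0n// mulrC.
  rewrite invf_plt ?posrE ?ltr0n ?divr_gt0 ?subr_gt0// in h.
  by move: h; rewrite ltr_pdivlMr// ltr_pdivrMl ?ltr0n// => /ltW.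
have [n yn] : exists n, (m (above (r_ n)) < y%:E)%E.
  apply: contrapT => /forallNP nu; move: ry; apply/negP; rewrite -leNgt.
  rewrite -(cvg_lim _ h)//; apply: lime_ge; first exact: cvgP h.
  by apply: nearW => n; rewrite leNgt; apply/negP/nu.
exists (r_ n); first by rewrite r_gt0 r_lt.
by rewrite -lte_fin -tail_fin.
Qed.

Lemma tail_small c : 0 < c -> exists2 r, 0 < r & tail r < c.
Proof.
move=> c0.
have h : (m (above (n.+1%:R)) @[n --> \oo] --> (0 : \bar R))%E.
  rewrite -[X in (_ --> X)%E](measure0 m).
  rewrite (_ : set0 = \bigcap_n (above (n.+1%:R))).
    apply: nonincreasing_cvg_mu => [|||].
    - by rewrite tail_fin ?ltry// ltr0n.
    - by move=> n; exact: measurable_gt_level.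
    - by apply: bigcapT_measurable => n; exact: measurable_gt_level.
    - move=> i j ij; apply/subsetPset => x /=; apply: le_lt_trans.
      by rewrite ler_nat ltnS.
  apply/seteqP; split => x //= /(_ (Num.truncn (f x)) Logic.I) /=.
  by rewrite ltNge (ltW (truncnS_gt _)).
have [n yn] : exists n, (m (above (n.+1%:R)) < c%:E)%E.
  apply: contrapT => /forallNP nu.
  have : (c%:E <= 0)%E.
    rewrite -(cvg_lim _ h)//; apply: lime_ge; first exact: cvgP h.
    by apply: nearW => n; rewrite leNgt; apply/negP/nu.
  by rewrite leNgt lte_fin c0.
exists n.+1%:R; first by rewrite ltr0n.
by rewrite -lte_fin -tail_fin// ltr0n.
Qed.

Hypothesis infinite : (m (above 0) = +oo)%E.

Lemma tail_large c : exists2 r, 0 < r & c < tail r.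
Proof.
have h := @cvg_gt_level_right 0; rewrite infinite in h.
have [n yn] : exists n, (c%:E < m (above (0 + n.+1%:R^-1)))%E.
  apply: contrapT => /forallNP nu.
  have : (+oo <= c%:E)%E.
    rewrite -(cvg_lim _ h)//; apply: lime_le; first exact: cvgP h.
    by apply: nearW => n; rewrite leNgt; apply/negP/nu.
  by [].
rewrite add0r in yn.
exists n.+1%:R^-1; first by rewrite invr_gt0 ltr0n.
by rewrite -lte_fin -tail_fin// invr_gt0 ltr0n.
Qed.

(** Generalised inverse of the tail: a quantile at mass c counted from the top, the total mass being
    infinite. *)
Definition level (c : R) : R := inf [set r | 0 < r /\ tail r < c].

Lemma level_has_inf c : 0 < c -> has_inf [set r | 0 < r /\ tail r < c].
Proof.
move=> c0; split; first by have [r r0 rc] := tail_small c0; exists r.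
by exists 0 => r [/ltW].
Qed.

Lemma le_level c r : 0 < c -> c <= tail r -> 0 < r -> r <= level c.
Proof.
move=> c0 cr r0; apply: lb_le_inf; first by have [] := level_has_inf c0.
move=> r' [r'0 r'c]; rewrite leNgt; apply/negP => r'r.
by move: r'c; rewrite ltNge (le_trans cr)//; apply: tail_nincr => //; exact: ltW.
Qed.

(** The infinite mass of {f > 0} makes any finite mass c be exceeded already above some positive
    level. *)
Lemma level_gt0 c : 0 < c -> 0 < level c.
Proof.
move=> c0; have [r r0 cr] := tail_large c.
by apply: (lt_le_trans r0); apply: le_level => //; exact: ltW.
Qed.

Lemma level_le c r : 0 < c -> tail r < c -> 0 < r -> level c <= r.
Proof. by move=> c0 rc r0; apply: ge_inf; [have [] := level_has_inf c0|split]. Qed.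

Lemma tail_lt_level c r : 0 < c -> level c < r -> tail r < c.
Proof.
move=> c0 rc; have [r' [r'0 r'c] r'r] := inf_lt (level_has_inf c0).1 rc.
apply: le_lt_trans r'c; apply: tail_nincr => //; exact: ltW.
Qed.

Lemma tail_ge_level c r : 0 < c -> 0 < r -> r < level c -> c <= tail r.
Proof.
move=> c0 r0 rc; rewrite leNgt; apply/negP => h.
by move: rc; rewrite ltNge level_le.
Qed.

(** Together with [ge_level_measure] this brackets c between the masses of {f > l} and {f >= l} at l
    = [level c]; an atom of f at l accounts for the difference. *)
Lemma tail_level c : 0 < c -> tail (level c) <= c.
Proof.
move=> c0; rewrite leNgt; apply/negP => h.
have [r' lr'] := tail_gt_right (level_gt0 c0) h.
by rewrite ltNge (ltW (tail_lt_level _ lr')).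
Qed.

Lemma ge_level_measure c : 0 < c -> (c%:E <= m (atleast (level c)))%E.
Proof.
move=> c0; rewrite leNgt; apply/negP => h.
have [r' /andP[r'0 r'l]] := tail_lt_left (level_gt0 c0) h.
by rewrite ltNge tail_ge_level.
Qed.

Lemma level_nincr c c' : 0 < c -> c <= c' -> level c' <= level c.
Proof.
move=> c0 cc'; apply: lb_le_inf; first by have [] := level_has_inf c0.
by move=> r [r0 rc]; apply: level_le => //; [exact: lt_le_trans cc'|exact: lt_le_trans cc'].
Qed.

End Tails.

Section Quantile.
Context {R : realType}.
Local Open Scope ring_scope.

Definition unif01 : probability (measurableTypeR R) R := uniform_prob (@ltr01 R).

(** The tie-breaking variable lives on the whole line; clamping keeps the convex combination in
    [rank] valid everywhere and changes nothing almost surely. *)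
Definition clamp01 (u : R) : R := Num.max 0 (Num.min 1 u).

Lemma clamp01_itv u : 0 <= clamp01 u <= 1.
Proof. by rewrite /clamp01 le_max lexx/= ge_max ler01 ge_min lexx. Qed.

Lemma unif01_clamp_lt (r : R) : 0 <= r <= 1 ->
  measurable [set u | clamp01 u < r] /\ unif01 [set u | (clamp01 u < r)%R] = r%:E.
Proof.
move=> /andP[r0 r1].
have mU : measurable [set u | clamp01 u < r].
  have mc : measurable_fun setT clamp01.
    by apply: measurable_maxr => //; exact: measurable_minr.
  have := mc measurableT _ (measurable_itv `]-oo, r[); rewrite setTI.
  by congr measurable; apply/seteqP; split => x /=; rewrite in_itv/=.
split => //.
have -> : unif01 [set u | (clamp01 u < r)%R] =
    (\int[lebesgue_measure]_(x in [set u | (clamp01 u < r)%R]) (uniform_pdf 0 1 x)%:E)%E.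
  by [].
rewrite integral_uniform_pdf.
rewrite (_ : _ `&` _ = `[0, r[%classic); last first.
  apply/seteqP; split => u /=; rewrite !in_itv/= /clamp01.
    by move=> [+ /andP[u0 u1]]; rewrite min_r// max_r// u0 => ->.
  move=> /andP[u0 ur]; have u1 : u <= 1 by rewrite (le_trans (ltW ur)).
  by rewrite u0 u1 min_r// max_r.
rewrite (eq_integral (fun=> 1%:E)); last first.
  move=> x; rewrite inE/= in_itv/= => /andP[x0 xr]; rewrite /uniform_pdf.
  rewrite ifT ?subr0 ?invr1//.
  by rewrite x0 (le_trans (ltW xr)).
rewrite integral_cst//= mul1e lebesgue_measure_itv/= lte_fin -EFinD subr0.
by case: ltP => // r0'; congr EFin; apply/le_anti; rewrite r0 r0'.
Qed.

Section Coupling.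
Context d (T : measurableType d) (m : {measure set T -> \bar R})
  (f : T -> R) (mf : measurable_fun setT f).
Local Notation above r := [set x | (r < f x)%R].
Local Notation atleast r := [set x | (r <= f x)%R].
Hypothesis fin : forall r, 0 < r -> (m (atleast r) < +oo)%E.
Hypothesis infinite : (m (above 0) = +oo)%E.
Local Notation tail := (tail m f).
Local Notation level := (level m f).
Local Notation wtail r := (fine (m (atleast r))).

Lemma wtail_fin r : 0 < r -> m (atleast r) = (wtail r)%:E.
Proof. by move=> r0; rewrite fineK// ge0_fin_numE// fin. Qed.

Lemma tail_le_wtail r : 0 < r -> tail r <= wtail r.
Proof.
move=> r0; rewrite -lee_fin -tail_fin// -wtail_fin//; apply: le_measure; rewrite ?inE.
- exact: measurable_gt_level.
- exact: measurable_ge_level.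
- by move=> x /= /ltW.
Qed.

Lemma wtail_le_tail r r' : 0 < r -> r < r' -> wtail r' <= tail r.
Proof.
move=> r0 rr'; rewrite -lee_fin -tail_fin// -wtail_fin//; last exact: lt_trans rr'.
apply: le_measure; rewrite ?inE.
- exact: measurable_ge_level.
- exact: measurable_gt_level.
- by move=> x /=; apply: lt_le_trans.
Qed.

(* [m]-mass lying strictly above the point (x, u) when T x [0, 1] is ordered
   by decreasing [f], ties being broken by [u]. *)
Definition rank (p : T * R) : R :=
  (1 - clamp01 p.2) * tail (f p.1) + clamp01 p.2 * wtail (f p.1).

Lemma rank_bounds p : 0 < f p.1 -> tail (f p.1) <= rank p <= wtail (f p.1).
Proof.
move=> f0; have := tail_le_wtail f0; have /andP[] := clamp01_itv p.2.
rewrite /rank; move: (clamp01 _) (tail _) (wtail _) => u t w u0 u1 tw.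
have : 0 <= u * (w - t) by rewrite mulr_ge0// subr_ge0.
have : 0 <= (1 - u) * (w - t) by rewrite mulr_ge0// subr_ge0.
by move=> *; apply/andP; split; lra.
Qed.

Lemma rank_ge0 p : 0 <= rank p.
Proof.
have /andP[u0 u1] := clamp01_itv p.2.
rewrite /rank addr_ge0// mulr_ge0 ?subr_ge0 ?fine_ge0//.
Qed.

Definition mass_ranked : {measure set (T * measurableTypeR R) -> \bar R} := (m \x unif01)%E.

Lemma mass_rankedX A (B : set (measurableTypeR R)) : measurable A -> measurable B ->
  mass_ranked (A `*` B) = (m A * unif01 B)%E.
Proof. exact: product_measure1E. Qed.

Definition tie_set c : set (measurableTypeR R) := [set u |
  (1 - clamp01 u) * tail (level c) + clamp01 u * wtail (level c) < c].

(** Below the level the rank is at least the tail, hence at least c. Above the level it is at most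
    the mass of {f >= f x}, which is less than c. Only on the atom at the level does the
    tie-breaking variable decide. *)
Lemma rank_ltE c : 0 < c -> [set p | 0 < f p.1 /\ rank p < c] =
  (above (level c) `*` setT) `|` ([set x | f x = level c] `*` tie_set c).
Proof.
move=> c0; have l0 := level_gt0 mf fin infinite c0.
apply/seteqP; split => -[x u] /=.
  move=> [fx rc]; have [lf|fl|fl] := ltgtP (level c) (f x); first by left.
    have := tail_ge_level mf fin c0 fx fl.
    have /andP[h _] := rank_bounds (p := (x, u)) fx.
    by move=> /le_trans/(_ h); rewrite leNgt rc.
  by right; split => //; rewrite /tie_set /= fl; exact: rc.
move=> [[lf _]|[fl]].
  have fx : 0 < f x by exact: lt_trans lf.
  split => //; have /andP[_ h] := rank_bounds (p := (x, u)) fx.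
  apply: le_lt_trans h _.
  (* An intermediate level turns the mass of {f >= f x} into a tail taken strictly above [level c],
     which is strictly less than c. *)
  pose r := (level c + f x) / 2.
  have lr : level c < r by rewrite /r; lra.
  have rf : r < f x by rewrite /r; lra.
  apply: le_lt_trans (tail_lt_level mf fin c0 lr).
  by apply: wtail_le_tail => //; exact: lt_trans lr.
by rewrite /tie_set /= => h; split; rewrite /rank /= fl.
Qed.

Lemma measurable_tie_set c : 0 < c -> measurable (tie_set c).
Proof.
move=> c0; have mc : measurable_fun setT clamp01.
  by apply: measurable_maxr => //; exact: measurable_minr.
have mg : measurable_fun setT (fun u => (1 - clamp01 u) * tail (level c) +
    clamp01 u * wtail (level c)).
  by apply: measurable_funD; apply: measurable_funM => //; exact: measurable_funB.
have := mg measurableT _ (measurable_itv `]-oo, c[); rewrite setTI.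
by congr measurable; apply/seteqP; split => x /=; rewrite in_itv/=.
Qed.

Lemma measurable_eq_level r : measurable [set x | f x = r].
Proof.
have := mf measurableT (measurable_set1 r); rewrite setTI.
by congr measurable; apply/seteqP; split.
Qed.

Lemma measurable_rank_lt c : measurable [set p | 0 < f p.1 /\ rank p < c].
Proof.
have [c0|c0] := ltP 0 c; last first.
  rewrite (_ : mkset _ = set0)//; apply/seteqP; split => p //= -[_].
  by rewrite ltNge (le_trans c0)// rank_ge0.
rewrite rank_ltE//; apply: measurableU; apply: measurableX => //.
- exact: measurable_gt_level.
- exact: measurable_eq_level.
- exact: measurable_tie_set.
Qed.

(** Probability integral transform for an infinite measure: on {f > 0} the rank has Lebesgue law on
    the half-line. The part above the level has mass p, and the atom, of mass q - p, contributes its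
    fraction (c - p) / (q - p). *)
Lemma mass_rank_lt c : 0 < c ->
  mass_ranked [set p | (0 < f p.1 /\ rank p < c)%R] = c%:E.
Proof.
move=> c0; have l0 := level_gt0 mf fin infinite c0.
have ma := measurable_gt_level mf (level c).
have me := measurable_eq_level (level c).
have mt := measurable_tie_set c0.
rewrite rank_ltE// measureU//; last 3 first.
- exact: measurableX.
- exact: measurableX.
- by apply/seteqP; split => -[x u] //= [[lf _] [fl _]]; move: lf; rewrite fl ltxx.
transitivity (m (above (level c)) * unif01 setT +
    m [set x | f x = level c] * unif01 (tie_set c))%E.
  by congr (_ + _)%E; exact: mass_rankedX.
rewrite probability_setT mule1 tail_fin//.
set p := tail _; set q := wtail (level c).
have pq : p <= q := tail_le_wtail l0.
have pc : p <= c by exact: tail_level.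
have cq : c <= q by rewrite -lee_fin -wtail_fin//; exact: ge_level_measure.
have me_ : m [set x | f x = level c] = (q - p)%:E.
  have : m (atleast (level c)) = (m (above (level c)) + m [set x | f x = level c])%E.
    rewrite -measureU//; last first.
      by apply/seteqP; split => x //= [+ fl]; rewrite fl ltxx.
    congr (m _); apply/seteqP; split => x /=.
      by rewrite le_eqVlt => /predU1P[->|]; [right|left].
    by move=> [/ltW|->].
  rewrite wtail_fin// tail_fin// -/p -/q => e.
  by rewrite EFinB e (addeC p%:E) addeK.
have [pq_eq|pq_lt] := eqVneq p q.
  rewrite me_ pq_eq subrr mul0e adde0; congr EFin.
  by apply/le_anti; rewrite cq -pq_eq pc.
have {pq_lt}pq_lt : 0 < q - p by rewrite subr_gt0 lt_neqAle pq_lt.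
have r01 : 0 <= (c - p) / (q - p) <= 1.
  rewrite divr_ge0 ?subr_ge0//= ler_pdivrMr// mul1r lerD2r//.
have [_] := unif01_clamp_lt r01.
rewrite (_ : [set u | _] = tie_set c) => [->|].
  rewrite me_ -EFinM -EFinD mulrC divfK ?gt_eqF//; congr EFin; lra.
apply/seteqP; split => u; rewrite /tie_set /= -/p -/q ltr_pdivlMr// => h; lra.
Qed.

(** [V] will be the tail of one coordinate of [k]; then [V_tail] holds because a nonnegative vector
    has coordinates at most their sum. *)
Variable V : R -> R.
Hypothesis V_ge0 : forall b, 0 <= V b.
Hypothesis V_right : forall b y, 0 < b -> y < V b -> exists2 b', b < b' & y < V b'.
Hypothesis V_nincr : forall b b', 0 < b -> b <= b' -> V b' <= V b.
Hypothesis V_tail : forall b, 0 < b -> V b <= tail b.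

(** The point 0 keeps the set nonempty, and makes the quantile 0 where f is not positive. *)
Definition quantile_set (p : T * R) : set R :=
  [set b | b = 0 \/ [/\ 0 < b, 0 < f p.1 & rank p < V b]].

(* The monotone rearrangement of [f] with tail function [V]. *)
Definition quantile (p : T * R) : R := sup (quantile_set p).

(** By [V_tail] the quantile cannot exceed f: if f < b then V b <= tail b <= tail f <= rank, so b is
    not in the set. *)
Lemma quantile_set_has_sup p : has_sup (quantile_set p).
Proof.
split; first by exists 0; left.
exists `|f p.1| => b [->|[b0 f0 rb]]; first exact: normr_ge0.
rewrite leNgt gtr0_norm//; apply/negP => fb.
have /andP[h _] := rank_bounds f0.
have := V_tail b0; rewrite leNgt => /negP; apply.
by apply: le_lt_trans rb; apply: le_trans h; apply: tail_nincr => //; exact: ltW.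
Qed.

Lemma quantile_ge0 p : 0 <= quantile p.
Proof. by apply: ub_le_sup; [have [] := quantile_set_has_sup p|left]. Qed.

(** Right-continuity of [V] is what makes the strict inequality on the supremum equivalent to a
    strict inequality at b itself. *)
Lemma quantile_gt b p : 0 < b -> b < quantile p <-> (0 < f p.1 /\ rank p < V b).
Proof.
move=> b0; split.
  move=> bq; have [b' [->|[b'0 f0 rb] bb']] := sup_gt (quantile_set_has_sup p).1 bq.
    by move=> /(lt_trans b0); rewrite ltxx.
  by split => //; apply: lt_le_trans rb _; apply: V_nincr => //; exact: ltW.
move=> [f0 /(V_right b0)[b' bb' rb]].
apply: (lt_le_trans bb'); apply: ub_le_sup; first by have [] := quantile_set_has_sup p.
by right; split => //; exact: lt_trans bb'.
Qed.

Lemma measurable_quantile : measurable_fun setT quantile.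
Proof.
apply: (measurability (@RGenOInfty.G R)); first exact: RGenOInfty.measurableE.
move=> _ [_ [b ->] <-]; rewrite setTI.
have pos b' : 0 < b' -> measurable (quantile @^-1` `]b', +oo[).
  move=> b0; rewrite (_ : _ @^-1` _ = [set p | 0 < f p.1 /\ rank p < V b']).
    exact: measurable_rank_lt.
  by apply/seteqP; split => p /=; rewrite in_itv/= andbT => /quantile_gt; exact.
have [b0|b0|->] := ltgtP b 0; last first.
- rewrite (_ : _ @^-1` _ = \bigcup_n (quantile @^-1` `]n.+1%:R^-1, +oo[)).
    by apply: bigcupT_measurable => n; apply: pos; rewrite invr_gt0 ltr0n.
  apply/seteqP; split => p /=; rewrite ?in_itv/= ?andbT.
    move=> q0; exists (Num.truncn (quantile p)^-1) => //=.
    by rewrite in_itv/= andbT invf_plt ?posrE ?ltr0n// truncnS_gt.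
  move=> [n _ /=]; rewrite in_itv/= andbT; apply: lt_trans.
  by rewrite invr_gt0 ltr0n.
- exact: pos.
- rewrite (_ : _ @^-1` _ = setT)//; apply/seteqP; split => p //= _.
  by rewrite in_itv/= andbT (lt_le_trans b0)// quantile_ge0.
Qed.

Lemma mass_quantile_gt b : 0 < b ->
  mass_ranked [set p | (b < quantile p)%R] = (V b)%:E.
Proof.
move=> b0; rewrite (_ : [set p | _] = [set p | 0 < f p.1 /\ rank p < V b]); last first.
  by apply/seteqP; split => p /= /quantile_gt; exact.
have [Vb|Vb] := ltP 0 (V b); first exact: mass_rank_lt.
have -> : V b = 0 by apply/le_anti; rewrite Vb V_ge0.
rewrite (_ : mkset _ = set0) ?measure0//; apply/seteqP; split => p //= -[_].
by rewrite ltNge rank_ge0.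
Qed.

(** Comonotonicity: the event that the quantile exceeds b lies between {f > l} and {f >= l} for the
    level l of mass V b. *)
Lemma quantile_gt_level b p : 0 < b -> 0 < V b ->
  (b < quantile p -> level (V b) <= f p.1) /\
  (level (V b) < f p.1 -> b < quantile p).
Proof.
move=> b0 Vb; have := rank_ltE Vb => /seteqP[h1 h2]; split.
  move=> /quantile_gt => /(_ b0) /h1 [[/ltW //]|[/= -> //]].
move=> lf; apply/quantile_gt => //; apply: h2; left; split => //.
Qed.

End Coupling.
End Quantile.

Section EqMeasurePos.
Local Open Scope ring_scope.

(** Near 0 the masses may be infinite, so the pi-system argument is run on each ]1/(n+1), +oo[ and
    the restrictions are reassembled by continuity from below. *)
Lemma eq_measure_pos (R : realType) (m1 m2 : {measure set R -> \bar R}) :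
  (forall r, (0 < r)%R -> m1 `]r, +oo[%classic = m2 `]r, +oo[%classic) ->
  (forall r, (0 < r)%R -> (m1 `]r, +oo[%classic < +oo)%E) ->
  forall E : set R, measurable E -> E `<=` `]0%R, +oo[%classic -> m1 E = m2 E.
Proof.
move=> m12 m1fin E mE E0.
pose D (n : nat) : set R := `]n.+1%:R^-1, +oo[%classic.
have mD n : measurable (D n) by exact: measurable_itv.
have DE n r : `]r, +oo[%classic `&` D n = `]Num.max r n.+1%:R^-1, +oo[%classic.
  by rewrite /D; apply/seteqP; split => x /=; rewrite !in_itv/= !andbT gt_max;
    [move=> [-> ->]|move=> /andP].
have pos (n : nat) : (0 < n.+1%:R^-1 :> R)%R by rewrite invr_gt0 ltr0n.
have restrE n : mrestr m1 (mD n) E = mrestr m2 (mD n) E.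
  apply: (measure_unique (@RGenOInfty.G R) (fun k => `]- k%:R, +oo[%classic)) => //.
  - exact: RGenOInfty.measurableE.
  - move=> _ _ [x ->] [y ->]; exists (Num.max x y).
    by apply/seteqP; split => z /=; rewrite !in_itv/= !andbT gt_max;
      [move=> [-> ->]|move=> /andP].
  - by move=> k; exists (- k%:R)%R.
  - apply/seteqP; split => // x _; exists (Num.truncn `|x|).+1 => //=.
    rewrite in_itv/= andbT ltrNl; apply: le_lt_trans (truncnS_gt _).
    by rewrite -normrN ler_norm.
  - move=> _ [x ->];
    change (m1 (`]x, +oo[%classic `&` D n) = m2 (`]x, +oo[%classic `&` D n)).
    rewrite DE.
    apply: m12.
    by rewrite lt_max pos orbT.
  - move=> k;
    change (m1 (`](- k%:R : R)%R, +oo[%classic `&` D n) < +oo)%E.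
    rewrite DE.
    apply: m1fin.
    by rewrite lt_max pos orbT.
have EU : E = \bigcup_n (E `&` D n).
  rewrite -setI_bigcupr; apply/esym/setIidl => x /E0 /=; rewrite in_itv/= andbT => x0.
  exists (Num.truncn x^-1) => //=.
  by rewrite /D/= in_itv/= andbT invf_plt ?posrE ?ltr0n// truncnS_gt.
have lim (m : {measure set R -> \bar R}) :
    (mrestr m (mD n) E @[n --> \oo] --> m E)%E.
  rewrite {2}EU; apply: nondecreasing_cvg_mu => [n||].
  - exact: measurableI.
  - by apply: bigcupT_measurable => n; exact: measurableI.
  - move=> i j ij; apply/subsetPset; apply: setIS => x /=.
    rewrite /D/= !in_itv/= !andbT; apply: le_lt_trans.
    by rewrite lef_pV2 ?posrE ?ltr0n// ler_nat ltnS.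
apply: cvg_unique (lim m2) => //; apply: cvg_trans (lim m1).
by apply: near_eq_cvg; apply: nearW => n; rewrite restrE.
Qed.

End EqMeasurePos.

(** * Integrals under extended couplings and one-dimensional jump measures *)

Section CouplingIntegrals.
Context {R : realType} {d : nat}.
Local Notation vec := (d.-tuple R).
Implicit Types (n k : {measure set vec -> \bar R}).

Lemma measurable_Omega2 : measurable (Omega2 R d).
Proof.
have m1 : measurable ((@fst vec vec) @^-1` [set s | nnegv s]).
  by rewrite -[X in measurable X]setTI; apply: measurable_fst => //; exact: measurable_nnegv.
have m2 : measurable ((@snd vec vec) @^-1` [set s | nnegv s]).
  by rewrite -[X in measurable X]setTI; apply: measurable_snd => //; exact: measurable_nnegv.
have mO1 : measurable ((@fst vec vec) @^-1` Omega R d).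
  by rewrite -[X in measurable X]setTI; apply: measurable_fst => //; exact: measurable_Omega.
have mO2 : measurable ((@snd vec vec) @^-1` Omega R d).
  by rewrite -[X in measurable X]setTI; apply: measurable_snd => //; exact: measurable_Omega.
rewrite (_ : Omega2 R d = (fst @^-1` [set s | nnegv s]) `&` (snd @^-1` [set s | nnegv s])
   `&` ((fst @^-1` Omega R d) `|` (snd @^-1` Omega R d))).
  by apply: measurableI; [exact: measurableI|exact: measurableU].
apply/seteqP; split => -[s t] /=.
  by move=> [s0 t0 [i|i]]; split => //; [left|right].
by move=> [[s0 t0] [[_ i]|[_ i]]]; split => //; [left|right].
Qed.

Lemma integral_Omega2 (g : {measure set (vec * vec)%type -> \bar R})
    (h : vec * vec -> \bar R) :
  g (~` Omega2 R d) = 0 -> measurable_fun setT h -> (forall p, 0 <= h p) ->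
  \int[g]_(p in Omega2 R d) h p = \int[g]_p h p.
Proof.
move=> g0 mh h0; rewrite integral_mkcond.
apply: (ge0_integral_ae0 (measurableC measurable_Omega2) g0) => //.
- apply/(measurable_restrictT _ measurable_Omega2); exact: measurable_funTS.
- by move=> p; rewrite patchE; case: ifP.
- by move=> p /contrapT pO; rewrite patchE mem_set.
Qed.

(** The marginal condition says nothing about pairs whose first component is 0, so [f] must vanish
    at the origin, the only nonnegative vector outside [Omega]. *)
Lemma integral_fst_coupling n1 (g : {measure set (vec * vec)%type -> \bar R})
    (f : vec -> \bar R) : on_Omega n1 -> g (~` Omega2 R d) = 0 ->
  (forall B, measurable B -> B `<=` Omega R d -> pushforward g fst B = n1 B) ->
  measurable_fun setT f -> (forall s, 0 <= f s) ->
  (forall s, nnegv s -> ~ Omega R d s -> f s = 0) ->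
  \int[g]_p f p.1 = \int[n1]_s f s.
Proof.
move=> n10 g0 gfst mf f0 fO.
have mO := @measurable_Omega R d.
have mfO : measurable_fun setT (f \_ (Omega R d)).
  by apply/(measurable_restrictT _ mO); exact: measurable_funTS.
have fO0 s : 0 <= (f \_ (Omega R d)) s by rewrite patchE; case: ifP.
transitivity (\int[g]_p (f \_ (Omega R d)) p.1).
  apply: (ge0_integral_ae0 (measurableC measurable_Omega2) g0) => //.
  - exact: measurableT_comp.
  - exact: measurableT_comp.
  - move=> p /contrapT [p1 _ _]; rewrite patchE; case: ifPn => // /negP pO.
    by apply: fO => //; move: pO; rewrite inE.
transitivity (\int[n1]_s (f \_ (Omega R d)) s).
  apply: (eq_law_integral (Y2 := id) (D := Omega R d)) => //.
  - by move=> s sO; rewrite patchE memNset.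
apply: (ge0_integral_ae0 (measurableC mO) n10) => //.
by move=> s /contrapT sO; rewrite patchE mem_set.
Qed.

Lemma integral_snd_coupling n2 (g : {measure set (vec * vec)%type -> \bar R})
    (f : vec -> \bar R) : on_Omega n2 -> g (~` Omega2 R d) = 0 ->
  (forall B, measurable B -> B `<=` Omega R d -> pushforward g snd B = n2 B) ->
  measurable_fun setT f -> (forall s, 0 <= f s) ->
  (forall s, nnegv s -> ~ Omega R d s -> f s = 0) ->
  \int[g]_p f p.2 = \int[n2]_s f s.
Proof.
move=> n20 g0 gsnd mf f0 fO.
have mO := @measurable_Omega R d.
have mfO : measurable_fun setT (f \_ (Omega R d)).
  by apply/(measurable_restrictT _ mO); exact: measurable_funTS.
have fO0 s : 0 <= (f \_ (Omega R d)) s by rewrite patchE; case: ifP.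
transitivity (\int[g]_p (f \_ (Omega R d)) p.2).
  apply: (ge0_integral_ae0 (measurableC measurable_Omega2) g0) => //.
  - exact: measurableT_comp.
  - exact: measurableT_comp.
  - move=> p /contrapT [_ p2 _]; rewrite patchE; case: ifPn => // /negP pO.
    by apply: fO => //; move: pO; rewrite inE.
transitivity (\int[n2]_s (f \_ (Omega R d)) s).
  apply: (eq_law_integral (Y2 := id) (D := Omega R d)) => //.
  - by move=> s sO; rewrite patchE memNset.
apply: (ge0_integral_ae0 (measurableC mO) n20) => //.
by move=> s /contrapT sO; rewrite patchE mem_set.
Qed.

(** Equality of one-dimensional Levy marginals; the set where the coordinate is 0 is excluded
    because marginal laws do not determine its mass. *)
Definition same_jumps n k (i j : 'I_d) : Prop :=
  forall B : set R, measurable B -> B `<=` `]0%R, +oo[ ->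
    n (coord i @^-1` B) = k (coord j @^-1` B).

Lemma on_Omega_nneg n : on_Omega n -> n (~` [set s | nnegv s]) = 0.
Proof.
move=> n0.
apply: (subset_measure0 (measurableC measurable_nnegv) (measurableC measurable_Omega) _ n0).
by move=> s sn [s0 _]; exact: sn.
Qed.

Lemma same_jumps_integral n k i j (f : R -> \bar R) :
  on_Omega n -> on_Omega k -> same_jumps n k i j ->
  measurable_fun setT f -> (forall r, 0 <= f r) -> f 0%R = 0 ->
  \int[n]_s f (tnth s i) = \int[k]_s f (tnth s j).
Proof.
move=> n0 k0 nk mf f0 f00.
pose P : set R := `]0%R, +oo[%classic; have mP : measurable P by exact: measurable_itv.
have mfP : measurable_fun setT (f \_ P).
  by apply/(measurable_restrictT _ mP); exact: measurable_funTS.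
have fP0 r : 0 <= (f \_ P) r by rewrite patchE; case: ifP.
have key (m : {measure set vec -> \bar R}) (l : 'I_d) : on_Omega m ->
    \int[m]_s f (tnth s l) = \int[m]_s (f \_ P) (tnth s l).
  move=> /on_Omega_nneg m0.
  apply: (ge0_integral_ae0 (measurableC measurable_nnegv) m0) => //.
  - by apply: measurableT_comp => //; exact: (measurable_coord l).
  - by apply: measurableT_comp => //; exact: (measurable_coord l).
  - move=> s /contrapT s0; rewrite patchE; case: ifPn => // /negP.
    rewrite inE /P/= in_itv/= andbT => sl.
    suff -> : tnth s l = 0%R by [].
    by apply/le_anti; rewrite s0 andbT leNgt; apply/negP.
rewrite !key//; apply: (eq_law_integral (Y1 := coord i) (Y2 := coord j) (D := P)) => //.
- exact: measurable_coord.
- exact: measurable_coord.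
- by move=> r rP; rewrite patchE memNset.
Qed.

Lemma integral_sqnormv n : \int[n]_s (sqnormv s)%:E =
  \sum_(i < d) \int[n]_s ((tnth s i) ^+ 2)%:E.
Proof.
rewrite -ge0_integral_sum//.
- by apply: eq_integral => s _; rewrite /sqnormv sumEFin.
- move=> i; apply/measurable_EFinP; apply: measurable_funX.
  exact: (measurable_coord i).
- by move=> i s _; rewrite lee_fin sqr_ge0.
Qed.

End CouplingIntegrals.

Lemma measure_ae_eq d (T : measurableType d) (R : realType)
    (m : {measure set T -> \bar R}) (N A B : set T) :
  measurable N -> m N = 0 -> measurable A -> measurable B ->
  (forall x, ~ N x -> A x <-> B x) -> m A = m B.
Proof.
move=> mN N0 mA mB AB.
have mC := measurableC mN; have C0 : m (~` ~` N) = 0 by rewrite setCK.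
rewrite -(measure_conegligible_setI mC mA C0) -(measure_conegligible_setI mC mB C0).
by congr (m _); apply/seteqP; split => x [Nx /(AB _ Nx)].
Qed.

Lemma markov_fin d (T : measurableType d) (R : realType)
    (m : {measure set T -> \bar R}) (g : T -> R) (c : R) :
  measurable_fun setT g -> (forall x, 0 <= g x)%R -> (0 < c)%R ->
  \int[m]_x (g x)%:E < +oo -> m [set x | (c <= g x)%R] < +oo.
Proof.
move=> mg g0 c0 gfin.
have := le_integral_abse m measurableT ((measurable_EFinP _ _).2 mg) c0.
under eq_integral do rewrite gee0_abs ?lee_fin//.
rewrite setTI (_ : [set x | _] = [set x | (c <= g x)%R]); last first.
  by apply/seteqP; split => x /=; rewrite ger0_norm// lee_fin.
move=> /le_lt_trans/(_ gfin) h; rewrite ltey; apply/eqP => moo.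
by move: h; rewrite moo gt0_muley ?lte_fin// ltxx.
Qed.

Lemma measure_exists_null d (T : measurableType d) (R : realType)
    (m : {measure set T -> \bar R}) (n : nat) (P : 'I_n -> set T) :
  (forall i, measurable (P i)) -> (forall i, m (P i) = 0) ->
  m [set x | exists i, P i x] = 0.
Proof.
move=> mP P0.
have -> : [set x | exists i, P i x] = \big[setU/set0]_(i < n) P i.
  rewrite -bigcup_seq; apply/seteqP; split => x /=.
    by move=> [i Pi]; exists i => //=; rewrite mem_index_enum.
  by move=> [i _ Pi]; exists i.
suff [] : measurable (\big[setU/set0]_(i < n) P i) /\
  m (\big[setU/set0]_(i < n) P i) = 0 by [].
elim/big_ind : _ => //.
move=> A B [mA A0] [mB B0]; split; first exact: measurableU.
by rewrite null_set_setU.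
Qed.

(** * The comonotone coupling of an intensity with the diagonal one *)

Section Optimal.
Context {R : realType} {d : nat} (i0 : 'I_d).
Local Notation vec := (d.-tuple R).
Variable k : {measure set vec -> \bar R}.
Hypotheses (k0 : on_Omega k)
  (kdiag : forall i j, k [set s | tnth s i != tnth s j] = 0)
  (kinf : k [set s | (0 < tnth s i0)%R] = +oo)
  (k2 : \int[k]_s ((tnth s i0) ^+ 2)%:E < +oo).

Lemma measurable_coord_neq i j : measurable [set s : vec | tnth s i != tnth s j].
Proof.
rewrite (_ : mkset _ = (fun s : vec => tnth s i - tnth s j)%R @^-1` (~` [set 0%R])).
  rewrite -[X in measurable X]setTI.
  by apply: measurable_funB => //; [exact: (measurable_coord i)|exact: (measurable_coord j)|
    apply: measurableC].
by apply/seteqP; split => s /=; rewrite -subr_eq0 => /eqP.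
Qed.

Lemma same_jumps_diag i : same_jumps k k i i0.
Proof.
move=> B mB B0; apply: (measure_ae_eq (measurable_coord_neq i i0)) => //.
- by rewrite -[X in measurable X]setTI; exact: measurable_coord.
- by rewrite -[X in measurable X]setTI; exact: measurable_coord.
- by move=> s /negP; rewrite negbK /coord /= => /eqP ->.
Qed.

Definition jump_tail (b : R) : R := tail k (coord i0) b.

Lemma coord_level_fin r : (0 < r)%R -> k [set s | (r <= coord i0 s)%R] < +oo.
Proof.
move=> r0.
have := @markov_fin _ _ _ k (fun s => coord i0 s ^+ 2)%R (r ^+ 2)%R.
move=> /(_ _ _ _ k2) h; apply: (le_lt_trans _ (h _ _ _)) => //.
- apply: le_measure; rewrite ?inE.
  + exact: (measurable_ge_level (measurable_coord i0)).
  + apply: (measurable_ge_level (f := (fun s => coord i0 s ^+ 2)%R)).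
    by apply: measurable_funX; exact: measurable_coord.
  + by move=> s /= rs; rewrite lerXn2r// nnegrE ltW// (lt_le_trans r0).
- by apply: measurable_funX; exact: measurable_coord.
- by move=> s; rewrite sqr_ge0.
- by rewrite exprn_gt0.
Qed.

Section Measure.
Variable n : {measure set vec -> \bar R}.
Hypotheses (n0 : on_Omega n) (nk : forall i, same_jumps n k i i0).

Lemma sqnorm_jumps : \int[n]_s (sqnormv s)%:E =
  \sum_(i < d) \int[k]_s ((tnth s i0) ^+ 2)%:E.
Proof.
rewrite integral_sqnormv; apply: eq_bigr => i _.
apply: (same_jumps_integral (f := fun r => (r ^+ 2)%:E) n0 k0 (nk i)) => //.
- by apply/measurable_EFinP; exact: exprn_measurable.
- by move=> r; rewrite lee_fin sqr_ge0.
- by rewrite expr0n.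
Qed.

Lemma sqnorm_fin : \int[n]_s (sqnormv s)%:E < +oo.
Proof. by rewrite sqnorm_jumps; apply: lte_sum_pinfty => i _. Qed.

(** If the sum is at least r, some coordinate is at least r / d; Markov's inequality for the squared
    norm concludes. *)
Lemma vsum_level_fin r : (0 < r)%R -> n [set s | (r <= vsum s)%R] < +oo.
Proof.
move=> r0.
have d0 : (0 < d%:R :> R)%R by rewrite ltr0n; case: (d) i0 => // -[].
have := @markov_fin _ _ _ n (@sqnormv R d) ((r / d%:R) ^+ 2)%R.
move=> /(_ _ _ _ sqnorm_fin) h; apply: (le_lt_trans _ (h _ _ _)) => //.
- apply: le_measure; rewrite ?inE.
  + exact: (measurable_ge_level (measurable_vsum)).
  + exact: (measurable_ge_level (@measurable_sqnormv R d)).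
  + move=> s /= rs.
    have [i ri] : exists i, (r / d%:R <= tnth s i)%R.
      apply: contrapT => /forallNP h'; move: rs; rewrite leNgt => /negP; apply.
      have -> : r = (\sum_(i < d) (r / d%:R))%R.
        by rewrite sumr_const card_ord -[RHS]mulr_natr divfK// lt0r_neq0.
      apply: ltr_sum => [|i _]; first by apply/hasP; exists i0 => //; rewrite mem_index_enum.
      by rewrite ltNge; apply/negP/h'.
    rewrite /sqnormv (bigD1 i)//= -[leLHS]addr0 lerD//.
      by rewrite lerXn2r// nnegrE ?(le_trans _ ri)// divr_ge0// ltW.
    by apply: sumr_ge0 => j _; rewrite sqr_ge0.
- exact: measurable_sqnormv.
- by move=> s; apply: sumr_ge0 => i _; rewrite sqr_ge0.
- by rewrite exprn_gt0// divr_gt0.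
Qed.

Lemma jumps_gtE r i : (0 <= r)%R ->
  n [set s | (r < tnth s i)%R] = k [set s | (r < tnth s i0)%R].
Proof.
move=> r0; have := nk i (measurable_itv `]r, +oo[).
rewrite (_ : coord i @^-1` _ = [set s | (r < tnth s i)%R]); last first.
  by apply/seteqP; split => s /=; rewrite in_itv/= andbT.
rewrite (_ : coord i0 @^-1` _ = [set s | (r < tnth s i0)%R]); last first.
  by apply/seteqP; split => s /=; rewrite in_itv/= andbT.
by apply => x /=; rewrite !in_itv/= !andbT; apply: le_lt_trans.
Qed.

Lemma jumps_le_vsum r : (0 <= r)%R ->
  k [set s | (r < tnth s i0)%R] <= n [set s | (r < vsum s)%R].
Proof.
move=> r0; rewrite -(jumps_gtE i0 r0).
have mc : measurable [set s : vec | (r < tnth s i0)%R].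
  exact: (measurable_gt_level (measurable_coord i0)).
have n00 := on_Omega_nneg n0.
rewrite -(measure_conegligible_setI measurable_nnegv mc n00).
apply: le_measure; rewrite ?inE.
- by apply: measurableI => //; exact: measurable_nnegv.
- exact: (measurable_gt_level measurable_vsum).
- by move=> s [s0 /= h]; apply: lt_le_trans h _; exact: le_vsum.
Qed.

Lemma vsum_inf : n [set s | (0 < vsum s)%R] = +oo.
Proof. by apply/eqP; rewrite -leye_eq -kinf; exact: jumps_le_vsum. Qed.

Lemma jump_tail_le b : (0 < b)%R -> (jump_tail b <= tail n vsum b)%R.
Proof.
move=> b0; rewrite -lee_fin.
rewrite -(tail_fin (measurable_coord i0) coord_level_fin)//.
by rewrite -(tail_fin measurable_vsum vsum_level_fin)// jumps_le_vsum// ltW.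
Qed.

Local Notation t := (quantile n vsum jump_tail).

Lemma jump_tail_ge0 b : (0 <= jump_tail b)%R.
Proof. exact: tail_ge0. Qed.

Lemma jump_tail_nincr b b' : (0 < b)%R -> (b <= b')%R -> (jump_tail b' <= jump_tail b)%R.
Proof. exact: (tail_nincr (measurable_coord i0) coord_level_fin). Qed.

Lemma jump_tail_right b y : (0 < b)%R -> (y < jump_tail b)%R ->
  exists2 b', (b < b')%R & (y < jump_tail b')%R.
Proof. exact: (tail_gt_right (measurable_coord i0) coord_level_fin). Qed.

Let mt : measurable_fun setT t.
Proof.
apply: measurable_quantile.
- exact: measurable_vsum.
- exact: vsum_level_fin.
- exact: vsum_inf.
- exact: jump_tail_right.
- exact: jump_tail_nincr.
- exact: jump_tail_le.
Qed.

Let t_ge0 p : (0 <= t p)%R.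
Proof.
apply: quantile_ge0.
- exact: measurable_vsum.
- exact: vsum_level_fin.
- exact: jump_tail_le.
Qed.

Definition const_vec (r : R) : vec := [tuple r | _ < d].

Lemma measurable_const_vec : measurable_fun setT const_vec.
Proof.
apply: measurable_tupleP => i.
by rewrite (_ : (fun _ => _) = id)//; apply/funext => r; rewrite tnth_mktuple.
Qed.

Definition comonotone_map (p : vec * measurableTypeR R) : vec * vec :=
  (p.1, const_vec (t p)).

Lemma measurable_comonotone_map : measurable_fun setT comonotone_map.
Proof.
apply: measurable_fun_pair; first exact: measurable_fst.
apply: (measurableT_comp measurable_const_vec); exact: mt.
Qed.

Definition comonotone_coupling : {measure set (vec * vec)%type -> \bar R} :=
  image_measure (mass_ranked n) measurable_comonotone_map.

Lemma comonotone_couplingE B :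
  comonotone_coupling B = mass_ranked n (comonotone_map @^-1` B).
Proof. by []. Qed.

Lemma comonotone_on_Omega2 : comonotone_coupling (~` Omega2 R d) = 0.
Proof.
rewrite comonotone_couplingE.
have mO := measurableC (@measurable_Omega R d).
have mA : measurable (comonotone_map @^-1` (~` Omega2 R d)).
  rewrite -[X in measurable X]setTI; apply: measurable_comonotone_map => //.
  exact: measurableC (@measurable_Omega2 R d).
have mB : measurable ((~` Omega R d) `*` [set: measurableTypeR R]) by exact: measurableX.
have AB : comonotone_map @^-1` (~` Omega2 R d) `<=`
    (~` Omega R d) `*` [set: measurableTypeR R].
  move=> [s u] /= h; split => // -[s0 si]; apply: h; split => //=; last by left.
  by move=> i; rewrite tnth_mktuple.
apply: (subset_measure0 mA mB AB).
transitivity (n (~` Omega R d) * unif01 setT); last by rewrite n0 mul0e.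
exact: mass_rankedX.
Qed.

Lemma comonotone_fst B : measurable B -> pushforward comonotone_coupling fst B = n B.
Proof.
move=> mB; rewrite /pushforward comonotone_couplingE.
rewrite (_ : _ @^-1` _ = B `*` setT); last first.
  by apply/seteqP; split => -[s u] //= -[].
transitivity (n B * unif01 setT); last by rewrite probability_setT mule1.
exact: mass_rankedX.
Qed.

(** Since [k] is carried by the diagonal, it is the law of (t, ..., t) as soon as t has the law of
    one coordinate of [k] on the positive half-line; [mass_quantile_gt] gives that law through its
    tails. *)
Lemma comonotone_snd B : measurable B -> B `<=` Omega R d ->
  pushforward comonotone_coupling snd B = k B.
Proof.
move=> mB BO; rewrite /pushforward comonotone_couplingE.
pose Bd : set R := const_vec @^-1` B.
have mBd : measurable Bd.
  by rewrite -[X in measurable X]setTI; exact: measurable_const_vec.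
transitivity (image_measure (mass_ranked n) mt Bd) => //.
transitivity (image_measure k (measurable_coord i0) Bd).
  have lawt r : (0 < r)%R ->
      image_measure (mass_ranked n) mt `]r, +oo[%classic = k [set s | (r < coord i0 s)%R].
    move=> r0; transitivity (mass_ranked n [set p | (r < t p)%R]).
      by congr (mass_ranked n _); apply/seteqP; split => p /=; rewrite in_itv/= andbT.
    rewrite (tail_fin (measurable_coord i0) coord_level_fin)//.
    apply: mass_quantile_gt => //.
    - exact: measurable_vsum.
    - exact: vsum_level_fin.
    - exact: vsum_inf.
    - exact: jump_tail_ge0.
    - exact: jump_tail_right.
    - exact: jump_tail_nincr.
    - exact: jump_tail_le.
  apply: eq_measure_pos => //.
  - move=> r r0; rewrite lawt//.
    by congr (k _); apply/seteqP; split => p /=; rewrite in_itv/= andbT.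
  - move=> r r0; rewrite lawt//; apply: (le_lt_trans _ (coord_level_fin r0)).
    apply: le_measure; rewrite ?inE.
    + exact: (measurable_gt_level (measurable_coord i0)).
    + exact: (measurable_ge_level (measurable_coord i0)).
    + by move=> s /= /ltW.
  - move=> r /BO [r0 [i ri]]; rewrite /= in_itv/= andbT lt_neqAle.
    by have := r0 i; rewrite tnth_mktuple in ri *; rewrite eq_sym ri => ->.
pose N : set vec := [set s | exists i, tnth s i != tnth s i0].
apply: (@measure_ae_eq _ _ _ k N).
- by apply: (measurable_exists (fun i => measurable_coord_neq i i0)).
- by apply: (measure_exists_null (P := fun i => [set s : vec | tnth s i != tnth s i0])) => i;
    [exact: measurable_coord_neq|exact: kdiag].
- by rewrite -[X in measurable X]setTI; exact: measurable_coord.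
- by [].
- move=> s Ns; rewrite /Bd /=.
  suff -> : const_vec (coord i0 s) = s by [].
  apply: eq_from_tnth => i; rewrite tnth_mktuple; apply/esym/eqP.
  by apply: contrapT => /negP h; apply: Ns; exists i.
Qed.

Lemma comonotone_support b : (0 < b)%R -> (0 < jump_tail b)%R ->
  comonotone_coupling [set p |
    (b < tnth p.2 i0 /\ vsum p.1 < level n vsum (jump_tail b))%R \/
    (level n vsum (jump_tail b) < vsum p.1 /\ tnth p.2 i0 <= b)%R] = 0.
Proof.
move=> b0 Vb; rewrite comonotone_couplingE.
rewrite (_ : _ @^-1` _ = set0) ?measure0//; apply/seteqP; split => p //=.
have [h1 h2] := quantile_gt_level measurable_vsum vsum_level_fin vsum_inf jump_tail_right
  jump_tail_nincr jump_tail_le p b0 Vb.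
rewrite tnth_mktuple => -[[/h1 + v]|[/h2 + v]].
  by rewrite leNgt v.
by rewrite ltNge v.
Qed.

End Measure.
End Optimal.

(** * Layers of the correlation *)

Section Pointwise.
Context {R : realType} {d : nat}.
Local Open Scope ring_scope.
Local Notation vec := (d.-tuple R).

Definition excess (l r : R) : R := Num.max (r - l) 0.

Lemma excess_ge0 l r : 0 <= excess l r.
Proof. by rewrite /excess le_max lexx orbT. Qed.

Lemma measurable_excess d1 (T : measurableType d1) l (f : T -> R) :
  measurable_fun setT f -> measurable_fun setT (fun x => excess l (f x)).
Proof. by move=> mf; apply: measurable_maxr => //; exact: measurable_funB. Qed.

Lemma excess_gt l r : l <= r -> excess l r = r - l.
Proof. by move=> lr; rewrite /excess max_l// subr_ge0. Qed.

Lemma excess_le l r : r <= l -> excess l r = 0.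
Proof. by move=> lr; rewrite /excess max_r// subr_le0. Qed.

Definition two_above (eta : R) : set vec :=
  [set s | exists i, exists j, [/\ i != j, eta < tnth s i & eta < tnth s j]].

Definition off_axes : set vec :=
  [set s | exists i, exists j, [/\ i != j, tnth s i != 0 & tnth s j != 0]].

(** In the excess of the sum the level is subtracted once; in the sum of the excesses it is
    subtracted once for each coordinate above it. Two coordinates above eta >= l therefore give a
    gain of at least l. *)
Lemma excess_superadd (s : vec) l eta : nnegv s -> 0 <= l <= eta ->
  \sum_(i < d) excess l (tnth s i) + l * \1_(two_above eta) s <= excess l (vsum s).
Proof.
move=> s0 /andP[l0 leta].
have [[j lj]|nj] := pselect (exists j, l < tnth s j); last first.
  rewrite big1 => [|i _]; last first.
    by apply: excess_le; rewrite leNgt; apply/negP => h; apply: nj; exists i.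
  rewrite add0r indicE memNset ?mulr0 ?excess_ge0// => -[i [_ [_ h _]]].
  by apply: nj; exists i; exact: le_lt_trans h.
have sumE : vsum s = tnth s j + \sum_(i < d | i != j) tnth s i.
  by rewrite /vsum (bigD1 j).
have le_exc i : excess l (tnth s i) <= tnth s i.
  by rewrite /excess ge_max s0 andbT gerBl.
rewrite (excess_gt (r := vsum s)); last first.
  by rewrite sumE (le_trans (ltW lj))// lerDl sumr_ge0.
rewrite (bigD1 j)//= (excess_gt (ltW lj)) sumE indicE.
have [/set_mem E|_] := boolP (s \in _); last first.
  rewrite mulr0 addr0 [leRHS]addrAC lerD2l.
  by apply: ler_sum => i _.
have [i ij li] : exists2 i, i != j & eta < tnth s i.
  move: E => [a [b [ab sa sb]]].
  by have [aj|aj] := eqVneq a j; [exists b => //; rewrite -aj eq_sym|exists a].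
rewrite (bigD1 i)//= [in leRHS](bigD1 i)//= (excess_gt (r := tnth s i)); last first.
  by rewrite ltW// (le_lt_trans _ li).
have : \sum_(i0 < d | (i0 != j) && (i0 != i)) excess l (tnth s i0) <=
       \sum_(i0 < d | (i0 != j) && (i0 != i)) tnth s i0 by apply: ler_sum.
by rewrite mulr1; lra.
Qed.

Lemma excess_axes (s : vec) l : 0 <= l -> nnegv s -> ~ off_axes s ->
  excess l (vsum s) = \sum_(i < d) excess l (tnth s i).
Proof.
move=> l0 s0 ns.
have [[j sj]|nj] := pselect (exists j, tnth s j != 0); last first.
  have z i : tnth s i = 0 by apply/eqP/negPn/negP => h; apply: nj; exists i.
  rewrite /vsum !big1 ?excess_le// => i _; rewrite z// excess_le//.
have z i : i != j -> tnth s i = 0.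
  move=> ij; apply/eqP/negPn/negP => h; apply: ns; by exists i, j.
rewrite /vsum (bigD1 j)//= [in RHS](bigD1 j)//= !big1 ?addr0//.
by move=> i ij; rewrite z// excess_le.
Qed.

(** Riemann sum of the layer-cake formula: h times the number of grid points below x recovers x, cut
    off at M h, up to one step h. *)
Lemma layer_sum_bounds (M : nat) (h x : R) : 0 < h -> 0 <= x ->
  Num.min x (M.+1%:R * h) - h <= \sum_(j < M) h * (j.+1%:R * h < x)%R%:R <=
  Num.min x (M%:R * h).
Proof.
move=> h0 x0; elim: M => [|M ih].
  by rewrite big_ord0 mul1r mul0r (min_r x0) lexx andbT subr_le0 ge_min lexx orbT.
rewrite big_ord_recr/=; move: ih; set S := \sum_(_ < _) _ => /andP[ih1 ih2].
have [hx|hx] := ltP (M.+1%:R * h) x.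
  rewrite (min_r (ltW hx)) in ih1.
  rewrite min_r in ih2; last first.
    by apply: le_trans (ltW hx); rewrite ler_wpM2r ?ler_nat// ltW.
  rewrite mulr1; apply/andP; split; last first.
    by rewrite -[in leRHS](natr1 M) mulrDl mul1r lerD2r.
  apply: le_trans (_ : M.+2%:R * h - h <= _); first by rewrite lerD2r ge_min lexx orbT.
  by rewrite -(natr1 M.+1) mulrDl mul1r addrK; lra.
rewrite mulr0 addr0; apply/andP; split; last first.
  by apply: le_trans ih2 _; rewrite ge_min lexx.
rewrite min_l in ih1 => //.
by rewrite min_l// (le_trans hx)// ler_wpM2r ?ler_nat// ltW.
Qed.

End Pointwise.

Section Comparison.
Context {R : realType} {d : nat} (i0 : 'I_d).
Local Notation vec := (d.-tuple R).
Variable k : {measure set vec -> \bar R}.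
Hypotheses (k0 : on_Omega k)
  (kdiag : forall i j, k [set s | tnth s i != tnth s j] = 0)
  (kinf : k [set s | (0 < tnth s i0)%R] = +oo)
  (k2 : \int[k]_s ((tnth s i0) ^+ 2)%:E < +oo).
Local Notation V := (jump_tail i0 k).
Local Notation coupling := {measure set (vec * vec)%type -> \bar R}.

Let mcoord i : measurable_fun setT (fun s : vec => tnth s i).
Proof. exact: measurable_coord. Qed.

Let mgt b : measurable_fun setT (fun s : vec => ((b < tnth s i0)%R%:R : R)).
Proof. exact: (measurable_coord_gt i0). Qed.

(** Positive parts, so that integrands are nonnegative on the whole ambient space; couplings are
    carried by nonnegative vectors, where nothing changes. *)
Definition vsum_pos (s : vec) : R := excess 0 (vsum s).
Definition height (s : vec) : R := excess 0 (tnth s i0).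

Let mvsum_pos : measurable_fun setT vsum_pos.
Proof. by apply: measurable_excess; exact: measurable_vsum. Qed.

Lemma vsum_posE s : nnegv s -> vsum_pos s = vsum s.
Proof. by move=> s0; rewrite /vsum_pos excess_gt ?subr0// vsum_ge0. Qed.

Lemma heightE s : nnegv s -> height s = tnth s i0.
Proof. by move=> s0; rewrite /height excess_gt ?subr0. Qed.

(* The correlation [\int vsum p.1 * height p.2] of a coupling is analysed
   through its layers [height p.2 > b]. *)
Definition layer (g : coupling) (b : R) : \bar R :=
  \int[g]_p (vsum_pos p.1 * (b < tnth p.2 i0)%R%:R)%:E.

Definition correlation (g : coupling) : \bar R :=
  \int[g]_p (vsum_pos p.1 * height p.2)%:E.

Let V_measure b : (0 < b)%R -> k [set s | (b < tnth s i0)%R] = (V b)%:E.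
Proof. exact: (tail_fin (measurable_coord i0) (coord_level_fin k2)). Qed.

Section OneCoupling.
Variables (n : {measure set vec -> \bar R}) (g : coupling).
Hypotheses (n0 : on_Omega n) (ng : extended_coupling n k g).

Let g0 : g (~` Omega2 R d) = 0. Proof. by case: ng. Qed.

Lemma integral_fst (f : vec -> R) : measurable_fun setT f ->
  (forall s, 0 <= f s)%R -> (forall s, nnegv s -> ~ Omega R d s -> f s = 0%R) ->
  \int[g]_p (f p.1)%:E = \int[n]_s (f s)%:E.
Proof.
case: ng => _ _ gf _ mf f0 fO.
apply: (integral_fst_coupling (f := fun s => (f s)%:E)) => //.
- exact/measurable_EFinP.
- by move=> s s0 sO; rewrite fO.
Qed.

Lemma integral_snd (f : vec -> R) : measurable_fun setT f ->
  (forall s, 0 <= f s)%R -> (forall s, nnegv s -> ~ Omega R d s -> f s = 0%R) ->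
  \int[g]_p (f p.2)%:E = \int[k]_s (f s)%:E.
Proof.
case: ng => _ _ _ gs mf f0 fO.
apply: (integral_snd_coupling (f := fun s => (f s)%:E)) => //.
- exact/measurable_EFinP.
- by move=> s s0 sO; rewrite fO.
Qed.

(** The right-hand side depends on the marginals alone: this is the common bound against which all
    couplings are measured. *)
Lemma excess_layer b l : (0 < b)%R -> (0 <= l)%R ->
  \int[g]_p (excess l (vsum p.1) + l * (b < tnth p.2 i0)%R%:R)%:E =
  \int[n]_s (excess l (vsum s))%:E + (l * V b)%:E.
Proof.
move=> b0 l0.
have me : measurable_fun setT (fun s : vec => excess l (vsum s)).
  by apply: measurable_excess; exact: measurable_vsum.
have ml : measurable_fun setT (fun s : vec => l * (b < tnth s i0)%R%:R)%R.
  by apply: measurable_funM => //; exact: mgt.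
transitivity (\int[g]_p (excess l (vsum p.1))%:E +
    \int[g]_p (l * (b < tnth p.2 i0)%R%:R)%:E).
  rewrite -ge0_integralD//.
  - by move=> p _; rewrite /= lee_fin excess_ge0.
  - apply/measurable_EFinP.
    exact: (measurableT_comp me).
  - by move=> p _; rewrite /= lee_fin mulr_ge0.
  - apply/measurable_EFinP.
    exact: (measurableT_comp ml).
rewrite (integral_fst (f := fun s => excess l (vsum s)))//; last 2 first.
- by move=> s; exact: excess_ge0.
- move=> s s0 /(notOmega s0) z; rewrite excess_le// /vsum big1// => i _.
rewrite (integral_snd (f := fun s => l * (b < tnth s i0)%R%:R)%R)//; last 2 first.
- by move=> s; rewrite mulr_ge0.
- by move=> s s0 /(notOmega s0) ->; rewrite ltNge ltW// mulr0.
congr (_ + _); rewrite EFinM -V_measure//.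
under eq_integral do rewrite EFinM.
rewrite ge0_integralZl//; last by apply/measurable_EFinP; exact: mgt.
congr (_ * _).
rewrite -[X in _ = k X]setIT -integral_indic//; last first.
  exact: (measurable_gt_level (measurable_coord i0)).
apply: eq_integral => s _; rewrite indicE; congr (_%:R%:E).
by congr nat_of_bool; apply/idP/idP => [h|/set_mem//]; exact/mem_set.
Qed.

Let mlayer b : measurable_fun setT
  (fun p : vec * vec => (vsum_pos p.1 * (b < tnth p.2 i0)%R%:R)%:E).
Proof.
apply/measurable_EFinP; apply: measurable_funM.
- exact: (measurableT_comp mvsum_pos).
- exact: (measurableT_comp (mgt b)).
Qed.

Let mexcess b l : measurable_fun setT (fun p : vec * vec =>
   (excess l (vsum p.1) + l * (b < tnth p.2 i0)%R%:R)%:E).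
Proof.
apply/measurable_EFinP; apply: measurable_funD.
- by apply: measurable_excess; exact: (measurableT_comp measurable_vsum).
- by apply: measurable_funM => //; exact: (measurableT_comp (mgt b)).
Qed.

Lemma layer_ge0 b : 0 <= layer g b.
Proof. by apply: integral_ge0 => p _; rewrite /= lee_fin mulr_ge0// excess_ge0. Qed.

(** Pointwise, x 1_E <= (x - l)^+ + l 1_E for x >= 0 and any event E. *)
Lemma layer_le b l : (0 < b)%R -> (0 <= l)%R ->
  layer g b <= \int[n]_s (excess l (vsum s))%:E + (l * V b)%:E.
Proof.
move=> b0 l0; rewrite -excess_layer//; apply: ge0_le_integral => //.
- by move=> p _; rewrite /= lee_fin mulr_ge0// excess_ge0.
- move=> p _; rewrite /= lee_fin; case: (b < _)%R; rewrite ?mulr1 ?mulr0 ?addr0 ?excess_ge0//.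
  rewrite /vsum_pos /excess ge_max subr0 -lerBlDr le_max lexx/=.
  by rewrite addr_ge0// le_max lexx orbT.
Qed.

(** In x 1_E <= (x - l)^+ + l 1_E, equality fails only if x < l on E or x > l off E; the hypothesis
    makes this set null. *)
Lemma layer_ge b l : (0 < b)%R -> (0 <= l)%R ->
  g [set p | (b < tnth p.2 i0 /\ vsum p.1 < l)%R \/
             (l < vsum p.1 /\ tnth p.2 i0 <= b)%R] = 0 ->
  \int[n]_s (excess l (vsum s))%:E + (l * V b)%:E <= layer g b.
Proof.
move=> b0 l0; set N := mkset _ => N0; rewrite -excess_layer//.
have mN : measurable N.
  have m1 : measurable [set p : vec * vec | (b < tnth p.2 i0)%R].
    apply: (measurable_gt_level (f := fun p : vec * vec => tnth p.2 i0)).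
    exact: (measurableT_comp (mcoord i0)).
  have m2 : measurable [set p : vec * vec | (l <= vsum p.1)%R].
    apply: (measurable_ge_level (f := fun p : vec * vec => vsum p.1)).
    exact: (measurableT_comp measurable_vsum).
  have m3 : measurable [set p : vec * vec | (l < vsum p.1)%R].
    apply: (measurable_gt_level (f := fun p : vec * vec => vsum p.1)).
    exact: (measurableT_comp measurable_vsum).
  rewrite (_ : N = ([set p | (b < tnth p.2 i0)%R] `&` ~` [set p | (l <= vsum p.1)%R]) `|`
     ([set p | (l < vsum p.1)%R] `&` ~` [set p | (b < tnth p.2 i0)%R])).
    by apply: measurableU; apply: measurableI => //; exact: measurableC.
  apply/seteqP; split => p /=; rewrite /N/=.
    move=> [[h1 h2]|[h1 h2]]; [left|right]; split => //; apply/negP.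
      by rewrite -ltNge.
    by rewrite -leNgt.
  move=> [[h1 /negP h2]|[h1 /negP h2]]; [left|right]; split => //.
    by rewrite ltNge.
  by rewrite leNgt.
apply: (ge0_le_integral_ae0 mN N0) => //.
- by move=> p; rewrite /= lee_fin addr_ge0 ?excess_ge0// mulr_ge0.
- by move=> p; rewrite /= lee_fin mulr_ge0// excess_ge0.
- move=> p; rewrite /N/= => nN; rewrite /= lee_fin.
  have [bp|pb] := ltP b (tnth p.2 i0).
    have lv : (l <= vsum p.1)%R by rewrite leNgt; apply/negP => h; apply: nN; left.
    by rewrite !mulr1 /vsum_pos !excess_gt// ?(le_trans l0)// subr0 subrK.
  have vl : (vsum p.1 <= l)%R by rewrite leNgt; apply/negP => h; apply: nN; right.
  by rewrite !mulr0 addr0 excess_le.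
Qed.

(** Levels are defined for positive masses only, so thresholds b beyond the support of the jumps are
    treated apart. *)
Lemma layer_null b : (0 < b)%R -> V b = 0%R -> layer g b = 0.
Proof.
move=> b0 Vb0; case: ng => _ _ _ gs.
pose B := Omega R d `&` [set s | (b < tnth s i0)%R].
have mB' : measurable [set s : vec | (b < tnth s i0)%R].
  exact: (measurable_gt_level (measurable_coord i0)).
have mB : measurable B by apply: measurableI => //; exact: measurable_Omega.
have gB : g (snd @^-1` B) = 0.
  have := gs B mB (@subIsetl _ _ _); rewrite /pushforward => ->.
  rewrite measure_conegligible_setI//; last exact: measurable_Omega.
  by rewrite V_measure// Vb0.
have mN : measurable (~` Omega2 R d `|` snd @^-1` B).
  apply: measurableU; first exact: (measurableC (@measurable_Omega2 R d)).
  by rewrite -[X in measurable X]setTI; exact: measurable_snd.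
have N0 : g (~` Omega2 R d `|` snd @^-1` B) = 0.
  rewrite null_set_setU//; first exact: (measurableC (@measurable_Omega2 R d)).
  by rewrite -[X in measurable X]setTI; exact: measurable_snd.
rewrite /layer (ge0_integral_ae0 (g := cst 0) mN N0)//.
- by rewrite integral0.
- by move=> p; rewrite /= lee_fin mulr_ge0// excess_ge0.
- move=> p /= np; have [bp|] := ltP b (tnth p.2 i0); last by rewrite mulr0.
  exfalso; apply: np; have [[p1 p2 _]|] := pselect (Omega2 R d p); last by left.
  right; split => //; split => //; exists i0.
  by rewrite gt_eqF// (lt_trans b0).
Qed.

End OneCoupling.
End Comparison.

Lemma fatou_bound d (T : measurableType d) (R : realType)
    (m : {measure set T -> \bar R}) (N : set T) (f_ : nat -> T -> R) (f : T -> R)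
    (C : \bar R) (n0 : nat) :
  measurable N -> m N = 0 -> (forall n, measurable_fun setT (f_ n)) ->
  measurable_fun setT f -> (forall n x, 0 <= f_ n x)%R -> (forall x, 0 <= f x)%R ->
  (forall x, ~ N x -> (f_ n x @[n --> \oo] --> f x)%R) ->
  (forall n, (n0 <= n)%N -> \int[m]_x (f_ n x)%:E <= C) ->
  \int[m]_x (f x)%:E <= C.
Proof.
move=> mN N0 mf_ mf f_0 f0 f_f fC.
have mC := measurableC mN.
pose g_ n := (EFin \o f_ n) \_ (~` N).
have mg_ n : measurable_fun setT (g_ n).
  by apply/(measurable_restrictT _ mC); apply: measurable_funTS; exact/measurable_EFinP.
have g_0 n x : 0 <= g_ n x by rewrite /g_ patchE; case: ifP => //=; rewrite lee_fin.
have g_E n : \int[m]_x g_ n x = \int[m]_x (f_ n x)%:E.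
  apply: (ge0_integral_ae0 mN N0) => //.
  - exact/measurable_EFinP.
  - by move=> x; rewrite lee_fin.
  - by move=> x Nx; rewrite /g_ patchE mem_set.
have -> : \int[m]_x (f x)%:E = \int[m]_x limn_einf (g_ ^~ x).
  have limE x : limn_einf (g_ ^~ x) = ((EFin \o f) \_ (~` N)) x.
    apply: (cvg_limn_einf_sup _).1; rewrite /g_ patchE.
    case: ifPn => [/set_mem Nx|Nx].
      under eq_fun do rewrite patchE mem_set//=.
      by apply: cvg_EFin; [exact: nearW|exact: f_f].
    by under eq_fun do rewrite patchE (negbTE Nx); exact: cvg_cst.
  under [RHS]eq_integral do rewrite limE.
  apply: (ge0_integral_ae0 mN N0) => //.
  - exact/measurable_EFinP.
  - by apply/(measurable_restrictT _ mC); apply: measurable_funTS; exact/measurable_EFinP.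
  - by move=> x; rewrite patchE; case: ifP => //=; rewrite lee_fin.
  - by move=> x Nx; rewrite patchE mem_set.
apply: le_trans (fatou m measurableT mg_ (fun n x _ => g_0 n x)) _.
rewrite limn_einf_lim; apply: lime_le; first exact: is_cvg_einfs.
exists n0 => // n /= nn; apply: le_trans (fC n nn); rewrite -g_E.
by apply: ereal_inf_lbound; exists n => //=; exact: leqnn.
Qed.

(** * Comparison of correlations with an intensity on the axes *)

Section Correlation.
Context {R : realType} {d : nat} (i0 : 'I_d).
Local Notation vec := (d.-tuple R).
Local Notation coupling := {measure set (vec * vec)%type -> \bar R}.

Lemma measurable_two_above eta : measurable (two_above eta : set vec).
Proof.
rewrite (_ : two_above eta = [set s : vec | exists i, exists j,
   ([set s | i != j] `&` ([set s | (eta < tnth s i)%R] `&` [set s | (eta < tnth s j)%R])) s]).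
  apply: (measurable_exists (P := fun i => _)) => i.
  apply: (measurable_exists (P := fun j => _)) => j.
  apply: measurableI; last by apply: measurableI;
    [exact: (measurable_gt_level (measurable_coord i))
    |exact: (measurable_gt_level (measurable_coord j))].
  have [ij|ij] := boolP (i != j).
    by rewrite (_ : mkset _ = setT)//; apply/seteqP; split.
  by rewrite (_ : mkset _ = set0)//; apply/seteqP; split.
by apply/seteqP; split => s; move=> [i [j]]; [move=> []|move=> [? []]]; exists i, j.
Qed.

Lemma measurable_off_axes : measurable (off_axes : set vec).
Proof.
rewrite (_ : off_axes = [set s : vec | exists i, exists j,
   ([set s | i != j] `&` ([set s | tnth s i != 0%R] `&` [set s | tnth s j != 0%R])) s]).
  apply: (measurable_exists (P := fun i => _)) => i.
  apply: (measurable_exists (P := fun j => _)) => j.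
  apply: measurableI; last by apply: measurableI; exact: measurable_coord_neq0.
  have [ij|ij] := boolP (i != j).
    by rewrite (_ : mkset _ = setT)//; apply/seteqP; split.
  by rewrite (_ : mkset _ = set0)//; apply/seteqP; split.
by apply/seteqP; split => s; move=> [i [j]]; [move=> []|move=> [? []]]; exists i, j.
Qed.

Variable k : {measure set vec -> \bar R}.
Hypotheses (k0 : on_Omega k)
  (kdiag : forall i j, k [set s | tnth s i != tnth s j] = 0)
  (kinf : k [set s | (0 < tnth s i0)%R] = +oo)
  (k2 : \int[k]_s ((tnth s i0) ^+ 2)%:E < +oo).
Local Notation V := (jump_tail i0 k).

Let mcoord i : measurable_fun setT (fun s : vec => tnth s i).
Proof. exact: measurable_coord. Qed.

Lemma integral_excess_coord n i l : on_Omega n -> same_jumps n k i i0 -> (0 <= l)%R ->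
  \int[n]_s (excess l (tnth s i))%:E = \int[k]_s (excess l (tnth s i0))%:E.
Proof.
move=> n0 nk l0.
apply: (same_jumps_integral (f := fun r => (excess l r)%:E) n0 k0 nk).
- by apply/measurable_EFinP; exact: measurable_excess.
- by move=> r; rewrite lee_fin excess_ge0.
- by rewrite excess_le.
Qed.

Lemma integral_excess_axes n l : on_Omega n -> (forall i, same_jumps n k i i0) ->
  n off_axes = 0 -> (0 <= l)%R ->
  \int[n]_s (excess l (vsum s))%:E = \sum_(i < d) \int[k]_s (excess l (tnth s i0))%:E.
Proof.
move=> n0 nk noff l0.
under eq_bigr => i _ do rewrite -(integral_excess_coord n0 (nk i) l0).
have me i : measurable_fun setT (fun s : vec => excess l (tnth s i)).
  exact: measurable_excess.
rewrite -ge0_integral_sum//; last 2 first.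
- by move=> i; apply/measurable_EFinP.
- by move=> i s _; rewrite lee_fin excess_ge0.
have mN : measurable (~` [set s | nnegv s] `|` (off_axes : set vec)).
  apply: measurableU; last exact: measurable_off_axes.
  exact: (measurableC measurable_nnegv).
have N0 : n (~` [set s | nnegv s] `|` off_axes) = 0.
  rewrite null_set_setU//.
  - exact: (measurableC measurable_nnegv).
  - exact: measurable_off_axes.
  - exact: on_Omega_nneg.
apply: (ge0_integral_ae0 mN N0) => //.
- by apply/measurable_EFinP; apply: measurable_excess; exact: measurable_vsum.
- by apply: emeasurable_sum => i //; apply/measurable_EFinP.
- by move=> s; rewrite lee_fin excess_ge0.
- by move=> s; rewrite sumEFin lee_fin sumr_ge0// => i _; exact: excess_ge0.
- move=> s /not_orP[/contrapT s0 sa].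
  by rewrite excess_axes// sumEFin.
Qed.

Lemma integral_excess_ge n l eta : on_Omega n -> (forall i, same_jumps n k i i0) ->
  (0 <= l <= eta)%R ->
  \sum_(i < d) \int[k]_s (excess l (tnth s i0))%:E + l%:E * n (two_above eta) <=
  \int[n]_s (excess l (vsum s))%:E.
Proof.
move=> n0 nk leta; have /andP[l0 _] := leta.
under eq_bigr => i _ do rewrite -(integral_excess_coord n0 (nk i) l0).
have me i : measurable_fun setT (fun s : vec => (excess l (tnth s i))%:E).
  by apply/measurable_EFinP; exact: measurable_excess.
have mt := measurable_two_above eta.
have mi : measurable_fun setT (fun s : vec => (\1_(two_above eta) s)%:E : \bar R).
  by apply/measurable_EFinP; exact: measurable_indic.
rewrite -ge0_integral_sum//; last first.
  by move=> i s _; rewrite lee_fin excess_ge0.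
rewrite -[X in l%:E * n X]setIT -integral_indic// -ge0_integralZl//.
rewrite -ge0_integralD//; last 4 first.
- by move=> s _; rewrite sumEFin lee_fin sumr_ge0// => i _; exact: excess_ge0.
- exact: emeasurable_sum.
- by move=> s _; rewrite mule_ge0// lee_fin.
- exact: measurable_funeM.
apply: (ge0_le_integral_ae0 (measurableC measurable_nnegv) (on_Omega_nneg n0)).
- by apply: emeasurable_funD; [exact: emeasurable_sum|exact: measurable_funeM].
- by apply/measurable_EFinP; apply: measurable_excess; exact: measurable_vsum.
- move=> s; apply: adde_ge0; last by rewrite mule_ge0// lee_fin.
  by rewrite sumEFin lee_fin sumr_ge0// => i _; exact: excess_ge0.
- by move=> s; rewrite lee_fin excess_ge0.
- move=> s /contrapT s0; rewrite sumEFin -EFinM -EFinD lee_fin.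
  exact: excess_superadd.
Qed.

Section Compare.
Variables n np : {measure set vec -> \bar R}.
Hypotheses (n0 : on_Omega n) (nk : forall i, same_jumps n k i i0).
Hypotheses (np0 : on_Omega np) (npk : forall i, same_jumps np k i i0)
  (npaxes : np off_axes = 0).
Variables g gp : coupling.
Hypotheses (gc : extended_coupling n k g) (gpc : extended_coupling np k gp).
Local Notation lev b := (level n vsum (V b)).
Hypothesis gsupp : forall b, (0 < b)%R -> (0 < V b)%R ->
  g [set p | (b < tnth p.2 i0 /\ vsum p.1 < lev b)%R \/
             (lev b < vsum p.1 /\ tnth p.2 i0 <= b)%R] = 0.

Let lev_gt0 b : (0 < V b)%R -> (0 < lev b)%R.
Proof.
move=> Vb; apply: level_gt0 => //.
- exact: measurable_vsum.
- exact: (vsum_level_fin k0 k2 n0 nk).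
- exact: (vsum_inf kinf n0 nk).
Qed.

(** The bound on the layer of [gp] is available at every level, so it can be taken at the level of
    [n], where it is an equality for [g]. What remains is the difference of the two integrals of the
    excess. *)
Lemma layer_compare b eta : (0 < b)%R -> (0 < V b)%R -> (lev b <= eta)%R ->
  layer i0 gp b + (lev b)%:E * n (two_above eta) <= layer i0 g b.
Proof.
move=> b0 Vb leveta; have l0 := ltW (lev_gt0 Vb).
apply: le_trans (layer_ge k0 k2 n0 gc b0 l0 (gsupp b0 Vb)).
apply: le_trans (leeD2r _ (layer_le k0 k2 np0 gpc b0 l0)) _.
rewrite addeAC leeD2r// integral_excess_axes//.
by apply: integral_excess_ge; rewrite ?l0.
Qed.

Lemma layer_compare_le b : (0 < b)%R -> layer i0 gp b <= layer i0 g b.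
Proof.
move=> b0; have [Vb|Vb] := ltP 0%R (V b).
  apply: le_trans (layer_compare b0 Vb (lexx _)).
  by rewrite leeDl// mule_ge0// lee_fin ltW// lev_gt0.
have Vb0 : V b = 0%R by apply/le_anti; rewrite Vb jump_tail_ge0.
by rewrite (layer_null k0 k2 gpc b0 Vb0) layer_ge0.
Qed.

Section Gap.
Variables (b0 delta : R).
Hypotheses (b0_gt0 : (0 < b0)%R) (delta_ge0 : (0 <= delta)%R).
Hypothesis gap : forall b, (b0 <= b <= 2 * b0)%R ->
  layer i0 gp b + delta%:E <= layer i0 g b.

(** With N^2 steps of height b0 / N the mesh tends to 0 while the range b0 N tends to infinity. *)
Definition step_height (N : nat) (x : R) : R :=
  (\sum_(j < N * N) b0 / N%:R * (j.+1%:R * (b0 / N%:R) < x)%R%:R)%R.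

Lemma step_height_ge0 N x : (0 <= step_height N x)%R.
Proof.
by apply: sumr_ge0 => j _; rewrite mulr_ge0// divr_ge0// ltW.
Qed.

Lemma step_height_le N x : (0 < N)%N -> (0 <= x)%R -> (step_height N x <= x)%R.
Proof.
move=> N0 x0; have h0 : (0 < b0 / N%:R)%R by rewrite divr_gt0// ltr0n.
have /andP[_ h] := layer_sum_bounds (N * N) h0 x0.
by apply: le_trans h _; rewrite ge_min lexx.
Qed.

Lemma step_height_cvg x : (0 <= x)%R -> (step_height N x @[N --> \oo] --> x)%R.
Proof.
move=> x0.
have cvg0 : ((b0 / N%:R : R)%R @[N --> \oo] --> (0 : R)%R)%R.
  apply/cvgrPdist_le => e e0; near=> N.
  have N0 : (0 < N%:R :> R)%R by rewrite ltr0n; near: N; exists 1%N.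
  rewrite sub0r normrN ger0_norm; last by rewrite divr_ge0 ?ltW.
  rewrite ler_pdivrMr// mulrC -ler_pdivrMr//.
  near: N; exists (Num.truncn (b0 / e)).+1 => // m /= mn.
  by apply/ltW; apply: lt_le_trans (truncnS_gt _) _; rewrite ler_nat.
have lo : ((x - b0 / N%:R : R)%R @[N --> \oo] --> x)%R.
  rewrite -[X in (_ --> X)%R]subr0; apply: cvgB => //; exact: cvg_cst.
apply: squeeze_cvgr lo (cvg_cst x).
near=> N.
have N0 : (0 < N)%N by near: N; exists 1%N.
rewrite step_height_le// andbT.
have h0 : (0 < b0 / N%:R)%R by rewrite divr_gt0// ltr0n.
have /andP[h _] := layer_sum_bounds (N * N) h0 x0.
apply: le_trans h; rewrite lerD2r le_min lexx/=.
apply: (@le_trans _ _ (b0 * N%:R)%R).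
  rewrite mulrC -ler_pdivrMr//; near: N; exists (Num.truncn (x / b0)).+1 => // m /= mn.
  by apply/ltW; apply: lt_le_trans (truncnS_gt _) _; rewrite ler_nat.
rewrite -natr1 natrM mulrDl mul1r.
have -> : (N%:R * N%:R * (b0 / N%:R) = b0 * N%:R :> R)%R.
  by field; rewrite pnatr_eq0 -lt0n.
by rewrite lerDl ltW.
Unshelve. all: by end_near. Qed.

Let mstep N : measurable_fun setT (step_height N).
Proof.
apply: measurable_sum => j; apply: measurable_funM => //.
rewrite (_ : (fun _ => _) = \1_(`]j.+1%:R * (b0 / N%:R), +oo[%classic)%R).
  exact: measurable_indic.
apply/funext => x; rewrite indicE; congr (_%:R)%R; congr nat_of_bool.
by apply/idP/idP => [h|/set_mem/=]; [apply/mem_set|]; rewrite /= in_itv/= andbT.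
Qed.

Let mvsum_pos : measurable_fun setT (@vsum_pos R d).
Proof. by apply: measurable_excess; exact: measurable_vsum. Qed.

Let mlayer b : measurable_fun setT
  (fun p : vec * vec => (vsum_pos p.1 * (b < tnth p.2 i0)%R%:R)%:E).
Proof.
apply/measurable_EFinP; apply: measurable_funM.
- exact: (measurableT_comp mvsum_pos).
- exact: (measurableT_comp (@measurable_coord_gt R d i0 b)).
Qed.

Lemma integral_step_height (h : coupling) N :
  \int[h]_p (vsum_pos p.1 * step_height N (tnth p.2 i0))%:E =
  \sum_(j < N * N) (b0 / N%:R)%:E * layer i0 h (j.+1%:R * (b0 / N%:R))%R.
Proof.
have h0 : (0 <= b0 / N%:R)%R by rewrite divr_ge0// ltW.
rewrite /layer.
under [RHS]eq_bigr => j _.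
  rewrite -ge0_integralZl//; last first.
    by move=> p _; rewrite lee_fin mulr_ge0// excess_ge0.
  over.
rewrite -ge0_integral_sum//.
- apply: eq_integral => p _; under [RHS]eq_bigr do rewrite -EFinM.
  rewrite sumEFin; congr EFin.
  by rewrite /step_height big_distrr/=; apply: eq_bigr => j _; ring.
- by move=> j; exact: measurable_funeM.
- move=> j p _; rewrite mule_ge0// lee_fin mulr_ge0// excess_ge0//.
Qed.

Lemma layer_sum_compare N : (1 < N)%N ->
  \int[gp]_p (vsum_pos p.1 * step_height N (tnth p.2 i0))%:E + (b0 * delta)%:E <=
  \int[g]_p (vsum_pos p.1 * step_height N (tnth p.2 i0))%:E.
Proof.
move=> N1; have N0 : (0 < N)%N by exact: ltnW.
have NR : (N%:R != 0 :> R)%R by rewrite pnatr_eq0 -lt0n.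
have h0 : (0 < b0 / N%:R)%R by rewrite divr_gt0// ltr0n.
rewrite !integral_step_height.
(* The thresholds (j + 1) b0 / N with N <= j < 2 N are N points of [b0, 2 b0], each contributing (b0
   / N) delta. From 1 < N follows 2 N <= N^2, so all of them occur in the sum. *)
pose e (j : nat) : R := if (N <= j < 2 * N)%N then delta else 0%R.
have -> : (b0 * delta)%:E = \sum_(j < N * N) (b0 / N%:R * e j)%:E.
  rewrite sumEFin; congr EFin.
  rewrite -(big_mkord xpredT (fun j => b0 / N%:R * e j)%R).
  rewrite (@big_cat_nat _ _ _ (2 * N))//= ?leq_mul// (@big_cat_nat _ _ _ N)//= ?leq_pmull//.
  rewrite [X in (X + _ + _)%R]big_nat_cond [X in (X + _ + _)%R]big1 => [|j]; last first.
    by rewrite andbT => /andP[_ jN]; rewrite /e leqNgt jN/= mulr0.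
  rewrite [X in (_ + X)%R]big_nat_cond [X in (_ + X)%R]big1 => [|j]; last first.
    by rewrite andbT => /andP[jN _]; rewrite /e ltnNge jN/= andbF mulr0.
  rewrite add0r addr0 big_nat_cond (eq_bigr (fun=> b0 / N%:R * delta)%R); last first.
    by move=> j; rewrite andbT => jN; rewrite /e jN.
  rewrite -big_nat_cond sumr_const_nat -mulr_natr.
  have -> : (2 * N - N = N)%N by rewrite mul2n -addnn addnK.
  by field.
rewrite -big_split/=; apply: lee_sum => j _.
rewrite (EFinM _ (e j)) -ge0_muleDr ?layer_ge0 ?lee_fin//; last first.
  by rewrite /e; case: ifP.
apply: lee_wpmul2l; first by rewrite lee_fin ltW.
have jb : (0 < j.+1%:R * (b0 / N%:R))%R by rewrite mulr_gt0// ltr0n.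
rewrite /e; case: ifPn => [/andP[Nj jN]|_]; last by rewrite adde0; exact: layer_compare_le.
apply: gap; apply/andP; split.
  rewrite mulrA ler_pdivlMr ?ltr0n// [leLHS]mulrC; apply: ler_wpM2r; first exact: ltW.
  by rewrite ler_nat; exact: leqW.
rewrite mulrA ler_pdivrMr ?ltr0n// [leRHS]mulrAC; apply: ler_wpM2r; first exact: ltW.
by rewrite -natrM ler_nat.
Qed.

(** The step heights stay below the true height, which bounds the side of [g] for each N; on the
    side of [gp] Fatou's lemma recovers the height in the limit. *)
Lemma correlation_compare :
  correlation i0 gp + (b0 * delta)%:E <= correlation i0 g.
Proof.
have mh : measurable_fun setT (@height R d i0).
  by apply: measurable_excess; exact: mcoord.
have mcor : measurable_fun setT (fun p : vec * vec => vsum_pos p.1 * height i0 p.2)%R.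
  apply: measurable_funM; first exact: (measurableT_comp mvsum_pos).
  exact: (measurableT_comp mh).
have mst N : measurable_fun setT (fun p : vec * vec =>
    vsum_pos p.1 * step_height N (tnth p.2 i0))%R.
  apply: measurable_funM; first exact: (measurableT_comp mvsum_pos).
  exact: (measurableT_comp (measurableT_comp (mstep N) (mcoord i0))).
have null (h : coupling) (m : {measure set vec -> \bar R}) :
    extended_coupling m k h -> h (~` Omega2 R d) = 0 by case.
have mO2 := measurableC (@measurable_Omega2 R d).
have upper N : (1 < N)%N -> \int[gp]_p (vsum_pos p.1 * step_height N (tnth p.2 i0))%:E
    <= correlation i0 g - (b0 * delta)%:E.
  move=> N1; rewrite leeBrDr//; apply: le_trans (layer_sum_compare N1) _.
  apply: (ge0_le_integral_ae0 mO2 (null _ _ gc)) => //.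
  - by apply/measurable_EFinP.
  - by apply/measurable_EFinP.
  - by move=> p; rewrite lee_fin mulr_ge0 ?excess_ge0 ?step_height_ge0.
  - by move=> p; rewrite lee_fin mulr_ge0 ?excess_ge0.
  - move=> p /contrapT[_ p2 _]; rewrite lee_fin ler_wpM2l ?excess_ge0// heightE//.
    by rewrite step_height_le// ltnW.
rewrite -leeBrDr//.
apply: (@fatou_bound _ _ _ gp (~` Omega2 R d)
  (fun N p => vsum_pos p.1 * step_height N (tnth p.2 i0))%R _ _ 2 mO2 (null _ _ gpc)).
- exact: mst.
- exact: mcor.
- by move=> N p; rewrite mulr_ge0 ?excess_ge0 ?step_height_ge0.
- by move=> p; rewrite mulr_ge0 ?excess_ge0.
- move=> p /contrapT[_ p2 _]; apply: cvgMr; rewrite heightE//; exact: step_height_cvg.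
- exact: upper.
Qed.

End Gap.
End Compare.
End Correlation.

(** * Extended Wasserstein distance to the comonotone intensity *)

Section Cost.
Context {R : realType} {d : nat}.
Local Notation vec := (d.-tuple R).
Local Notation coupling := {measure set (vec * vec)%type -> \bar R}.
Implicit Types (n k : {measure set vec -> \bar R}) (g : coupling).

Definition cost g : \bar R := \int[g]_(p in Omega2 R d) (sqdistv p.1 p.2)%:E.

Definition sq_wasserstein n k : \bar R :=
  ereal_inf [set cost g | g in extended_coupling n k].

Lemma sqdistv_ge0 (s t : vec) : (0 <= sqdistv s t)%R.
Proof. by apply: sumr_ge0 => i _; rewrite sqr_ge0. Qed.

Lemma sqnormv_ge0 (s : vec) : (0 <= sqnormv s)%R.
Proof. by apply: sumr_ge0 => i _; rewrite sqr_ge0. Qed.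

Lemma measurable_sqdistv : measurable_fun setT (fun p : vec * vec => sqdistv p.1 p.2).
Proof.
apply: measurable_sum => i; apply: measurable_funX; apply: measurable_funB.
- exact: (measurableT_comp (measurable_coord i)).
- exact: (measurableT_comp (measurable_coord i)).
Qed.

Lemma cost_ge0 g : 0 <= cost g.
Proof. by apply: integral_ge0 => p _; rewrite lee_fin sqdistv_ge0. Qed.

Lemma sq_wasserstein_ge0 n k : 0 <= sq_wasserstein n k.
Proof. by apply: le_ereal_inf_tmp => _ [g _ <-]; exact: cost_ge0. Qed.

Lemma costE n k g : extended_coupling n k g ->
  cost g = \int[g]_p (sqdistv p.1 p.2)%:E.
Proof.
move=> [g0 _ _ _]; apply: (integral_Omega2 (h := fun p => (sqdistv p.1 p.2)%:E)) => //.
- by apply/measurable_EFinP; exact: measurable_sqdistv.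
- by move=> p; rewrite lee_fin sqdistv_ge0.
Qed.

(** The image of [k] under s |-> (s, s) is a coupling of zero cost. *)
Lemma sq_wasserstein_self n k : on_Omega k -> \int[k]_s (sqnormv s)%:E < +oo ->
  (forall B, measurable B -> n B = k B) -> sq_wasserstein n k = 0.
Proof.
move=> k0 kfin nk; apply/eqP; rewrite eq_le sq_wasserstein_ge0 andbT.
have mdup : measurable_fun setT (fun s : vec => (s, s)) by exact: measurable_fun_pair.
pose g : coupling := image_measure k mdup.
have gO : g (~` Omega2 R d) = 0.
  have mO2 : measurable ((fun s : vec => (s, s)) @^-1` (~` Omega2 R d)).
    rewrite -[X in measurable X]setTI.
    exact: (mdup measurableT _ (measurableC (@measurable_Omega2 R d))).
  apply: (subset_measure0 mO2 (measurableC (@measurable_Omega R d)) _ k0).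
  by move=> s h [s0 [i si]]; apply: h; split => //; left; exists i.
apply: ereal_inf_lbound; exists g.
  split => //.
  - rewrite (integral_Omega2 (h := fun p => (sqnormv p.1 + sqnormv p.2)%:E))//; last 2 first.
    + apply/measurable_EFinP; apply: measurable_funD.
      * exact: (measurableT_comp (@measurable_sqnormv R d)).
      * exact: (measurableT_comp (@measurable_sqnormv R d)).
    + by move=> p; rewrite lee_fin addr_ge0// sqnormv_ge0.
    rewrite integral_image_measure//; last 2 first.
    + apply/measurable_EFinP; apply: measurable_funD.
      * exact: (measurableT_comp (@measurable_sqnormv R d)).
      * exact: (measurableT_comp (@measurable_sqnormv R d)).
    + by move=> p; rewrite lee_fin addr_ge0// sqnormv_ge0.
    under eq_integral do rewrite /= EFinD.
    have mn : measurable_fun setT (fun s : vec => (sqnormv s)%:E).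
      by apply/measurable_EFinP; exact: measurable_sqnormv.
    rewrite ge0_integralD//.
    + by rewrite lte_add_pinfty.
    + by move=> s _; rewrite lee_fin sqnormv_ge0.
    + by move=> s _; rewrite lee_fin sqnormv_ge0.
  - by move=> B mB BO; rewrite nk.
rewrite /cost (integral_Omega2 (h := fun p => (sqdistv p.1 p.2)%:E))//; last 2 first.
- by apply/measurable_EFinP; exact: measurable_sqdistv.
- by move=> p; rewrite lee_fin sqdistv_ge0.
rewrite integral_image_measure//; last 2 first.
- by apply/measurable_EFinP; exact: measurable_sqdistv.
- by move=> p; rewrite lee_fin sqdistv_ge0.
apply: integral0_eq => s _; congr EFin; rewrite /sqdistv big1// => i _.
by rewrite subrr expr0n.
Qed.

(** Multiplying a coupling by c gives a coupling of the scaled measures with c times the cost, and c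
    <= 1. The case c = 0 is included. *)
Lemma sq_wasserstein_scale (c : {nonneg R}) n k n' k' : (c%:num <= 1)%R ->
  (forall B, measurable B -> n' B = c%:num%:E * n B) ->
  (forall B, measurable B -> k' B = c%:num%:E * k B) ->
  sq_wasserstein n' k' <= sq_wasserstein n k.
Proof.
move=> c1 n'E k'E; apply: le_ereal_inf_tmp => _ [g [gO gfin gf gs] <-].
have mO2 := @measurable_Omega2 R d.
have scale_le x : 0 <= x -> c%:num%:E * x <= x.
  by move=> x0; rewrite -[leRHS]mul1e lee_wpmul2r.
pose h : coupling := mscale c g.
have hg (f : vec * vec -> \bar R) : measurable_fun setT f -> (forall p, 0 <= f p) ->
    \int[h]_(p in Omega2 R d) f p = c%:num%:E * \int[g]_(p in Omega2 R d) f p.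
  by move=> mf f0; rewrite ge0_integral_mscale//; exact: measurable_funTS.
have msq : measurable_fun setT (fun p : vec * vec => (sqnormv p.1 + sqnormv p.2)%:E).
  apply/measurable_EFinP; apply: measurable_funD.
  - exact: (measurableT_comp (@measurable_sqnormv R d)).
  - exact: (measurableT_comp (@measurable_sqnormv R d)).
apply: (@le_trans _ _ (cost h)).
  apply: ereal_inf_lbound; exists h => //; split.
  - by transitivity (c%:num%:E * g (~` Omega2 R d)) => //; rewrite gO mule0.
  - rewrite hg//; last by move=> p; rewrite lee_fin addr_ge0// sqnormv_ge0.
    apply: le_lt_trans gfin; apply: scale_le; apply: integral_ge0 => p _.
    by rewrite lee_fin addr_ge0// sqnormv_ge0.
  - by move=> B mB BO; rewrite n'E// -gf.
  - by move=> B mB BO; rewrite k'E// -gs.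
rewrite /cost hg//; last 2 first.
- by apply/measurable_EFinP; exact: measurable_sqdistv.
- by move=> p; rewrite lee_fin sqdistv_ge0.
by apply: scale_le; exact: cost_ge0.
Qed.

End Cost.

Section Optimality.
Context {R : realType} {d : nat} (i0 : 'I_d).
Local Notation vec := (d.-tuple R).
Local Notation coupling := {measure set (vec * vec)%type -> \bar R}.
Variable k : {measure set vec -> \bar R}.
Hypotheses (k0 : on_Omega k)
  (kdiag : forall i j, k [set s | tnth s i != tnth s j] = 0)
  (kinf : k [set s | (0 < tnth s i0)%R] = +oo)
  (k2 : \int[k]_s ((tnth s i0) ^+ 2)%:E < +oo).
Local Notation V := (jump_tail i0 k).
Local Notation second_moment := (\sum_(i < d) \int[k]_s ((tnth s i0) ^+ 2)%:E).

Let kk i : same_jumps k k i i0. Proof. exact: same_jumps_diag. Qed.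

Let mnorm : measurable_fun setT (fun s : vec => (sqnormv s)%:E).
Proof. by apply/measurable_EFinP; exact: measurable_sqnormv. Qed.

Let msqnorm2 : measurable_fun setT (fun p : vec * vec => (sqnormv p.1 + sqnormv p.2)%:E).
Proof.
apply/measurable_EFinP; apply: measurable_funD.
- exact: (measurableT_comp (@measurable_sqnormv R d)).
- exact: (measurableT_comp (@measurable_sqnormv R d)).
Qed.

Lemma second_moment_fin : second_moment < +oo.
Proof. exact: lte_sum_pinfty. Qed.

Lemma sqnorm_coupling n (g : coupling) : on_Omega n -> (forall i, same_jumps n k i i0) ->
  g (~` Omega2 R d) = 0 ->
  (forall B, measurable B -> B `<=` Omega R d -> pushforward g fst B = n B) ->
  (forall B, measurable B -> B `<=` Omega R d -> pushforward g snd B = k B) ->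
  \int[g]_p (sqnormv p.1 + sqnormv p.2)%:E = second_moment + second_moment.
Proof.
move=> n0 nk gO gf gs.
have z (s : vec) : nnegv s -> ~ Omega R d s -> (sqnormv s)%:E = 0 :> \bar R.
  move=> s0 /(notOmega s0) h; congr EFin; rewrite /sqnormv big1// => i _.
  by rewrite h expr0n.
under [LHS]eq_integral do rewrite EFinD.
rewrite ge0_integralD//; last 4 first.
- by move=> p _; rewrite lee_fin sqnormv_ge0.
- exact: (measurableT_comp mnorm).
- by move=> p _; rewrite lee_fin sqnormv_ge0.
- exact: (measurableT_comp mnorm).
rewrite (integral_fst_coupling (f := fun s => (sqnormv s)%:E) n0 gO gf)//; last first.
  by move=> s; rewrite lee_fin sqnormv_ge0.
rewrite (integral_snd_coupling (f := fun s => (sqnormv s)%:E) k0 gO gs)//; last first.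
  by move=> s; rewrite lee_fin sqnormv_ge0.
by rewrite (sqnorm_jumps k0 n0 nk) (sqnorm_jumps k0 k0 kk).
Qed.

Lemma comonotone_extended_coupling n : on_Omega n -> (forall i, same_jumps n k i i0) ->
  exists2 g : coupling, extended_coupling n k g &
  forall b, (0 < b)%R -> (0 < V b)%R ->
  g [set p | (b < tnth p.2 i0 /\ vsum p.1 < level n vsum (V b))%R \/
             (level n vsum (V b) < vsum p.1 /\ tnth p.2 i0 <= b)%R] = 0.
Proof.
move=> n0 nk; exists (comonotone_coupling k0 kinf k2 n0 nk); last first.
  exact: comonotone_support.
have gO := comonotone_on_Omega2 k0 kinf k2 n0 nk.
have gf B : measurable B -> B `<=` Omega R d ->
    pushforward (comonotone_coupling k0 kinf k2 n0 nk) fst B = n B.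
  by move=> mB _; exact: comonotone_fst.
have gs B : measurable B -> B `<=` Omega R d ->
    pushforward (comonotone_coupling k0 kinf k2 n0 nk) snd B = k B.
  by move=> mB BO; exact: comonotone_snd.
split => //.
rewrite (integral_Omega2 (h := fun p => (sqnormv p.1 + sqnormv p.2)%:E))//; last first.
  by move=> p; rewrite lee_fin addr_ge0// sqnormv_ge0.
by rewrite (sqnorm_coupling n0 nk gO gf gs) lte_add_pinfty ?second_moment_fin.
Qed.

Section CostCorrelation.
Variables (n : {measure set vec -> \bar R}) (g : coupling).
Hypotheses (n0 : on_Omega n) (nk : forall i, same_jumps n k i i0)
  (gc : extended_coupling n k g).

(* The second marginal is carried by the diagonal, where
   [sqdistv s t + 2 * vsum s * height t = sqnormv s + sqnormv t]. *)
Let off_diag : set vec := Omega R d `&` [set s | exists i, tnth s i != tnth s i0].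

Let m_off_diag : measurable off_diag.
Proof.
apply: measurableI; first exact: measurable_Omega.
exact (measurable_exists (fun i => measurable_coord_neq i i0)).
Qed.

Let exceptional : set (vec * vec) := ~` Omega2 R d `|` snd @^-1` off_diag.

Let m_exceptional : measurable exceptional.
Proof.
apply: measurableU; first exact: (measurableC (@measurable_Omega2 R d)).
by rewrite -[X in measurable X]setTI; exact: measurable_snd.
Qed.

Let exceptional0 : g exceptional = 0.
Proof.
case: gc => gO _ _ gs; rewrite null_set_setU//.
- exact: (measurableC (@measurable_Omega2 R d)).
- by rewrite -[X in measurable X]setTI; exact: measurable_snd.
- have := gs _ m_off_diag (@subIsetl _ _ _); rewrite /pushforward => ->.
  rewrite measure_conegligible_setI//.
  + by apply: measure_exists_null => i; [exact: measurable_coord_neq|exact: kdiag].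
  + exact: measurable_Omega.
  + exact (measurable_exists (fun i => measurable_coord_neq i i0)).
Qed.

Lemma coupling_snd_diag p : ~ exceptional p ->
  [/\ nnegv p.1, nnegv p.2 & forall i, tnth p.2 i = tnth p.2 i0].
Proof.
move=> /not_orP[/contrapT[p1 p2 _] pd]; split => // i.
apply/eqP/negPn/negP => h; apply: pd.
have [pO|nO] := pselect (Omega R d p.2).
  by split => //; exists i.
by move: h; rewrite !(notOmega p2 nO) eqxx.
Qed.

(** Stated additively, since the finiteness of both terms is deduced from this identity
    afterwards. *)
Lemma cost_correlation :
  cost g + 2%:E * correlation i0 g = second_moment + second_moment.
Proof.
have mc : measurable_fun setT (fun p : vec * vec => vsum_pos p.1 * height i0 p.2)%R.
  apply: measurable_funM.
  - apply: (measurableT_comp (f := vsum_pos)) => //.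
    by apply: measurable_excess; exact: measurable_vsum.
  - apply: (measurableT_comp (f := height i0)) => //.
    by apply: measurable_excess; exact: (measurable_coord i0).
have c0 (p : vec * vec) : (0 <= vsum_pos p.1 * height i0 p.2)%R.
  by rewrite mulr_ge0 ?excess_ge0.
have md : measurable_fun setT (fun p : vec * vec => (sqdistv p.1 p.2)%:E).
  by apply/measurable_EFinP; exact: measurable_sqdistv.
have mce : measurable_fun setT (fun p : vec * vec => (vsum_pos p.1 * height i0 p.2)%:E).
  by apply/measurable_EFinP.
rewrite (costE gc) /correlation -ge0_integralZl//; last first.
  by move=> p _; rewrite lee_fin.
rewrite -ge0_integralD//; last 3 first.
- by move=> p _; rewrite lee_fin sqdistv_ge0.
- by move=> p _; rewrite mule_ge0// lee_fin.
- exact: measurable_funeM.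
case: (gc) => gO _ gf gs; rewrite -(sqnorm_coupling n0 nk gO gf gs).
apply: (ge0_integral_ae0 m_exceptional exceptional0) => //.
- by apply: emeasurable_funD => //; exact: measurable_funeM.
- by move=> p; rewrite adde_ge0 ?mule_ge0 ?lee_fin ?sqdistv_ge0.
- by move=> p; rewrite lee_fin addr_ge0 ?sqnormv_ge0.
move=> p /coupling_snd_diag[p1 p2 pd].
rewrite -EFinM -EFinD; congr EFin; rewrite vsum_posE// heightE//.
rewrite /sqdistv /vsum /sqnormv mulr_suml mulr_sumr -!big_split/=.
by apply: eq_bigr => i _; rewrite pd; ring.
Qed.

Lemma cost_fin : cost g < +oo.
Proof.
apply: (@le_lt_trans _ _ (second_moment + second_moment)).
  by rewrite -cost_correlation leeDl// mule_ge0// integral_ge0// => p _;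
    rewrite lee_fin mulr_ge0 ?excess_ge0.
by rewrite lte_add_pinfty ?second_moment_fin.
Qed.

Lemma correlation_fin_num : correlation i0 g \is a fin_num.
Proof.
have c0 : 0 <= correlation i0 g.
  by apply: integral_ge0 => p _; rewrite lee_fin mulr_ge0 ?excess_ge0.
rewrite ge0_fin_numE//; apply: (@le_lt_trans _ _ (second_moment + second_moment)).
  rewrite -cost_correlation; apply: le_trans (leeDr _ (cost_ge0 g)).
  by rewrite -[leLHS]mul1e lee_wpmul2r// lee_fin ler1n.
by rewrite lte_add_pinfty ?second_moment_fin.
Qed.

(** Both coordinates are compared with the common value c of the second vector: (a - b)^2 <= 2 (a -
    c)^2 + 2 (b - c)^2. The bound is the same for every coupling, so it survives the infimum. *)
Lemma le_cost_coord i j :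
  \int[n]_s ((tnth s i - tnth s j) ^+ 2)%:E <= 2%:E * cost g.
Proof.
have mij : measurable_fun setT (fun s : vec => ((tnth s i - tnth s j) ^+ 2)%:E).
  apply/measurable_EFinP; apply: measurable_funX; apply: measurable_funB.
  - exact: (measurable_coord i).
  - exact: (measurable_coord j).
case: (gc) => gO _ gf _.
have md : measurable_fun setT (fun p : vec * vec => (sqdistv p.1 p.2)%:E).
  by apply/measurable_EFinP; exact: measurable_sqdistv.
rewrite (costE gc) -ge0_integralZl//; last first.
  by move=> p _; rewrite lee_fin sqdistv_ge0.
rewrite -(integral_fst_coupling (f := fun s => ((tnth s i - tnth s j) ^+ 2)%:E) n0 gO gf)//;
  last 2 first.
- by move=> s; rewrite lee_fin sqr_ge0.
- by move=> s s0 /(notOmega s0) z; rewrite !z subrr expr0n.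
apply: (ge0_le_integral_ae0 m_exceptional exceptional0).
- exact: (measurableT_comp mij).
- exact: measurable_funeM.
- by move=> p; rewrite lee_fin sqr_ge0.
- by move=> p; rewrite mule_ge0// lee_fin sqdistv_ge0.
move=> p /coupling_snd_diag[_ _ pd]; rewrite -EFinM lee_fin.
have [->|ij] := eqVneq i j.
  by rewrite subrr expr0n/= mulr_ge0// sqdistv_ge0.
rewrite /sqdistv (bigD1 i)//= (bigD1 j)//=; last by rewrite eq_sym.
set r := (\sum_(_ < _ | _) _)%R; have r0 : (0 <= r)%R.
  by apply: sumr_ge0 => l _; rewrite sqr_ge0.
rewrite (pd i) (pd j); move: (tnth p.1 i) (tnth p.1 j) (tnth p.2 i0) => a b c.
(* This square is exactly 2 (a - c)^2 + 2 (b - c)^2 - (a - b)^2. *)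
have : (0 <= (a + b - 2 * c) ^+ 2)%R by rewrite sqr_ge0.
by move=> h; nra.
Qed.

End CostCorrelation.

Lemma sq_wasserstein_fin n : on_Omega n -> (forall i, same_jumps n k i i0) ->
  sq_wasserstein n k < +oo.
Proof.
move=> n0 nk; have [g gc _] := comonotone_extended_coupling n0 nk.
apply: le_lt_trans (cost_fin n0 nk gc).
by apply: ereal_inf_lbound; exists g.
Qed.

Lemma sq_wasserstein_eq0 n : on_Omega n -> sq_wasserstein n k = 0 ->
  forall i j, n [set s | tnth s i != tnth s j] = 0.
Proof.
move=> n0 W0 i j.
have mij : measurable_fun setT (fun s : vec => ((tnth s i - tnth s j) ^+ 2)%:E).
  apply/measurable_EFinP; apply: measurable_funX; apply: measurable_funB.
  - exact: (measurable_coord i).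
  - exact: (measurable_coord j).
apply: (ge0_integral_eq0 (f := fun s : vec => ((tnth s i - tnth s j) ^+ 2)%:E)) => //.
- by move=> s; rewrite lee_fin sqr_ge0.
- apply/eqP; rewrite eq_le; apply/andP; split; last first.
    by apply: integral_ge0 => s _; rewrite lee_fin sqr_ge0.
  suff : 2^-1%:E * \int[n]_s ((tnth s i - tnth s j) ^+ 2)%:E <= sq_wasserstein n k.
    by rewrite W0 pmule_rle0// lte_fin invr_gt0.
  apply: le_ereal_inf_tmp => _ [g gc <-].
  by rewrite lee_pdivrMl// le_cost_coord.
- exact: measurable_coord_neq.
- by move=> s /= sij; rewrite eqe sqrf_eq0 subr_eq0.
Qed.

Section Extremal.
Variables n np : {measure set vec -> \bar R}.
Hypotheses (n0 : on_Omega n) (nk : forall i, same_jumps n k i i0).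
Hypotheses (np0 : on_Omega np) (npk : forall i, same_jumps np k i i0)
  (npaxes : np off_axes = 0).

Lemma cost_gap (c : R) (g gp : coupling) : extended_coupling n k g -> extended_coupling np k gp ->
  correlation i0 gp + c%:E <= correlation i0 g -> cost g + (2 * c)%:E <= cost gp.
Proof.
move=> gc gpc h.
have := cost_correlation np0 npk gpc; rewrite -(cost_correlation n0 nk gc).
have f1 := correlation_fin_num n0 nk gc; have f2 := correlation_fin_num np0 npk gpc.
have f3 : cost g \is a fin_num by rewrite ge0_fin_numE ?cost_ge0// (cost_fin n0 nk gc).
have f4 : cost gp \is a fin_num by rewrite ge0_fin_numE ?cost_ge0// (cost_fin np0 npk gpc).
move: h; rewrite -(fineK f1) -(fineK f2) -(fineK f3) -(fineK f4).
rewrite -!EFinM -!EFinD !lee_fin => h [] e; lra.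
Qed.

Lemma sq_wasserstein_le_axes : sq_wasserstein n k <= sq_wasserstein np k.
Proof.
have [g gc gsupp] := comonotone_extended_coupling n0 nk.
apply: le_ereal_inf_tmp => _ [gp gpc <-].
apply: (@le_trans _ _ (cost g)); first by apply: ereal_inf_lbound; exists g.
(* No gap is asked for here: [delta] is 0, and 1 is an arbitrary positive choice of [b0]. *)
have := correlation_compare k0 kinf k2 n0 nk np0 npk npaxes gc gpc gsupp
  (b0 := 1) (delta := 0) ltr01 (lexx _).
rewrite mulr0 adde0 => h; have {h} : correlation i0 gp + 0%:E <= correlation i0 g.
  rewrite adde0; apply: h => b /andP[b1 _]; rewrite adde0.
  apply: (layer_compare_le k0 kinf k2 n0 nk np0 npk npaxes gc gpc gsupp).
  exact: lt_le_trans b1.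
by move=> /(cost_gap gc gpc); rewrite mulr0 adde0.
Qed.

(** Mass off the axes yields mass e of vectors with two coordinates above some eta > 0, and each
    layer whose level is at most eta then gains its level times e. For small thresholds b the levels
    do fall below eta, which gives a positive gap common to all couplings of [np] with [k]. *)
Lemma sq_wasserstein_lt_axes : n off_axes != 0 -> sq_wasserstein n k < sq_wasserstein np k.
Proof.
move=> noff.
have [eta eta0 neta] : exists2 eta, (0 < eta)%R & n (two_above eta) != 0.
  apply: contrapT => h; move/eqP : noff; apply.
  have mE j : measurable (two_above (j.+1%:R^-1) : set vec) by exact: measurable_two_above.
  rewrite -(measure_conegligible_setI measurable_nnegv measurable_off_axes (on_Omega_nneg n0)).
  apply: (@subset_measure0 _ _ _ n _ (\bigcup_j (two_above (j.+1%:R^-1) : set vec))).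
  - by apply: measurableI; [exact: measurable_nnegv|exact: measurable_off_axes].
  - exact: bigcupT_measurable.
  - move=> s [s0 [i [j [ij si sj]]]].
    have {}si : (0 < tnth s i)%R by rewrite lt0r si s0.
    have {}sj : (0 < tnth s j)%R by rewrite lt0r sj s0.
    pose m := Num.min (tnth s i) (tnth s j).
    have m0 : (0 < m)%R by rewrite lt_min si sj.
    have : ((Num.truncn m^-1).+1%:R^-1 < m)%R.
      by rewrite invf_plt ?posrE ?ltr0n// truncnS_gt.
    by rewrite lt_min => /andP[mi mj]; exists (Num.truncn m^-1) => //; exists i, j.
  - apply: measure_negligible; first exact: bigcupT_measurable.
    apply: negligible_bigcup => j; apply/negligibleP => //.
    apply/eqP/negPn/negP => nj; apply: h.
    by exists (j.+1%:R^-1)%R; rewrite ?invr_gt0 ?ltr0n.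
have nfin : n (two_above eta) \is a fin_num.
  rewrite ge0_fin_numE//; apply: le_lt_trans (vsum_level_fin k0 k2 n0 nk eta0).
  rewrite -(measure_conegligible_setI measurable_nnegv (measurable_two_above eta)
    (on_Omega_nneg n0)).
  apply: le_measure; rewrite ?inE.
  - by apply: measurableI; [exact: measurable_nnegv|exact: measurable_two_above].
  - exact: (measurable_ge_level measurable_vsum).
  - by move=> s [s0 [i [j [_ si _]]]] /=; rewrite (le_trans (ltW si))// le_vsum.
pose e := fine (n (two_above eta)).
have e0 : (0 < e)%R by rewrite fine_gt0// lt0e neta measure_ge0 -ge0_fin_numE.
have vfin := vsum_level_fin k0 k2 n0 nk; have cfin := @coord_level_fin _ _ i0 k k2.
have vinf := vsum_inf kinf n0 nk.
(* Infinite activity provides r with V(r) above the mass of {sigma > eta}; then every b <= r has its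
   level at most eta. The interval [b0, 2 b0] is [r / 2, r]. *)
have [r r0 Vr] := tail_large (measurable_coord i0) cfin kinf (tail n vsum eta).
pose b0 := (r / 2)%R; have b0_gt0 : (0 < b0)%R by rewrite divr_gt0.
pose lev b := level n vsum (V b).
have V_gt b : (0 < b)%R -> (b <= r)%R -> (tail n vsum eta < V b)%R.
  by move=> bp br; apply: lt_le_trans Vr _; exact: (jump_tail_nincr k2).
have V_gt0 b : (0 < b)%R -> (b <= r)%R -> (0 < V b)%R.
  by move=> bp br; apply: le_lt_trans (V_gt b bp br); exact: tail_ge0.
have lev0 : (0 < lev b0)%R.
  by apply: (level_gt0 measurable_vsum vfin vinf); apply: V_gt0 => //; rewrite /b0; lra.
have [g gc gsupp] := comonotone_extended_coupling n0 nk.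
(* Levels are nondecreasing in b because [V] is nonincreasing, so the level at b0 is the smallest
   one on the interval. *)
pose delta := (lev b0 * e)%R.
have delta0 : (0 < delta)%R by rewrite mulr_gt0.
have key gp : extended_coupling np k gp -> cost g + (2 * (b0 * delta))%:E <= cost gp.
  move=> gpc; apply: (cost_gap gc gpc).
  apply: (correlation_compare k0 kinf k2 n0 nk np0 npk npaxes gc gpc gsupp b0_gt0 (ltW delta0)).
  move=> b /andP[b0b b2b].
  have bp : (0 < b)%R by exact: lt_le_trans b0b.
  have br : (b <= r)%R by move: b2b; rewrite /b0; lra.
  have Vb := V_gt0 b bp br.
  have lb : (lev b <= eta)%R by apply: (level_le measurable_vsum vfin) => //; exact: V_gt.
  apply: le_trans (layer_compare k0 kinf k2 n0 nk np0 npk npaxes gc gpc gsupp bp Vb lb).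
  rewrite leeD2l// -(fineK nfin) -EFinM lee_fin ler_wpM2r ?fine_ge0//.
  apply: (level_nincr measurable_vsum vfin) => //.
  exact: (jump_tail_nincr k2).
have gfin : cost g \is a fin_num by rewrite ge0_fin_numE ?cost_ge0// (cost_fin n0 nk gc).
apply: (@le_lt_trans _ _ (cost g)); first by apply: ereal_inf_lbound; exists g.
apply: (@lt_le_trans _ _ (cost g + (2 * (b0 * delta))%:E)).
  by rewrite lteDl// lte_fin !mulr_gt0.
by apply: le_ereal_inf_tmp => _ [gp gpc <-]; exact: key.
Qed.

End Extremal.

(** At distance zero [np] would be carried by both the diagonal and the axes, hence would not charge
    positive values of coordinate [i0], whose mass is infinite. Two distinct coordinates are
    essential. *)
Lemma sq_wasserstein_axes_gt0 np (j0 : 'I_d) : j0 != i0 -> on_Omega np ->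
  (forall i, same_jumps np k i i0) -> np off_axes = 0 -> 0 < sq_wasserstein np k.
Proof.
move=> ji np0 npk npaxes; rewrite lt0e sq_wasserstein_ge0 andbT.
apply/eqP => W0; have ndiag := sq_wasserstein_eq0 np0 W0 j0 i0.
have := jumps_gtE npk i0 (lexx 0%R); rewrite kinf => npinf.
suff : np [set s : vec | (0 < tnth s i0)%R] = 0 by rewrite npinf.
have mo := @measurable_off_axes R d.
have md := @measurable_coord_neq R d j0 i0.
have ms : measurable [set s : vec | (0 < tnth s i0)%R].
  exact: (measurable_gt_level (measurable_coord i0)).
have sub : [set s : vec | (0 < tnth s i0)%R] `<=`
    off_axes `|` [set s : vec | tnth s j0 != tnth s i0].
  move=> s /= s0; have [e|ne] := eqVneq (tnth s j0) (tnth s i0); last by right.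
  by left; exists j0, i0; split => //; rewrite ?e gt_eqF.
have null : np (off_axes `|` [set s : vec | tnth s j0 != tnth s i0]) = 0.
  by rewrite null_set_setU.
exact: (subset_measure0 ms (measurableU _ _ mo md) sub null).
Qed.

End Optimality.

(** * Laplace exponents of completely random vectors *)

Section SigmaAlgebra.
Context {T : Type} (G : set (set T)).
Hypothesis sG : sigma_algebra setT G.

Lemma sigma_algebra_forall n (P : 'I_n -> set T) :
  (forall i, G (P i)) -> G [set x | forall i, P i x].
Proof.
case: sG => G0 GC GU GP.
pose Q k := if insub k is Some i then ~` P i else set0.
have -> : [set x | forall i, P i x] = setT `\` \bigcup_k Q k.
  apply/seteqP; split => x /=.
    move=> Px; split => // -[k _]; rewrite /Q; case: insubP => // i _ _; exact.
  move=> [_ nQ] i; apply: contrapT => nP; apply: nQ; exists (val i) => //.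
  by rewrite /Q valK.
apply: (GC); apply: GU => k; rewrite /Q; case: insubP => // i _ _.
by rewrite -setTD; apply: GC.
Qed.

(** The events on vectors of measures form a bare system of sets, not a measurable type;
    coordinatewise measurability is therefore established for an abstract sigma-algebra. *)
Lemma sigma_algebra_tuple (R : realType) d (f : T -> d.-tuple R) :
  (forall i (B : set R), measurable B -> G ((fun x => tnth (f x) i) @^-1` B)) ->
  forall B, measurable B -> G (f @^-1` B).
Proof.
move=> Gf B mB; suff : image_set_system setT f G B.
  by rewrite /image_set_system/= setTI.
move: B mB; rewrite measurable_upper_orthants; apply: smallest_sub.
  exact: sigma_algebra_image.
move=> _ [a _ <-]; rewrite /image_set_system/= setTI.
apply: (sigma_algebra_forall (P := fun i => [set x | a i < tnth (f x) i]%R)) => i.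
have := Gf i _ (measurable_itv `]a i, +oo[); congr G.
by apply/seteqP; split => x /=; rewrite in_itv/= andbT.
Qed.

End SigmaAlgebra.

Section LaplaceExponent.
Context {R : realType} {X : completePseudoMetricType R} {d : nat}
  {dO : measure_display} {Om : measurableType dO}.
Variables (P : probability Om R) (mu : 'I_d -> R.-ftker Om ~> borel X).
Implicit Types (A : set (borel X)) (lam : d.-tuple R).

Lemma measurable_fine_kernel i A : measurable A ->
  measurable_fun setT (fun w => fine (mu i w A)).
Proof.
by move=> mA; apply: measurableT_comp => //; exact: (measurable_kernel (mu i)).
Qed.

Lemma measurable_evalv A : measurable A -> measurable_fun setT (evalv mu A).
Proof.
move=> mA; apply: measurable_tupleP => i.
under eq_fun do rewrite tnth_mktuple.
exact: measurable_fine_kernel.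
Qed.

Lemma evalv_ge0 A w : nnegv (evalv mu A w).
Proof. by move=> i; rewrite tnth_mktuple fine_ge0. Qed.

Lemma kernel_fin_num i w A : measurable A -> mu i w A \is a fin_num.
Proof. exact: kernel_finite_transition. Qed.

Lemma measurable_exp_evalv A lam : measurable A ->
  measurable_fun setT (fun w => expR (- dotv lam (evalv mu A w))).
Proof.
move=> mA; apply: (measurableT_comp (f := fun s => expR (- dotv lam s))).
  exact: measurable_exp_dotv.
exact: measurable_evalv.
Qed.

Definition laplace A lam : R :=
  fine (\int[P]_w (expR (- dotv lam (evalv mu A w)))%:E).

Lemma integral_laplace A lam : measurable A -> nnegv lam ->
  \int[P]_w (expR (- dotv lam (evalv mu A w)))%:E = (laplace A lam)%:E /\
  (0 < laplace A lam <= 1)%R.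
Proof.
move=> mA l0; have mf := measurable_exp_evalv lam mA.
have i0 : 0 <= \int[P]_w (expR (- dotv lam (evalv mu A w)))%:E.
  by apply: integral_ge0 => w _; rewrite lee_fin expR_ge0.
have i1 : \int[P]_w (expR (- dotv lam (evalv mu A w)))%:E <= 1.
  rewrite -(@probability_setT _ _ _ P) -[leRHS]mul1e -(integral_cst P measurableT 1).
  apply: ge0_le_integral => //; first exact/measurable_EFinP.
  by move=> w _; rewrite lee_fin expR_le1 oppr_le0 dotv_ge0//; exact: evalv_ge0.
have fin : \int[P]_w (expR (- dotv lam (evalv mu A w)))%:E \is a fin_num.
  by rewrite ge0_fin_numE//; apply: le_lt_trans i1 _; rewrite ltry.
rewrite /laplace fineK//; split => //.
rewrite -!lte_fin -lee_fin fineK// i1 andbT lt0e i0 andbT.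
apply/eqP => z; have : P setT = 0.
  apply: (ge0_integral_eq0 (E := setT) _ _ z) => //.
  - exact/measurable_EFinP.
  - by move=> w _; rewrite eqe gt_eqF ?expR_gt0.
by rewrite probability_setT => /eqP; rewrite onee_eq0.
Qed.

Definition exponent A lam : R := (- ln (laplace A lam))%R.

Lemma levy_exponentE A lam nu : measurable A -> nnegv lam ->
  is_levy_intensity P mu A nu ->
  \int[nu]_(s in Omega R d) (1 - expR (- dotv lam s))%:E = (exponent A lam)%:E.
Proof.
move=> mA l0 [_ /(_ _ l0) <-]; have [e /andP[h _]] := integral_laplace mA l0.
by rewrite unlock e lne_EFin.
Qed.

Lemma levy_intensityP A : driftless P mu -> measurable A ->
  is_levy_intensity P mu A (levy_intensity P mu A).
Proof.
move=> dr mA; rewrite /levy_intensity; case: pselect => [h|]; last by move/(_ (dr _ mA)).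
by case: cid.
Qed.

End LaplaceExponent.

Lemma measure_vector_events_eval (R : realType) (X : completePseudoMetricType R) d
    (A : set (borel X)) (B : set (d.-tuple R)) : measurable A -> measurable B ->
  @measure_vector_events R X d [set m : 'I_d -> {measure set (borel X) -> \bar R} |
    B [tuple fine (m i A) | i < d]].
Proof.
move=> mA mB; apply: (sigma_algebra_tuple (@smallest_sigma_algebra _ setT _)) mB.
move=> i C mC; apply: sub_sigma_algebra; exists i.
exists [set m : {measure set (borel X) -> \bar R} | (fine @^-1` C) (m A)].
  apply: sub_sigma_algebra; exists A, (fine @^-1` C); split => //.
  by rewrite -[X in measurable X]setTI; apply: fine_measurable.
by apply/seteqP; split => m /=; rewrite tnth_mktuple.
Qed.

Section EqExponent.
Context {R : realType} {X : completePseudoMetricType R} {d : nat}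
  {dO1 : measure_display} {Om1 : measurableType dO1}
  {dO2 : measure_display} {Om2 : measurableType dO2}.
Variables (P1 : probability Om1 R) (mu1 : 'I_d -> R.-ftker Om1 ~> borel X).
Variables (P2 : probability Om2 R) (mu2 : 'I_d -> R.-ftker Om2 ~> borel X).

Lemma levy_eq A1 A2 n1 n2 : measurable A1 -> measurable A2 ->
  is_levy_intensity P1 mu1 A1 n1 -> is_levy_intensity P2 mu2 A2 n2 ->
  (forall lam, nnegv lam -> exponent P1 mu1 A1 lam = exponent P2 mu2 A2 lam) ->
  forall B, measurable B -> n1 B = n2 B.
Proof.
move=> mA1 mA2 h1 h2 e; apply: eq_levy_measure.
- by case: h1.
- by case: h2.
- by move=> lam l0; rewrite (levy_exponentE mA1 l0 h1) ltry.
- by move=> lam l0; rewrite (levy_exponentE mA1 l0 h1) (levy_exponentE mA2 l0 h2) e.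
Qed.

Lemma laplace_exponent A lam : measurable A -> nnegv lam ->
  exponent P1 mu1 A lam = exponent P2 mu2 A lam ->
  laplace P1 mu1 A lam = laplace P2 mu2 A lam.
Proof.
move=> mA l0 /oppr_inj; have [_ /andP[h1 _]] := integral_laplace P1 mu1 mA l0.
have [_ /andP[h2 _]] := integral_laplace P2 mu2 mA l0.
by apply: ln_inj; rewrite posrE.
Qed.

Lemma eq_law_coord i j A (f : R -> \bar R) : measurable A ->
  eq_in_law (measure_events (X := X)) P1 (random_measure mu1 i) P2 (random_measure mu2 j) ->
  measurable_fun setT f -> (forall x, 0 <= f x) ->
  \int[P1]_w f (fine (mu1 i w A)) = \int[P2]_w f (fine (mu2 j w A)).
Proof.
move=> mA law mf f0.
apply: (@eq_law_integral _ _ _ _ _ _ _ P1 P2 (fun w => fine (mu1 i w A))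
  (fun w => fine (mu2 j w A)) setT) => //.
- exact: measurable_fine_kernel.
- exact: measurable_fine_kernel.
- move=> B mB _; apply: (law [set m | (fine @^-1` B) (m A)]).
  apply: sub_sigma_algebra; exists A, (fine @^-1` B); split => //.
  by rewrite -[X in measurable X]setTI; apply: fine_measurable.
- by move=> y; case.
Qed.

Lemma eq_law_laplace i j A a : measurable A -> (0 <= a)%R ->
  eq_in_law (measure_events (X := X)) P1 (random_measure mu1 i) P2 (random_measure mu2 j) ->
  laplace P1 mu1 A (vunit i a) = laplace P2 mu2 A (vunit j a).
Proof.
move=> mA a0 law; congr fine.
under eq_integral do rewrite dotv_unit tnth_mktuple.
under [RHS]eq_integral do rewrite dotv_unit tnth_mktuple.
apply: (eq_law_coord (f := fun x => (expR (- (a * x)))%:E)) => //.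
apply/measurable_EFinP; apply: measurableT_comp => //; apply: measurable_funN.
exact: measurable_funM.
Qed.

Lemma same_law_laplace A lam : measurable A -> nnegv lam ->
  same_law P1 mu1 P2 mu2 -> laplace P1 mu1 A lam = laplace P2 mu2 A lam.
Proof.
move=> mA l0 law; congr fine.
apply: (@eq_law_integral _ _ _ _ _ _ _ P1 P2 (evalv mu1 A) (evalv mu2 A) setT
  (fun s => (expR (- dotv lam s))%:E)) => //.
- exact: measurable_evalv.
- exact: measurable_evalv.
- move=> B mB _.
  apply: (law [set m : 'I_d -> {measure set (borel X) -> \bar R} |
    B [tuple fine (m i A) | i < d]]).
  exact: measure_vector_events_eval.
- by apply/measurable_EFinP; exact: measurable_exp_dotv.
- by move=> y; case.
Qed.

End EqExponent.

Lemma eadd_eq_self (R : realType) (x y : \bar R) : x \is a fin_num -> x + y = x -> y = 0.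
Proof. by move=> fx e; rewrite -[LHS](addeK _ fx) (addeC y) e subee. Qed.

(** * Diagonal, axes and marginals read off the Levy exponent *)

Section LevyExponent.
Context {R : realType} {d : nat}.
Local Notation vec := (d.-tuple R).
Implicit Types (n k : {measure set vec -> \bar R}) (lam s : vec).

Definition levy_exponent n lam : \bar R :=
  \int[n]_(s in Omega R d) (1 - expR (- dotv lam s))%:E.

Lemma levy_exponent_ge0 n lam : nnegv lam -> 0 <= levy_exponent n lam.
Proof. by move=> l0; apply: integral_ge0 => s [s0 _]; rewrite lee_fin one_sub_exp_ge0. Qed.

Lemma Omega_integralD n (f g : vec -> R) :
  measurable_fun setT f -> measurable_fun setT g ->
  (forall s, nnegv s -> (0 <= f s)%R) -> (forall s, nnegv s -> (0 <= g s)%R) ->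
  \int[n]_(s in Omega R d) (f s)%:E + \int[n]_(s in Omega R d) (g s)%:E =
  \int[n]_(s in Omega R d) (f s + g s)%:E.
Proof.
move=> mf mg f0 g0; have mO := @measurable_Omega R d.
rewrite -ge0_integralD//.
- by move=> s [s0 _]; rewrite lee_fin f0.
- by apply/measurable_EFinP; exact: measurable_funTS.
- by move=> s [s0 _]; rewrite lee_fin g0.
- by apply/measurable_EFinP; exact: measurable_funTS.
Qed.

Lemma measurable_one_sub_expR lam :
  measurable_fun setT (fun s : vec => (1 - expR (- dotv lam s))%R).
Proof. by apply: measurable_funB => //; exact: measurable_exp_dotv. Qed.

Lemma levy_exponent_coord n i a : (0 <= a)%R ->
  levy_exponent n (vunit i a) =
  \int[n]_(s in Omega R d) (1 - expR (- (a * tnth s i)))%:E.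
Proof. by move=> a0; apply: eq_integral => s _; rewrite dotv_unit. Qed.

Lemma Omega_integral_eq0 n (f : vec -> R) (E : set vec) : on_Omega n ->
  measurable_fun setT f -> (forall s, Omega R d s -> (0 <= f s)%R) ->
  \int[n]_(s in Omega R d) (f s)%:E = 0 -> measurable E ->
  (forall s, Omega R d s -> E s -> f s != 0%R) -> n E = 0.
Proof.
move=> n0 mf f0 if0 mE Ef; have mO := @measurable_Omega R d.
have <- : n (Omega R d `&` E) = n E by exact: measure_conegligible_setI.
apply: (ge0_integral_eq0 (f := (fun s => (f s)%:E) \_ (Omega R d))).
- apply/(measurable_restrictT _ mO)/measurable_EFinP; exact: measurable_funTS.
- by move=> s; rewrite patchE; case: ifPn => // /set_mem Os; rewrite lee_fin f0.
- by rewrite -integral_mkcond.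
- exact: measurableI.
- by move=> s [Os Es]; rewrite patchE mem_set// eqe Ef.
Qed.

Lemma measurable_expN_coord i : measurable_fun setT (fun s : vec => expR (- tnth s i)).
Proof.
apply: measurableT_comp => //; apply: measurable_funN; exact: (measurable_coord i).
Qed.

(* [(1 - x^2) + (1 - y^2) + (x - y)^2 = 2 (1 - x y)] at [x = e^(-s_i)], [y = e^(-s_j)] *)
Lemma levy_exponent_diag n i j : on_Omega n ->
  (forall lam, nnegv lam -> levy_exponent n lam < +oo) ->
  levy_exponent n (vunit i 2) = levy_exponent n (vadd (vunit i 1) (vunit j 1)) ->
  levy_exponent n (vunit j 2) = levy_exponent n (vadd (vunit i 1) (vunit j 1)) ->
  n [set s | tnth s i != tnth s j] = 0.
Proof.
move=> n0 nfin ei ej; have mO := @measurable_Omega R d.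
pose f s := ((expR (- tnth s i) - expR (- tnth s j)) ^+ 2)%R.
have mf : measurable_fun setT f.
  apply: measurable_funX; apply: measurable_funB; exact: measurable_expN_coord.
have f0 s : nnegv s -> (0 <= f s)%R by rewrite sqr_ge0.
apply: (Omega_integral_eq0 n0 mf).
- by move=> s [/f0].
- have l0 : nnegv (vadd (vunit i 1) (vunit j 1) : vec).
    by apply: nnegvD; apply: nnegv_unit.
  have li : nnegv (vunit i 2 : vec) by apply: nnegv_unit.
  have lj : nnegv (vunit j 2 : vec) by apply: nnegv_unit.
  have fin : levy_exponent n (vadd (vunit i 1) (vunit j 1)) \is a fin_num.
    by rewrite ge0_fin_numE ?nfin ?levy_exponent_ge0.
  have : levy_exponent n (vunit i 2) + levy_exponent n (vunit j 2) +
      \int[n]_(s in Omega R d) (f s)%:E =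
      levy_exponent n (vadd (vunit i 1) (vunit j 1)) +
      levy_exponent n (vadd (vunit i 1) (vunit j 1)).
    have m1 l := measurable_one_sub_expR l.
    have e1 l : nnegv l -> forall s, nnegv s -> (0 <= 1 - expR (- dotv l s))%R.
      by move=> l0' s; exact: one_sub_exp_ge0.
    rewrite /levy_exponent.
    pose va : vec := vunit i 2; pose vb : vec := vunit j 2.
    pose vc : vec := vadd (vunit i 1) (vunit j 1).
    have h1 := Omega_integralD n (m1 va) (m1 vb) (e1 _ li) (e1 _ lj).
    have h2 := Omega_integralD n (m1 vc) (m1 vc) (e1 _ l0) (e1 _ l0).
    have eij s : nnegv s -> (0 <= (1 - expR (- dotv va s)) + (1 - expR (- dotv vb s)))%R by
      move=> s0; exact: (addr_ge0 (e1 va li s s0) (e1 vb lj s s0)).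
    have m2 := measurable_funD (m1 va) (m1 vb).
    have h3 := Omega_integralD n m2 mf eij f0.
    apply: (etrans (congr1 (fun z => z + \int[n]_(s in Omega R d) (f s)%:E) h1)).
    apply: (etrans h3); apply: (etrans _ (esym h2)).
    apply: eq_integral => s _; congr EFin.
    rewrite /= /va /vb dotvD !dotv_unit !mul1r opprD expRD /f.
    have e2 (x : R) : expR (- (2 * x)) = (expR (- x) * expR (- x))%R.
      by rewrite -expRD; congr expR; ring.
    by rewrite !e2; ring.
  rewrite ei ej => h.
  by apply: (eadd_eq_self (x := _ + _) _ h); rewrite fin_numD fin.
- exact: measurable_coord_neq.
- move=> s _ /= h; apply: expf_neq0; rewrite subr_eq0.
  by apply: contra h => /eqP/expR_inj/oppr_inj ->.
Qed.

(* [(1 - x) (1 - y) + (1 - x y) = (1 - x) + (1 - y)] at [x = e^(-s_i)], [y = e^(-s_j)] *)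
Lemma levy_exponent_axes n i j : i != j -> on_Omega n ->
  (forall lam, nnegv lam -> levy_exponent n lam < +oo) ->
  levy_exponent n (vadd (vunit i 1) (vunit j 1)) =
    levy_exponent n (vunit i 1) + levy_exponent n (vunit j 1) ->
  n [set s | tnth s i != 0%R /\ tnth s j != 0%R] = 0.
Proof.
move=> ij n0 nfin e; have mO := @measurable_Omega R d.
pose f s := ((1 - expR (- tnth s i)) * (1 - expR (- tnth s j)))%R.
have mf : measurable_fun setT f.
  apply: measurable_funM; apply: measurable_funB => //; exact: measurable_expN_coord.
have e0 s l : nnegv s -> (0 <= 1 - expR (- tnth s l))%R.
  by move=> s0; rewrite subr_ge0 expR_le1 oppr_le0.
have f0 s : nnegv s -> (0 <= f s)%R by move=> s0; rewrite mulr_ge0 ?e0.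
apply: (Omega_integral_eq0 n0 mf).
- by move=> s [/f0].
- have l0 : nnegv (vadd (vunit i 1) (vunit j 1) : vec).
    by apply: nnegvD; apply: nnegv_unit.
  have li : nnegv (vunit i 1 : vec) by apply: nnegv_unit.
  have lj : nnegv (vunit j 1 : vec) by apply: nnegv_unit.
  have fin : levy_exponent n (vadd (vunit i 1) (vunit j 1)) \is a fin_num.
    by rewrite ge0_fin_numE ?nfin ?levy_exponent_ge0.
  have : \int[n]_(s in Omega R d) (f s)%:E +
      levy_exponent n (vadd (vunit i 1) (vunit j 1)) =
      levy_exponent n (vunit i 1) + levy_exponent n (vunit j 1).
    have m1 l := measurable_one_sub_expR l.
    have e1 l : nnegv l -> forall s, nnegv s -> (0 <= 1 - expR (- dotv l s))%R.
      by move=> l0' s; exact: one_sub_exp_ge0.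
    rewrite /levy_exponent.
    pose va : vec := vunit i 1; pose vb : vec := vunit j 1.
    pose vc : vec := vadd (vunit i 1) (vunit j 1).
    apply: (etrans (Omega_integralD n mf (m1 vc) f0 (e1 _ l0))).
    apply: (etrans _ (esym (Omega_integralD n (m1 va) (m1 vb) (e1 _ li) (e1 _ lj)))).
    apply: eq_integral => s _; congr EFin.
    by rewrite dotvD !dotv_unit !mul1r opprD expRD /f; ring.
  rewrite -e => h.
  by rewrite addeC in h; exact: (eadd_eq_self fin h).
- by apply: measurableI; exact: measurable_coord_neq0.
- move=> s [s0 _] /= [si sj]; rewrite /f mulf_neq0// subr_eq0 eq_sym.
  + by apply: contra si; rewrite -[X in _ == X]expR0 => /eqP/expR_inj/eqP; rewrite oppr_eq0.
  + by apply: contra sj; rewrite -[X in _ == X]expR0 => /eqP/expR_inj/eqP; rewrite oppr_eq0.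
Qed.

Lemma off_axes_eq0 n :
  (forall i j, i != j -> n [set s | tnth s i != 0%R /\ tnth s j != 0%R] = 0) ->
  n off_axes = 0.
Proof.
move=> h; pose Q i j : set vec := [set s | i != j] `&`
  ([set s | tnth s i != 0%R] `&` [set s | tnth s j != 0%R]).
have mQ i j : measurable (Q i j).
  apply: measurableI; last by apply: measurableI; exact: measurable_coord_neq0.
  have [ij|ij] := boolP (i != j).
    by rewrite (_ : mkset _ = setT)//; apply/seteqP; split.
  by rewrite (_ : mkset _ = set0)//; apply/seteqP; split.
have -> : off_axes = [set s | exists i, (fun i => [set s | exists j, Q i j s]) i s] :> set vec.
  apply/seteqP; split => s /=; first by move=> [i [j [ij si sj]]]; exists i, j.
  by move=> [i [j [ij [si sj]]]]; exists i, j; split.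
apply: (measure_exists_null (P := fun i => [set s | exists j, Q i j s])) => i.
  exact: (measurable_exists (mQ i)).
apply: (measure_exists_null (P := Q i)) => // j.
have [ij|/negP ij] := boolP (i != j); last first.
  by rewrite (_ : Q i j = set0) ?measure0//; apply/seteqP; split => // s [].
apply: (subset_measure0 (mQ i j) _ _ (h _ _ ij)).
  by apply: measurableI; exact: measurable_coord_neq0.
by move=> s [_ []].
Qed.

Lemma diag_levy_exponent n i0 lam : on_Omega n -> nnegv lam ->
  (forall i, n [set s | tnth s i != tnth s i0] = 0) ->
  levy_exponent n lam = levy_exponent n (vunit i0 (vsum lam)).
Proof.
move=> n0 l0 ndiag; have mO := @measurable_Omega R d.
have mN i := @measurable_coord_neq R d i i0.
rewrite /levy_exponent [LHS]integral_mkcond [RHS]integral_mkcond.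
have l0' : nnegv (vunit i0 (vsum lam) : vec) by apply: nnegv_unit; exact: vsum_ge0.
have g0 (l : vec) s : nnegv l ->
    0 <= ((fun s => (1 - expR (- dotv l s))%:E) \_ (Omega R d)) s.
  move=> l1; rewrite patchE; case: ifPn => // /set_mem[s0 _].
  by rewrite lee_fin one_sub_exp_ge0.
apply: (ge0_integral_ae0 (N := [set s | exists i, tnth s i != tnth s i0])) => //.
- exact: (measurable_exists mN).
- exact: (measure_exists_null mN ndiag).
- by apply/(measurable_restrictT _ mO); exact: measurable_one_sub_exp.
- by apply/(measurable_restrictT _ mO); exact: measurable_one_sub_exp.
- by move=> s; exact: g0.
- by move=> s; exact: g0.
move=> s Ns; rewrite !patchE; case: ifPn => // _.
rewrite dotv_unit; congr (1 - expR (- _))%:E.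
rewrite /dotv /vsum mulr_suml; apply: eq_bigr => i _; congr (_ * _)%R.
by apply/eqP; apply: contrapT => /negP h; apply: Ns; exists i.
Qed.

Lemma axes_levy_exponent n lam : on_Omega n -> nnegv lam -> n off_axes = 0 ->
  levy_exponent n lam = \sum_(i < d) levy_exponent n (vunit i (tnth lam i)).
Proof.
move=> n0 l0 nax; have mO := @measurable_Omega R d.
have mF (l : vec) : measurable_fun setT
    ((fun s => (1 - expR (- dotv l s))%:E) \_ (Omega R d)).
  by apply/(measurable_restrictT _ mO); exact: measurable_one_sub_exp.
have g0 (l : vec) s : nnegv l ->
    0 <= ((fun s => (1 - expR (- dotv l s))%:E) \_ (Omega R d)) s.
  move=> l1; rewrite patchE; case: ifPn => // /set_mem[s0 _].
  by rewrite lee_fin one_sub_exp_ge0.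
have li i : nnegv (vunit i (tnth lam i)) by apply: nnegv_unit.
rewrite /levy_exponent [LHS]integral_mkcond.
under eq_bigr do rewrite integral_mkcond.
rewrite -ge0_integral_sum//; last by move=> i s _; exact: g0.
apply: (ge0_integral_ae0 measurable_off_axes nax) => //.
- exact: emeasurable_sum.
- by move=> s; exact: g0.
- by move=> s; apply: sume_ge0 => i _; exact: g0.
move=> s Ns; rewrite patchE; case: ifPn => [sO|sO]; last first.
  by rewrite big1// => i _; rewrite patchE (negbTE sO).
under eq_bigr do rewrite patchE sO dotv_unit.
rewrite sumEFin; congr EFin.
move/set_mem: sO => [s0 [i si]].
have sj j : j != i -> tnth s j = 0%R.
  move=> ji; apply/eqP; apply: contrapT => /negP h; apply: Ns.
  by exists j, i; split.
rewrite (bigD1 i)//= [X in _ = (_ + X)%R]big1 ?addr0; last first.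
  by move=> j ji; rewrite sj// mulr0 oppr0 expR0 subrr.
congr (1 - expR (- _))%R.
rewrite /dotv (bigD1 i)//= big1 ?addr0// => j ji.
by rewrite sj// mulr0.
Qed.

(** Uniqueness of intensities in dimension one, applied to the images under one coordinate. The
    images are restricted to [Omega R 1] because the value 0 may carry any mass. *)
Lemma same_jumps_levy n k i j : on_Omega n -> on_Omega k ->
  (forall a, (0 <= a)%R -> levy_exponent n (vunit i a) < +oo) ->
  (forall a, (0 <= a)%R -> levy_exponent n (vunit i a) = levy_exponent k (vunit j a)) ->
  same_jumps n k i j.
Proof.
move=> n0 k0 nfin nk B mB B0.
have mO1 := @measurable_Omega R 1; have mO := @measurable_Omega R d.
pose q (l : 'I_d) (s : vec) : 1.-tuple R := [tuple tnth s l | _ < 1].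
have mq l : measurable_fun setT (q l).
  apply: measurable_tupleP => z; under eq_fun do rewrite tnth_mktuple.
  exact: (measurable_coord l).
pose marg (m : {measure set vec -> \bar R}) l : {measure set (1.-tuple R) -> \bar R} :=
  mrestr (image_measure m (mq l)) mO1.
have marg0 m l : on_Omega (marg m l).
  by rewrite /on_Omega /marg /= /mrestr setICl measure0.
have margE m l (lam : 1.-tuple R) : on_Omega m -> nnegv lam ->
    \int[marg m l]_(s in Omega R 1) (1 - expR (- dotv lam s))%:E =
    levy_exponent m (vunit l (tnth lam ord0)).
  move=> m0 l0; pose f (s : 1.-tuple R) := (1 - expR (- dotv lam s))%:E.
  have mf : measurable_fun setT (f \_ (Omega R 1)).
    by apply/(measurable_restrictT _ mO1); exact: measurable_one_sub_exp.
  have f0 (s : 1.-tuple R) : 0 <= (f \_ (Omega R 1)) s.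
    by rewrite patchE; case: ifPn => // /set_mem[s0 _]; rewrite lee_fin one_sub_exp_ge0.
  have -> : \int[marg m l]_(s in Omega R 1) f s =
      \int[image_measure m (mq l)]_(s in Omega R 1) f s.
    by apply: eq_measure_integral => A mA AO; rewrite /marg /= /mrestr setIidl.
  rewrite integral_mkcond integral_image_measure// /levy_exponent [RHS]integral_mkcond.
  have l0' : nnegv (vunit l (tnth lam ord0) : vec) by exact: nnegv_unit.
  apply: (ge0_integral_ae0 (measurableC mO) m0) => //.
  - by apply: (measurableT_comp mf); exact: mq.
  - by apply/(measurable_restrictT _ mO); exact: measurable_one_sub_exp.
  - move=> s; rewrite patchE; case: ifPn => // /set_mem[s0 _].
    by rewrite lee_fin one_sub_exp_ge0.
  - move=> s /contrapT sO; have [s0 _] := sO; rewrite !patchE (mem_set sO).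
    have e : dotv lam (q l s) = (tnth lam ord0 * tnth s l)%R.
      by rewrite /dotv big_ord1 tnth_mktuple.
    rewrite dotv_unit; case: ifPn => [_|qO]; first by rewrite /f e.
    suff -> : tnth s l = 0%R by rewrite mulr0 oppr0 expR0 subrr.
    apply/eqP; apply: contraNT qO => sl; rewrite inE; split.
      by move=> z; rewrite tnth_mktuple.
    by exists ord0; rewrite tnth_mktuple.
have : marg n i [set s | B (tnth s ord0)] = marg k j [set s | B (tnth s ord0)].
  apply: eq_levy_measure => //.
  - by move=> lam l0; rewrite margE// nfin.
  - by move=> lam l0; rewrite !margE// nk.
  - have := @measurable_coord R 1 ord0 measurableT _ mB; by rewrite setTI.
have margB m l : marg m l [set s | B (tnth s ord0)] = m (coord l @^-1` B).
  rewrite /marg /= /mrestr; congr (m _); apply/seteqP; split => s /=.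
    by rewrite tnth_mktuple => -[].
  rewrite tnth_mktuple => Bs; split => //.
  have := B0 _ Bs; rewrite /= in_itv/= andbT => sl; split.
    by move=> z; rewrite tnth_mktuple ltW.
  by exists ord0; rewrite tnth_mktuple gt_eqF.
by rewrite !margB.
Qed.

End LevyExponent.

(** The left-hand side is ln (b / a^2) <= b / a^2 - 1. It is meant for a and b the Laplace
    transforms of one coordinate at h and 2 h, so that it becomes a second difference of the
    exponent. *)
Lemma ln_variation (R : realType) (l a b c : R) : (0 < l)%R -> (l <= a)%R -> (0 < b)%R ->
  (0 <= c)%R -> (b - a ^+ 2 <= c)%R -> (2 * - ln a - - ln b <= c / l ^+ 2)%R.
Proof.
move=> l0 la b0 c0 bac; have a0 := lt_le_trans l0 la.
have -> : (2 * - ln a - - ln b = ln (b / a ^+ 2))%R.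
  by rewrite ln_div ?posrE ?exprn_gt0// lnXn//; ring.
have q0 : (0 < b / a ^+ 2)%R by rewrite divr_gt0// exprn_gt0.
apply: le_trans (_ : b / a ^+ 2 - 1 <= _)%R.
  have := @le_ln1Dx R (b / a ^+ 2 - 1)%R.
  rewrite addrCA subrr addr0; apply; lra.
have -> : (b / a ^+ 2 - 1 = (b - a ^+ 2) / a ^+ 2)%R.
  by rewrite mulrBl divff// expf_neq0// gt_eqF.
apply: le_trans (_ : c / a ^+ 2 <= _)%R.
  by rewrite ler_wpM2r// invr_ge0 exprn_ge0// ltW.
rewrite ler_wpM2l// lef_pV2 ?posrE ?exprn_gt0// lerXn2r ?nnegrE//; exact: ltW.
Qed.

Lemma second_order_variance (R : realType) (a b c : R) :
  (b + 1 <= 2 * a + c)%R -> (b - a ^+ 2 <= c)%R.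
Proof. by have := sqr_ge0 (1 - a)%R; rewrite sqrrB mul1r expr1n; lra. Qed.

(** With y = x / (N + 1), the inequalities y / (1 + y) <= 1 - e^(-y) <= y squeeze the sequence. *)
Lemma secant_expR_cvg (R : realType) (x : R) : (0 <= x)%R ->
  (N.+1%:R * (1 - expR (- (N.+1%:R^-1 * x))))%R @[N --> \oo] --> x.
Proof.
move=> x0.
have h : (x / (1 + N.+1%:R^-1 * x))%R @[N --> \oo] --> x.
  suff : (x / (1 + N.+1%:R^-1 * x))%R @[N --> \oo] --> (x / (1 + 0 * x))%R.
    by rewrite mul0r addr0 divr1.
  apply: cvgM; first exact: cvg_cst.
  apply: cvgV; first by rewrite mul0r addr0 oner_neq0.
  apply: cvgD; first exact: cvg_cst.
  by apply: cvgMl; exact: cvg_harmonic.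
apply: squeeze_cvgr h (cvg_cst x) => //; apply: nearW => N.
have N0 : (0 < N.+1%:R :> R)%R by rewrite ltr0n.
set y := (N.+1%:R^-1 * x)%R.
have y0 : (0 <= y)%R by rewrite mulr_ge0// invr_ge0 ltW.
have -> : x = (N.+1%:R * y)%R by rewrite /y mulrA divff ?mul1r// gt_eqF.
apply/andP; split.
  rewrite -mulrA ler_wpM2l//.
  rewrite ler_pdivrMr; last by apply: ltr_pwDl.
  have e1 := expR_ge1Dx y.
  have : (expR (- y) * (1 + y) <= 1)%R.
    by rewrite expRN mulrC ler_pdivrMr ?expR_gt0// mul1r.
  set z := expR _; nra.
rewrite ler_wpM2l//.
have := expR_ge1Dx (- y); lra.
Qed.

(** * Second moments pass from the random vector to its intensity *)

Section SecondMoment.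
Context {R : realType} {X : completePseudoMetricType R} {d : nat}
  {dO : measure_display} {Om : measurableType dO}.
Variables (P : probability Om R) (mu : 'I_d -> R.-ftker Om ~> borel X).
Variables (A : set (borel X)) (mA : measurable A) (i : 'I_d).
Let Y w : R := fine (mu i w A).
Let L (h : R) : R := laplace P mu A (vunit i h).

Let Y0 w : (0 <= Y w)%R. Proof. by rewrite fine_ge0. Qed.
Let mY : measurable_fun setT Y. Proof. exact: measurable_fine_kernel. Qed.

Lemma measurable_exp_coord h : measurable_fun setT (fun w => expR (- (h * Y w))).
Proof.
apply: measurableT_comp => //; apply: measurable_funN; exact: measurable_funM.
Qed.

Lemma laplace_coordE h : (0 <= h)%R ->
  \int[P]_w (expR (- (h * Y w)))%:E = (L h)%:E /\ (0 < L h <= 1)%R.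
Proof.
move=> h0; have [e Le] := integral_laplace P mu mA (nnegv_unit i h0).
split; last exact: Le.
apply: (etrans _ e); apply: eq_integral => w _.
by congr (expR (- _))%:E; rewrite dotv_unit tnth_mktuple.
Qed.

(* [1 + x^2 <= 2 x + (h Y)^2] at [x = e^(-hY)], since [1 - x <= h Y]. *)
Lemma laplace_second_order h m : (0 <= h)%R -> (0 <= m)%R ->
  \int[P]_w (Y w ^+ 2)%:E = m%:E ->
  (L (2 * h) + 1 <= 2 * L h + h ^+ 2 * m)%R.
Proof.
move=> h0 m0 mE; have h20 : (0 <= 2 * h)%R by rewrite mulr_ge0.
have [e2 _] := laplace_coordE h20; have [e1 _] := laplace_coordE h0.
have me := measurable_exp_coord.
have mY2 : measurable_fun setT (fun w => Y w ^+ 2)%R by exact: measurable_funX.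
have eL : \int[P]_w (expR (- (2 * h * Y w)) + 1)%:E = (L (2 * h) + 1)%:E.
  rewrite (eq_integral (fun w => (expR (- (2 * h * Y w)))%:E + (cst 1) w))//.
  rewrite ge0_integralD//.
  - by rewrite e2 integral_cst// [X in _ * X](@probability_setT _ _ _ P) mule1.
  - exact/measurable_EFinP.
have eR : \int[P]_w (2 * expR (- (h * Y w)) + h ^+ 2 * Y w ^+ 2)%:E = (2 * L h + h ^+ 2 * m)%:E.
  rewrite (eq_integral (fun w => 2%:E * (expR (- (h * Y w)))%:E +
    (h ^+ 2)%:E * (Y w ^+ 2)%:E))//.
  rewrite ge0_integralD//.
  - rewrite ge0_integralZl//; last exact/measurable_EFinP.
    rewrite ge0_integralZl//; first by rewrite e1 mE.
    + exact/measurable_EFinP.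
    + by move=> w _; rewrite lee_fin sqr_ge0.
    + by rewrite lee_fin sqr_ge0.
  - by apply: measurable_funeM; exact/measurable_EFinP.
  - by move=> w _; rewrite mule_ge0// lee_fin sqr_ge0.
  - by apply: measurable_funeM; exact/measurable_EFinP.
rewrite -lee_fin -eL -eR; apply: ge0_le_integral => //.
- by apply/measurable_EFinP; apply: measurable_funD.
- apply/measurable_EFinP; apply: measurable_funD; exact: measurable_funM.
- move=> w _; rewrite lee_fin.
  have -> : expR (- (2 * h * Y w)) = (expR (- (h * Y w)) ^+ 2)%R.
    by rewrite expr2 -expRD; congr expR; ring.
  have x0 : (0 <= h * Y w)%R by rewrite mulr_ge0.
  set x := (h * Y w)%R in x0 *; rewrite -exprMn -/x.
  have : (1 - x <= expR (- x))%R by apply: le_trans (expR_ge1Dx _).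
  have : (expR (- x) <= 1)%R by rewrite expR_le1 oppr_le0.
  set z := expR (- x) => z1 zx.
  have : ((1 - z) ^+ 2 <= x ^+ 2)%R by rewrite lerXn2r ?nnegrE//; lra.
  nra.
Qed.

Variables (n : {measure set (d.-tuple R) -> \bar R}).
Hypothesis hn : is_levy_intensity P mu A n.

(** The identity (1 - x)^2 + (1 - x^2) = 2 (1 - x) at x = e^(-h s_i), integrated; the sum form
    avoids subtracting integrals. *)
Lemma levy_second_order h : (0 <= h)%R ->
  \int[n]_(s in Omega R d) ((1 - expR (- (h * tnth s i))) ^+ 2)%:E +
  (exponent P mu A (vunit i (2 * h)))%:E = (2 * exponent P mu A (vunit i h))%:E.
Proof.
move=> h0; have h20 : (0 <= 2 * h)%R by rewrite mulr_ge0.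
have m1 l : measurable_fun setT (fun s : d.-tuple R => (1 - expR (- (l * tnth s i)))%R).
  apply: measurable_funB => //; apply: measurableT_comp => //; apply: measurable_funN.
  by apply: measurable_funM => //; exact: (measurable_coord i).
have p1 l : (0 <= l)%R -> forall s : d.-tuple R, nnegv s -> (0 <= 1 - expR (- (l * tnth s i)))%R.
  by move=> l0 s s0; rewrite subr_ge0 expR_le1 oppr_le0 mulr_ge0.
have m2 := measurable_funX 2 (m1 h).
have p2 (s : d.-tuple R) : nnegv s ->
    (0 <= (1 - expR (- (h * tnth s i))) ^+ 2)%R by rewrite sqr_ge0.
have e1 := etrans (esym (levy_exponent_coord n i h0))
  (levy_exponentE mA (nnegv_unit i h0) hn).
have e2 := etrans (esym (levy_exponent_coord n i h20))
  (levy_exponentE mA (nnegv_unit i h20) hn).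
apply: (etrans (congr1 (fun z => _ + z) (esym e2))).
apply: (etrans (Omega_integralD n m2 (m1 _) p2 (p1 _ h20))).
rewrite [RHS](_ : _ = (exponent P mu A (vunit i h))%:E + (exponent P mu A (vunit i h))%:E);
  last by rewrite -EFinD; congr EFin; ring.
apply: (etrans _ (congr1 (fun z => z + z) e1)).
apply: (etrans _ (esym (Omega_integralD n (m1 _) (m1 _) (p1 _ h0) (p1 _ h0)))).
apply: eq_integral => s _; congr EFin => /=.
have -> : expR (- (2 * h * tnth s i)) = (expR (- (h * tnth s i)) ^+ 2)%R.
  by rewrite expr2 -expRD; congr expR; ring.
by ring.
Qed.

(* By [ln_variation], the integral of ((1 - e^(-h s_i)) / h)^2 is bounded
   uniformly in h; Fatou as h tends to 0. *)
Lemma levy_second_moment : \int[P]_w (Y w ^+ 2)%:E < +oo ->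
  \int[n]_s (tnth s i ^+ 2)%:E < +oo.
Proof.
move=> Yfin.
have I0 : 0 <= \int[P]_w (Y w ^+ 2)%:E by apply: integral_ge0 => w _; rewrite lee_fin sqr_ge0.
pose m := fine (\int[P]_w (Y w ^+ 2)%:E).
have mE : \int[P]_w (Y w ^+ 2)%:E = m%:E by rewrite fineK// ge0_fin_numE.
have m0 : (0 <= m)%R by rewrite fine_ge0.
have [_ /andP[L1 _]] := laplace_coordE ler01.
have bound h : (0 <= h <= 1)%R ->
    \int[n]_(s in Omega R d) ((1 - expR (- (h * tnth s i))) ^+ 2)%:E <=
    (h ^+ 2 * (m / L 1 ^+ 2))%:E.
  move=> /andP[h0 h1]; have h20 : (0 <= 2 * h)%R by rewrite mulr_ge0.
  have [_ /andP[a0 a1]] := laplace_coordE h0; have [_ /andP[b0 b1]] := laplace_coordE h20.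
  have e := levy_second_order h0.
  have -> : \int[n]_(s in Omega R d) ((1 - expR (- (h * tnth s i))) ^+ 2)%:E =
     (2 * exponent P mu A (vunit i h) - exponent P mu A (vunit i (2 * h)))%:E.
    by rewrite EFinB -e addeK.
  (* Laplace transforms decrease in h, so [L 1] is a positive lower bound valid for all h in [0, 1];
     it makes the constant independent of h. *)
  have L1h : (L 1 <= L h)%R.
    have [e1 _] := laplace_coordE ler01; have [e2 _] := laplace_coordE h0.
    rewrite -lee_fin; apply: (eq_ind _ (fun z => z <= (L h)%:E) _ _ e1).
    apply: (eq_ind _ (fun z => _ <= z) _ _ e2); apply: ge0_le_integral => //.
    - by apply/measurable_EFinP; exact: measurable_exp_coord.
    - by apply/measurable_EFinP; exact: measurable_exp_coord.
    - by move=> w _; rewrite lee_fin ler_expR lerN2 ler_wpM2r.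
  have so := laplace_second_order h0 m0 mE.
  have c0 : (0 <= h ^+ 2 * m)%R by rewrite mulr_ge0 ?sqr_ge0.
  have var : (L (2 * h) - L h ^+ 2 <= h ^+ 2 * m)%R.
    exact: second_order_variance so.
  rewrite lee_fin mulrA; exact: (ln_variation L1 L1h b0 c0 var).
have [nO _] := hn; have mO := @measurable_Omega R d.
pose f_ (N : nat) (s : d.-tuple R) := ((N.+1%:R * (1 - expR (- (N.+1%:R^-1 * tnth s i)))) ^+ 2)%R.
have mf_ N : measurable_fun setT (f_ N).
  apply: measurable_funX; apply: measurable_funM => //; apply: measurable_funB => //.
  apply: measurableT_comp => //; apply: measurable_funN.
  by apply: measurable_funM => //; exact: (measurable_coord i).
have null : n (~` Omega R d) = 0 by [].
apply: (@le_lt_trans _ _ (m / L 1 ^+ 2)%:E); last by rewrite ltry.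
apply: (@fatou_bound _ _ _ n (~` Omega R d) f_ _ _ 0 (measurableC mO) null mf_).
- by apply: measurable_funX; exact: (measurable_coord i).
- by move=> N s; rewrite sqr_ge0.
- by move=> s; rewrite sqr_ge0.
- move=> s /contrapT[s0 _]; rewrite /f_ expr2.
  under eq_fun do rewrite expr2.
  by apply: cvgM; exact: secant_expR_cvg.
- move=> N _.
  have h01 : (0 <= (N.+1%:R^-1 : R) <= 1)%R.
    by rewrite invr_ge0 ler0n/= invf_le1 ?ltr0n// ler1n.
  have := bound _ h01.
  rewrite (_ : \int[n]_x (f_ N x)%:E = (N.+1%:R ^+ 2)%:E *
    \int[n]_(s in Omega R d) ((1 - expR (- (N.+1%:R^-1 * tnth s i))) ^+ 2)%:E).
    move=> h; apply: (@le_trans _ _ ((N.+1%:R ^+ 2)%:E * (N.+1%:R^-1 ^+ 2 * (m / L 1 ^+ 2))%:E)).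
      by rewrite lee_wpmul2l// lee_fin sqr_ge0.
    by rewrite -EFinM lee_fin mulrA -exprMn mulfV ?expr1n ?mul1r// pnatr_eq0.
  have mg : measurable_fun setT (fun s : d.-tuple R =>
      ((1 - expR (- (N.+1%:R^-1 * tnth s i))) ^+ 2)%:E).
    apply/measurable_EFinP; apply: measurable_funX; apply: measurable_funB => //.
    apply: measurableT_comp => //; apply: measurable_funN.
    by apply: measurable_funM => //; exact: (measurable_coord i).
  rewrite -ge0_integralZl//; last 2 first.
  + exact: measurable_funTS.
  + by move=> s _; rewrite lee_fin sqr_ge0.
  rewrite [RHS]integral_mkcond; apply: (ge0_integral_ae0 (measurableC mO) null).
  + exact/measurable_EFinP.
  + apply/(measurable_restrictT _ mO); apply: measurable_funTS.
    exact: measurable_funeM.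
  + by move=> s; rewrite lee_fin sqr_ge0.
  + by move=> s; rewrite patchE; case: ifPn => // _; rewrite -EFinM lee_fin mulr_ge0// sqr_ge0.
  + by move=> s /contrapT sO; rewrite patchE (mem_set sO) -EFinM /f_ exprMn.
Qed.

End SecondMoment.

(** * Independence and laws *)

Section WeightedIntegral.
Context {R : realType} d (T : measurableType d) (m : {measure set T -> \bar R})
  (w : T -> R) (mw : measurable_fun setT w) (w0 : forall x, (0 <= w x)%R).
Import HBNNSimple.

Lemma integral_weighted_nnsfun (f : {nnsfun T >-> R}) :
  \int[weighted_measure m mw w0]_x (f x)%:E = \int[m]_x (f x * w x)%:E.
Proof.
pose s : seq R := finmap.enum_fset (fset_set (range f)).
have c0 i : (0 <= s`_i)%R.
  have [si|si] := ltnP i (size s); last by rewrite nth_default.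
  have : s`_i \in s by rewrite mem_nth.
  by rewrite /s in_fset_set// inE => -[x _ <-].
have mf i : measurable (f @^-1` [set s`_i]) by [].
have fE x : f x = (\sum_(i < size s) s`_i * \1_(f @^-1` [set s`_i]) x)%R := fimfunEord f x.
have fE' x : (f x)%:E = \sum_(i < size s) (s`_i * \1_(f @^-1` [set s`_i]) x)%:E.
  by rewrite sumEFin; congr EFin; exact: fE.
under [LHS]eq_integral => x _ do rewrite fE'.
rewrite ge0_integral_sum//; last first.
- by move=> i x _; rewrite lee_fin mulr_ge0.
- by move=> i; apply/measurable_EFinP; apply: measurable_funM => //; exact: measurable_indic.
have fwE x : (f x * w x)%:E = \sum_(i < size s) (s`_i * \1_(f @^-1` [set s`_i]) x * w x)%:E.
  by rewrite sumEFin fE mulr_suml.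
under [RHS]eq_integral do rewrite fwE.
rewrite ge0_integral_sum//; last first.
- by move=> i x _; rewrite lee_fin mulr_ge0// mulr_ge0.
- move=> i; apply/measurable_EFinP; apply: measurable_funM => //.
  by apply: measurable_funM => //; exact: measurable_indic.
apply: eq_bigr => i _.
under [LHS]eq_integral do rewrite EFinM.
rewrite ge0_integralZl//; last first.
- by rewrite lee_fin.
- by apply/measurable_EFinP; exact: measurable_indic.
rewrite integral_indic// setIT.
transitivity ((s`_i)%:E * \int[m]_x (w x * \1_(f @^-1` [set s`_i]) x)%:E).
  by congr (_ * _); exact: weighted_measure_indic.
rewrite -ge0_integralZl//; last first.
- by rewrite lee_fin.
- by move=> x _; rewrite lee_fin mulr_ge0.
- by apply/measurable_EFinP; apply: measurable_funM => //; exact: measurable_indic.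
by apply: eq_integral => x _; rewrite -EFinM; congr EFin; ring.
Qed.

(** The density formula, extended from simple functions by monotone convergence on both sides. *)
Lemma integral_weighted (f : T -> R) : measurable_fun setT f -> (forall x, 0 <= f x)%R ->
  \int[weighted_measure m mw w0]_x (f x)%:E = \int[m]_x (f x * w x)%:E.
Proof.
move=> mf f0; have mf' : measurable_fun setT (EFin \o f) by exact/measurable_EFinP.
pose f_ := nnsfun_approx measurableT mf'.
have fcvg x : EFin (f_ n x) @[n --> \oo] --> (f x)%:E.
  by apply: (cvg_nnsfun_approx measurableT mf') => // y _; rewrite lee_fin.
have nd x : {homo (fun n => f_ n x) : a b / (a <= b)%N >-> (a <= b)%R}.
  by move=> a b ab; exact/lefP/nd_nnsfun_approx.
have h1 : \int[weighted_measure m mw w0]_x (f_ n x)%:E @[n --> \oo] -->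
    \int[weighted_measure m mw w0]_x (f x)%:E.
  rewrite [X in _ --> X](_ : _ = \int[weighted_measure m mw w0]_x limn (fun n => (f_ n x)%:E)).
    apply: cvg_monotone_convergence => //.
    - by move=> n; apply/measurable_EFinP.
    - by move=> n x _; rewrite lee_fin.
    - by move=> x _ a b ab; rewrite lee_fin nd.
  by apply: eq_integral => x _; apply/esym/cvg_lim.
have h2 : \int[m]_x (f_ n x * w x)%:E @[n --> \oo] --> \int[m]_x (f x * w x)%:E.
  rewrite [X in _ --> X](_ : _ = \int[m]_x limn (fun n => (f_ n x * w x)%:E)).
    apply: cvg_monotone_convergence => //.
    - by move=> n; apply/measurable_EFinP; exact: measurable_funM.
    - by move=> n x _; rewrite lee_fin mulr_ge0.
    - by move=> x _ a b ab; rewrite lee_fin ler_wpM2r// nd.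
  apply: eq_integral => x _; apply/esym/cvg_lim => //.
  under eq_fun do rewrite EFinM.
  by rewrite EFinM; apply: cvgeZr.
apply: cvg_unique h1 _ => //.
apply: cvg_trans h2; apply: near_eq_cvg; apply: nearW => n.
by apply/esym; exact: integral_weighted_nnsfun.
Qed.

End WeightedIntegral.

Section IndependentProduct.
Context {R : realType} d (T : measurableType d) (P : probability T R) (n : nat)
  (f : 'I_n -> T -> R).
Hypothesis mf : forall i, measurable_fun setT (f i).
Hypothesis f0 : forall i x, (0 <= f i x)%R.
Hypothesis f1 : forall i x, (f i x <= 1)%R.
Hypothesis indep : forall E : 'I_n -> set R, (forall i, measurable (E i)) ->
  P [set x | forall i, E i (f i x)] = \prod_(i < n) P (f i @^-1` E i).

Let mean i : R := fine (\int[P]_x (f i x)%:E).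
Let prob i (E : set R) : R := fine (P (f i @^-1` E)).

Let mpre i E : measurable E -> measurable (f i @^-1` E).
Proof. by move=> mE; rewrite -[X in measurable X]setTI; exact: mf. Qed.

Let meanE i : \int[P]_x (f i x)%:E = (mean i)%:E.
Proof.
rewrite fineK// ge0_fin_numE; last by apply: integral_ge0 => x _; rewrite lee_fin.
apply: (@le_lt_trans _ _ 1); last by rewrite ltry.
rewrite -(@probability_setT _ _ _ P) -[leRHS]mul1e -(integral_cst P measurableT 1).
apply: ge0_le_integral => //.
- by move=> x _; rewrite lee_fin.
- exact/measurable_EFinP.
- by move=> x _; rewrite lee_fin.
Qed.

Let factor (S : {set 'I_n}) (E : 'I_n -> set R) i x : R :=
  if i \in S then f i x else \1_(E i) (f i x).
Let value (S : {set 'I_n}) (E : 'I_n -> set R) i : R :=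
  if i \in S then mean i else prob i (E i).

(** Induction on the set [S] of indices carrying the function itself, the others carrying an
    indicator; the base case is the independence hypothesis. To admit an index i into [S], two
    measures on the line are compared: B |-> E[1_B(f_i) g], with g the product of the other factors,
    and a multiple of the law of f_i. The induction hypothesis says that they agree. *)
Lemma integral_mixed_product (S : {set 'I_n}) (E : 'I_n -> set R) :
  (forall i, measurable (E i)) ->
  \int[P]_x (\prod_(i < n) factor S E i x)%:E = (\prod_(i < n) value S E i)%:E.
Proof.
have [k] := ubnP #|S|; elim: k S E => // k IH S E Sk mE.
have [S0|[i iS]] := set_0Vmem S.
  rewrite S0 (eq_bigr (fun i => fine (P (f i @^-1` E i)))); last first.
    by move=> i _; rewrite /value inE.
  under eq_integral => x _ do under eq_bigr => i _ do rewrite /factor inE.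
  have -> : (\prod_(i < n) fine (P (f i @^-1` E i)))%:E = \prod_(i < n) P (f i @^-1` E i).
    by rewrite -prodEFin; apply: eq_bigr => i _; rewrite fineK// fin_num_measure//; exact: mpre.
  have mI : measurable [set x | forall i, E i (f i x)].
    by apply: (measurable_forall (P := fun i => f i @^-1` E i)) => i; exact: mpre.
  rewrite -indep// -[X in _ = P X]setIT -integral_indic//.
  apply: eq_integral => x _; congr EFin; rewrite indicE.
  case: (boolP (x \in _)) => [/set_mem h|/negP h].
    by rewrite big1// => i _; rewrite indicE mem_set//; exact: h.
  have [i nEi] : exists i, ~ E i (f i x).
    by apply/existsNP => h'; apply: h; rewrite inE.
  by rewrite (bigD1 i)//= indicE memNset// mul0r.
pose S' := S :\ i; have Sk' : (#|S'| < k)%N.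
  by move: Sk; rewrite (cardsD1 i) iS.
pose E' B := fun j => if j == i then B else E j.
have mE' B : measurable B -> forall j, measurable (E' B j) by move=> mB j; rewrite /E'; case: ifP.
pose g x := (\prod_(j < n | j != i) factor S E j x)%R.
pose c := (\prod_(j < n | j != i) value S E j)%R.
have factor0 S1 E1 j x : (0 <= factor S1 E1 j x)%R.
  by rewrite /factor; case: ifP => // _; rewrite indicE.
have g0 x : (0 <= g x)%R by apply: prodr_ge0 => j _; exact: factor0.
have mfactor j : measurable_fun setT (factor S E j).
  rewrite (_ : factor S E j = if j \in S then f j else \1_(f j @^-1` E j)).
    by case: ifP => // _; apply: measurable_indic; exact: mpre.
  by apply/funext => x; rewrite /factor; case: ifP => // _; rewrite !indicE.
have mg : measurable_fun setT g.
  rewrite /g; under eq_fun do rewrite big_mkcond.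
  by apply: measurable_prod => j _; case: (j != i).
have c0 : (0 <= c)%R.
  by apply: prodr_ge0 => j _; rewrite /value; case: ifP => _;
    rewrite fine_ge0//; apply: integral_ge0 => x _; rewrite lee_fin.
have split_factor B x : (\prod_(j < n) factor S' (E' B) j x = \1_B (f i x) * g x)%R.
  rewrite (bigD1 i)//= {1}/factor /S' in_setD1 eqxx/= /E' eqxx; congr (_ * _)%R.
  by apply: eq_bigr => j ji; rewrite /factor in_setD1 ji/= (negbTE ji).
have split_value B : (\prod_(j < n) value S' (E' B) j = prob i B * c)%R.
  rewrite (bigD1 i)//= {1}/value /S' in_setD1 eqxx/= /E' eqxx; congr (_ * _)%R.
  by apply: eq_bigr => j ji; rewrite /value in_setD1 ji/= (negbTE ji).
pose m1 : {measure set R -> \bar R} := image_measure (weighted_measure P mg g0) (mf i).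
pose m2 : {measure set R -> \bar R} := mscale (NngNum c0) (image_measure P (mf i)).
have m12 B : measurable B -> m1 B = m2 B.
  move=> mB; transitivity (\int[P]_x (\1_B (f i x) * g x)%:E).
    rewrite /m1; apply: (etrans (weighted_measure_indic P mg g0 (mpre i mB))).
    by apply: eq_integral => x _; rewrite mulrC !indicE; congr (_%:R * _)%:E.
  under eq_integral do rewrite -split_factor.
  rewrite (IH S' (E' B) Sk' (mE' _ mB)) split_value EFinM muleC.
  rewrite /m2 /= /mscale/=; congr (_ * _).
  by rewrite fineK// fin_num_measure//; exact: mpre.
have mabs : measurable_fun setT (fun r : R => `|r|%:E).
  by apply/measurable_EFinP.
(* The absolute value stands for the identity, so that the integrand is nonnegative on the whole
   line; the values of [f i] are nonnegative. *)
have e1 : \int[m1]_r `|r|%:E = \int[P]_x (f i x * g x)%:E.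
  rewrite integral_image_measure//.
  apply: (etrans (integral_weighted P mg g0 _ _)).
  - by apply: measurableT_comp.
  - by [].
  - by apply: eq_integral => x _; rewrite ger0_norm.
have e2 : \int[m2]_r `|r|%:E = (mean i * c)%:E.
  rewrite ge0_integral_mscale// integral_image_measure//=.
  rewrite (eq_integral (fun x => (f i x)%:E)); last by move=> x _; rewrite ger0_norm.
  by rewrite meanE -EFinM mulrC.
under eq_integral => x _ do rewrite (bigD1 i)//= {1}/factor iS.
rewrite -[LHS]e1 (bigD1 i)//= {1}/value iS -e2.
by apply: eq_measure_integral => B mB _; exact: m12.
Qed.

Lemma integral_independent_product :
  \int[P]_x (\prod_(i < n) f i x)%:E = \prod_(i < n) \int[P]_x (f i x)%:E.
Proof.
under [RHS]eq_bigr do rewrite meanE.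
rewrite prodEFin; have := @integral_mixed_product [set: 'I_n] (fun=> setT).
rewrite /factor /value; under eq_integral do under eq_bigr do rewrite inE.
by under [X in _ = X%:E]eq_bigr do rewrite inE; apply.
Qed.

End IndependentProduct.

Lemma ln_prod (R : realType) n (F : 'I_n -> R) : (forall i, 0 < F i)%R ->
  (ln (\prod_(i < n) F i) = \sum_(i < n) ln (F i))%R.
Proof.
move=> F0; suff [] : (0 < \prod_(i < n) F i)%R /\
  (ln (\prod_(i < n) F i) = \sum_(i < n) ln (F i))%R by [].
elim/big_rec2 : _ => [|i y x _ [x0 <-]]; first by rewrite ln1.
by rewrite mulr_gt0// lnM ?posrE.
Qed.

Section ExtremeVectors.
Context {R : realType} {X : completePseudoMetricType R} {d : nat}
  {dO : measure_display} {Om : measurableType dO}.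
Variables (P : probability Om R) (mu : 'I_d -> R.-ftker Om ~> borel X).
Variables (A : set (borel X)) (mA : measurable A).

Lemma exponent_components_equal i0 lam : components_ae_equal P mu -> nnegv lam ->
  exponent P mu A lam = exponent P mu A (vunit i0 (vsum lam)).
Proof.
move=> hco l0; apply: (congr1 (fun z => - ln (fine z))%R).
apply: ge0_ae_eq_integral => //.
- by apply/measurable_EFinP; exact: measurable_exp_evalv.
- by apply/measurable_EFinP; exact: measurable_exp_evalv.
apply: filterS hco => w h _; congr (expR (- _))%:E.
rewrite dotv_unit /dotv /vsum mulr_suml; apply: eq_bigr => i _.
by rewrite !tnth_mktuple (h i i0 A mA).
Qed.

Lemma exponent_components_independent lam : components_independent P mu -> nnegv lam ->
  exponent P mu A lam = (\sum_(i < d) exponent P mu A (vunit i (tnth lam i)))%R.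
Proof.
move=> hind l0; have li i : nnegv (vunit i (tnth lam i)) by exact: nnegv_unit.
have pos i : (0 < laplace P mu A (vunit i (tnth lam i)))%R.
  by have [_ /andP[]] := integral_laplace P mu mA (li i).
rewrite /exponent sumrN -ln_prod//; congr (- ln _)%R; apply: EFin_inj.
have [<- _] := integral_laplace P mu mA l0.
rewrite -prodEFin; under [RHS]eq_bigr => i _ do have [<- _] := integral_laplace P mu mA (li i).
pose phi i (y : \bar R) : R := expR (- (tnth lam i * fine y)).
have mphi i : measurable_fun setT (phi i).
  apply: measurableT_comp => //; apply: measurable_funN; exact: measurable_funM.
have mf i : measurable_fun setT (fun w => phi i (mu i w A)).
  by apply: (measurableT_comp (mphi i)); exact: measurable_kernel.
have f0 i w : (0 <= phi i (mu i w A))%R by rewrite expR_ge0.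
have f1 i w : (phi i (mu i w A) <= 1)%R.
  by rewrite expR_le1 oppr_le0 mulr_ge0// fine_ge0.
have ind (E : 'I_d -> set R) : (forall i, measurable (E i)) ->
    P [set w | forall i, E i (phi i (mu i w A))] =
    \prod_(i < d) P ((fun w => phi i (mu i w A)) @^-1` E i).
  move=> mE.
  have := hind [set: 'I_d]%SET (fun i => [set m | (phi i @^-1` E i) (m A)]).
  rewrite (eq_bigl xpredT); last by move=> i; rewrite finset.in_setT.
  rewrite (_ : \bigcap_(j in _) _ = [set w | forall i, E i (phi i (mu i w A))]); last first.
    apply/seteqP; split => w /=; first by move=> h i; apply: (h i); rewrite /= finset.in_setT.
    by move=> h i _; exact: h.
  apply => i; apply: sub_sigma_algebra; exists A, (phi i @^-1` E i); split => //.
  by rewrite -[X in measurable X]setTI; exact: mphi.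
have := integral_independent_product mf f0 f1 ind.
under eq_integral => w _ do rewrite -expR_sum.
move=> h; transitivity (\int[P]_x (expR (\sum_(i < d) - (tnth lam i * fine (mu i x A))))%:E).
  apply: eq_integral => w _; congr (expR _)%:E; rewrite sumrN; congr (- _)%R.
  by apply: eq_bigr => i _; rewrite tnth_mktuple.
rewrite h; apply: eq_bigr => i _; apply: eq_integral => w _; congr (expR (- _))%:E.
by rewrite dotv_unit tnth_mktuple.
Qed.

End ExtremeVectors.

Section Rectangles.
Context {R : realType} {dT : measure_display} {T : measurableType dT} {N : nat}.

Definition rectangles : set (set (N.-tuple T)) :=
  [set E | exists2 B : 'I_N -> set T, (forall j, measurable (B j)) &
    E = [set y | forall j, B j (tnth y j)]].

Lemma measurable_rectangles : @measurable _ (N.-tuple T) = <<s rectangles >>.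
Proof.
apply/seteqP; split; last first.
  apply: smallest_sub; first exact: sigma_algebra_measurable.
  move=> _ [B mB ->]; apply: (measurable_forall (P := fun j => (fun y => tnth y j) @^-1` B j)) => j.
  by rewrite -[X in measurable X]setTI; exact: measurable_tnth.
apply: smallest_sub; first exact: smallest_sigma_algebra.
move=> B; rewrite -bigcup_seq => -[j _ [C mC <-]]; rewrite setTI.
apply: sub_sigma_algebra; exists (fun i => if i == j then C else setT).
  by move=> i; case: ifP.
apply/seteqP; split => y /=.
  by move=> Cy i; case: ifPn => // /eqP ->.
by move=> /(_ j); rewrite eqxx.
Qed.

Lemma rectangles_setI : setI_closed rectangles.
Proof.
move=> _ _ [B1 mB1 ->] [B2 mB2 ->]; exists (fun j => B1 j `&` B2 j).
  by move=> j; exact: measurableI.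
apply/seteqP; split => y /=; first by move=> [h1 h2] j; split.
by move=> h; split => j; have [] := h j.
Qed.

Lemma eq_measure_rectangles (m1 m2 : {measure set (N.-tuple T) -> \bar R}) :
  m1 setT < +oo -> (forall E, rectangles E -> m1 E = m2 E) ->
  forall E, measurable E -> m1 E = m2 E.
Proof.
move=> fin m12 E mE; apply: (measure_unique rectangles (fun=> setT)) => //.
- exact: measurable_rectangles.
- exact: rectangles_setI.
- by move=> _; exists (fun=> setT) => //; apply/seteqP; split.
- by rewrite bigcup_const.
Qed.

End Rectangles.

(** * Laplace transforms determine the law of a completely random vector *)

Section LawDetermined.
Context {R : realType} {X : completePseudoMetricType R} {d : nat}
  {dO1 : measure_display} {Om1 : measurableType dO1}
  {dO2 : measure_display} {Om2 : measurableType dO2}.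
Variables (P1 : probability Om1 R) (mu1 : 'I_d -> R.-ftker Om1 ~> borel X).
Variables (P2 : probability Om2 R) (mu2 : 'I_d -> R.-ftker Om2 ~> borel X).
Hypothesis cr1 : completely_random P1 mu1.
Hypothesis cr2 : completely_random P2 mu2.
Hypothesis laplaceE : forall (A : set (borel X)) lam, measurable A -> nnegv lam ->
  laplace P1 mu1 A lam = laplace P2 mu2 A lam.
Local Notation vec := (d.-tuple R).

Lemma eq_law_evalv (A : set (borel X)) (B : set vec) : measurable A -> measurable B ->
  P1 (evalv mu1 A @^-1` B) = P2 (evalv mu2 A @^-1` B).
Proof.
move=> mA mB; have m1 := measurable_evalv mu1 mA; have m2 := measurable_evalv mu2 mA.
have nn dO (Om : measurableType dO) (P : probability Om R) (mu : 'I_d -> R.-ftker Om ~> borel X) :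
    P (evalv mu A @^-1` (~` [set s | nnegv s])) = 0.
  rewrite (_ : _ @^-1` _ = set0) ?measure0//; apply/seteqP; split => // w h.
  by apply: h; exact: evalv_ge0.
apply: (eq_finite_measure_laplace (m1 := image_measure P1 m1) (m2 := image_measure P2 m2)) => //.
- exact: nn.
- exact: nn.
- by change (P1 setT < +oo); rewrite probability_setT ltry.
move=> lam l0; have me : measurable_fun setT (fun s : vec => (expR (- dotv lam s))%:E).
  by apply/measurable_EFinP; exact: measurable_exp_dotv.
rewrite !integral_image_measure//.
have [-> _] := integral_laplace P1 mu1 mA l0.
by have [-> _] := integral_laplace P2 mu2 mA l0; rewrite laplaceE.
Qed.

Lemma eq_law_disjoint N (S : 'I_N -> set (borel X)) (E : set (N.-tuple vec)) :
  (2 <= N)%N -> (forall j, measurable (S j)) -> trivIset setT S -> measurable E ->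
  P1 [set w | E [tuple evalv mu1 (S j) w | j < N]] =
  P2 [set w | E [tuple evalv mu2 (S j) w | j < N]].
Proof.
move=> N2 mS tS mE.
have mY dO (Om : measurableType dO) (mu : 'I_d -> R.-ftker Om ~> borel X) :
    measurable_fun setT (fun w => [tuple evalv mu (S j) w | j < N]).
  apply/measurable_fun_tnthP => j.
  rewrite (_ : _ \o _ = evalv mu (S j)); first exact: measurable_evalv.
  by apply/funext => w /=; rewrite tnth_mktuple.
have rect dO (Om : measurableType dO) (P : probability Om R)
    (mu : 'I_d -> R.-ftker Om ~> borel X) (B : 'I_N -> set vec) :
    completely_random P mu -> (forall j, measurable (B j)) ->
    P [set w | forall j, B j (tnth [tuple evalv mu (S j) w | j < N] j)] =
    \prod_(j < N) P (evalv mu (S j) @^-1` B j).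
  move=> cr mB; have := cr N S N2 mS tS [set: 'I_N]%SET B mB.
  rewrite (eq_bigl xpredT); last by move=> i; rewrite finset.in_setT.
  move=> <-; congr (P _); apply/seteqP; split => w /=.
    by move=> h j _; have := h j; rewrite tnth_mktuple.
  by move=> h j; rewrite tnth_mktuple; apply: (h j); rewrite /= finset.in_setT.
apply: (eq_measure_rectangles (m1 := image_measure P1 (mY _ _ mu1))
  (m2 := image_measure P2 (mY _ _ mu2))) => //.
- by change (P1 setT < +oo); rewrite probability_setT ltry.
- move=> _ [B mB ->].
  apply: (etrans (rect _ _ P1 mu1 B cr1 mB)); apply: (etrans _ (esym (rect _ _ P2 mu2 B cr2 mB))).
  by apply: eq_bigr => j _; exact: eq_law_evalv.
Qed.

Lemma eq_law_finite n (A : 'I_n -> set (borel X)) (B : 'I_n -> set vec) :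
  (forall k, measurable (A k)) -> (forall k, measurable (B k)) ->
  P1 [set w | forall k, B k (evalv mu1 (A k) w)] =
  P2 [set w | forall k, B k (evalv mu2 (A k) w)].
Proof.
(* With no set at all there is a single atom, while complete randomness speaks of at least two
   disjoint sets; one set already yields two atoms. *)
case: n A B => [|n] A B mA mB.
  rewrite (_ : mkset _ = setT); last by apply/seteqP; split => // w _ [].
  rewrite (_ : mkset _ = setT); last by apply/seteqP; split => // w _ [].
  by rewrite !probability_setT.
pose N := #|{: {set 'I_n.+1}}|; pose b (j : 'I_N) : {set 'I_n.+1} := enum_val j.
have N2 : (2 <= N)%N.
  rewrite /N -cardsT -powersetT card_powerset cardsT card_ord expnS.
  by rewrite leq_pmulr// expn_gt0.
(* The atoms of the algebra generated by the [A k]. *)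
pose S (j : 'I_N) : set (borel X) :=
  [set x | forall k, (if k \in b j then A k else ~` A k) x].
have mS j : measurable (S j).
  apply: (measurable_forall (P := fun k => if k \in b j then A k else ~` A k)) => k.
  by case: ifP => _; [exact: mA|exact: measurableC].
have tS : trivIset setT S.
  move=> j j' _ _ [x [/= h h']]; apply: enum_val_inj; apply/setP => k.
  move: (h k) (h' k); rewrite -/(b j) -/(b j').
  by case: ifP => _; case: ifP.
pose sum_atoms (y : N.-tuple vec) k : vec :=
  [tuple (\sum_(j < N) if k \in b j then tnth (tnth y j) i else 0)%R | i < d].
pose E : set (N.-tuple vec) := [set y | forall k, B k (sum_atoms y k)].
have mE : measurable E.
  apply: (measurable_forall (P := fun k => (sum_atoms ^~ k) @^-1` B k)) => k.
  rewrite -[X in measurable X]setTI.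
  have : measurable_fun setT (sum_atoms ^~ k); last exact.
  apply: measurable_tupleP => i; under eq_fun do rewrite tnth_mktuple.
  apply: measurable_sum => j; case: (k \in b j) => //.
  apply: (measurableT_comp (measurable_coord i)); exact: measurable_tnth.
have evalE dO (Om : measurableType dO) (mu : 'I_d -> R.-ftker Om ~> borel X) w k :
    sum_atoms [tuple evalv mu (S j) w | j < N] k = evalv mu (A k) w.
  apply: eq_from_tnth => i; rewrite !tnth_mktuple.
  pose F j : set (borel X) := if k \in b j then S j else set0.
  have mF j : measurable (F j) by rewrite /F; case: ifP.
  have tF : trivIset setT F.
    move=> j j' _ _ [x [/=]]; rewrite /F.
    case: ifP => // _ Sj; case: ifP => // _ Sj'.
    by apply: tS => //; exists x.
  have AF : A k = \big[setU/set0]_(j < N) F j.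
    rewrite -bigcup_seq; apply/seteqP; split => x.
      (* The atom containing x is indexed by the set of those k for which x is in [A k]. *)
      move=> Ax; exists (enum_rank [set k | `[< A k x >]]%SET); first by rewrite /= mem_index_enum.
      rewrite /F /b enum_rankK inE; case: asboolP => // _ k'.
      by rewrite /b enum_rankK inE; case: asboolP.
    move=> [j _]; rewrite /= /F; case: ifP => // kb /(_ k).
    by rewrite kb.
  have mU : measurable (\big[setU/set0]_(j < N) F j) by rewrite -AF.
  rewrite AF (measure_semi_additive_ord (mu i w))// -sum_fine; last first.
    by move=> j _; exact: kernel_fin_num.
  apply: eq_bigr => j _; rewrite tnth_mktuple /F.
  by case: ifP => _; rewrite ?tnth_mktuple// measure0.
have := eq_law_disjoint N2 mS tS mE.
rewrite /E; congr (P1 _ = P2 _); apply/seteqP; split => w /= h k; have := h k; by rewrite evalE.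
Qed.

Definition cylinders : set (set ('I_d -> {measure set (borel X) -> \bar R})) :=
  [set F | exists n (i : 'I_n -> 'I_d) (A : 'I_n -> set (borel X)) (C : 'I_n -> set (\bar R)),
    [/\ forall k, measurable (A k), forall k, measurable (C k) &
      F = [set m : 'I_d -> {measure set (borel X) -> \bar R} |
        forall k, C k (m (i k) (A k))]]].

Lemma cylinders_setI : setI_closed cylinders.
Proof.
move=> _ _ [n1 [i1 [A1 [C1 [mA1 mC1 ->]]]]] [n2 [i2 [A2 [C2 [mA2 mC2 ->]]]]].
exists (n1 + n2)%N.
exists (fun k => match fintype.split k with inl k => i1 k | inr k => i2 k end).
exists (fun k => match fintype.split k with inl k => A1 k | inr k => A2 k end).
exists (fun k => match fintype.split k with inl k => C1 k | inr k => C2 k end).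
split; [by move=> k; case: fintype.split|by move=> k; case: fintype.split|].
apply/seteqP; split => m /=.
  by move=> [h1 h2] k; case: fintype.split.
move=> h; split => k.
  by have := h (lshift n2 k); rewrite (unsplitK (inl k)).
by have := h (rshift n1 k); rewrite (unsplitK (inr k)).
Qed.

Lemma measure_vector_events_cylinders :
  @measure_vector_events R X d `<=` <<s cylinders >>.
Proof.
apply: smallest_sub; first exact: smallest_sigma_algebra.
move=> _ [i [E mE ->]].
suff : image_set_system setT (fun m : 'I_d -> {measure set (borel X) -> \bar R} => m i)
    <<s cylinders >> E by rewrite /image_set_system/= setTI.
move: E mE; apply: smallest_sub.
  exact/sigma_algebra_image/smallest_sigma_algebra.
move=> _ [A [C [mA mC ->]]]; rewrite /image_set_system/= setTI.
apply: sub_sigma_algebra; exists 1%N, (fun=> i), (fun=> A), (fun=> C); split => //.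
by apply/seteqP; split => m /= h => [_//|]; exact: (h ord0).
Qed.

(** Cylinders form a pi-system generating the events. Measurability of both preimages is carried
    through the Dynkin argument, since complements and disjoint unions need it and the target has no
    measurable structure. *)
Lemma same_law_of_laplace : same_law P1 mu1 P2 mu2.
Proof.
move=> E /measure_vector_events_cylinders.
rewrite -(setI_closed_g_dynkin_g_sigma_algebra cylinders_setI) => hE.
suff [] : [/\ measurable (random_vector mu1 @^-1` E), measurable (random_vector mu2 @^-1` E) &
    P1 (random_vector mu1 @^-1` E) = P2 (random_vector mu2 @^-1` E)] by [].
move: E hE; apply: smallest_sub.
  split => [|E [m1 m2 e]|F tF mF].
  - by rewrite !preimage_setT !probability_setT; split.
  - split; [exact: (measurableC m1)|exact: (measurableC m2)|].
    apply: (etrans (probability_setC P1 m1)); apply: (etrans _ (esym (probability_setC P2 m2))).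
    by rewrite e.
  - have m1 k : measurable (random_vector mu1 @^-1` F k) by have [] := mF k.
    have m2 k : measurable (random_vector mu2 @^-1` F k) by have [] := mF k.
    have t1 : trivIset setT (fun k => random_vector mu1 @^-1` F k).
      by move=> k j _ _ [w [/= hk hj]]; apply: tF => //; exists (random_vector mu1 w).
    have t2 : trivIset setT (fun k => random_vector mu2 @^-1` F k).
      by move=> k j _ _ [w [/= hk hj]]; apply: tF => //; exists (random_vector mu2 w).
    have e1 : random_vector mu1 @^-1` (\bigcup_k F k) =
      \bigcup_k (random_vector mu1 @^-1` F k) by [].
    have e2 : random_vector mu2 @^-1` (\bigcup_k F k) =
      \bigcup_k (random_vector mu2 @^-1` F k) by [].
    rewrite e1 e2; split; [by apply: bigcup_measurable|by apply: bigcup_measurable|].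
    apply: (etrans (measure_bigcup P1 setT _ (fun k _ => m1 k) t1)).
    apply: (etrans _ (esym (measure_bigcup P2 setT _ (fun k _ => m2 k) t2))).
    by apply: eq_eseriesr => k _; have [] := mF k.
move=> _ [n [i [A [C [mA mC ->]]]]].
have pre dO (Om : measurableType dO) (mu : 'I_d -> R.-ftker Om ~> borel X) :
    random_vector mu @^-1` [set m : 'I_d -> {measure set (borel X) -> \bar R} |
      forall k, C k (m (i k) (A k))] =
    [set w | forall k, (fun k => [set s : vec | C k (tnth s (i k))%:E]) k (evalv mu (A k) w)].
  apply/seteqP; split => w /= h k; have := h k;
    by rewrite tnth_mktuple fineK//; exact: kernel_fin_num.
have mpre dO (Om : measurableType dO) (mu : 'I_d -> R.-ftker Om ~> borel X) :
    measurable (random_vector mu @^-1` [set m : 'I_d -> {measure set (borel X) -> \bar R} |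
      forall k, C k (m (i k) (A k))]).
  apply: (measurable_forall (P := fun k => (fun w => mu (i k) w (A k)) @^-1` C k)) => k.
  by rewrite -[X in measurable X]setTI; exact: measurable_kernel.
split; [exact: mpre|exact: mpre|].
rewrite !pre; apply: (eq_law_finite (B := fun k => [set s : vec | C k (tnth s (i k))%:E])) => //.
move=> k; rewrite -[X in measurable X]setTI.
have : measurable_fun setT (fun s : vec => (tnth s (i k))%:E); last exact.
by apply/measurable_EFinP; exact: (measurable_coord (i k)).
Qed.

End LawDetermined.

(** * The index of dependence *)

Section CompetitorJumps.
Context {R : realType} {X : completePseudoMetricType R} {d : nat}.
Variables (i0 : 'I_d).
Context {dO : measure_display} {Om : measurableType dO}.
Variables (P : probability Om R) (mu : 'I_d -> R.-ftker Om ~> borel X).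
Variables (alpha : {finite_measure set (borel X) -> \bar R})
  (nu : {measure set (d.-tuple R) -> \bar R}).
Hypotheses (hcrv : crv P mu) (hhom : homogeneous P mu alpha nu)
  (hact : infinitely_active nu) (heq : equal_marginals P mu)
  (hmom : finite_second_moments P mu).
Implicit Types (A : set (borel X)) (lam : d.-tuple R).
Local Notation vec := (d.-tuple R).

Definition mass_ratio A : R := (fine (alpha A) / fine (alpha setT))%R.

Lemma alphaT_gt0 : (0 < fine (alpha setT))%R.
Proof.
case: hhom => aT _ _; rewrite fine_gt0// lt0e aT measure_ge0/=.
by rewrite -ge0_fin_numE// fin_num_measure.
Qed.

Lemma mass_ratio_ge0 A : (0 <= mass_ratio A)%R.
Proof. by rewrite divr_ge0// fine_ge0. Qed.

Lemma mass_ratio_le1 A : measurable A -> (mass_ratio A <= 1)%R.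
Proof.
move=> mA; rewrite ler_pdivrMr ?alphaT_gt0// mul1r fine_le ?fin_num_measure//.
by apply: le_measure; rewrite ?inE.
Qed.

Lemma levy_homogeneous A B : measurable A -> measurable B ->
  levy_intensity P mu A B = (mass_ratio A)%:E * levy_intensity P mu setT B.
Proof.
move=> mA mB; case: hhom => _ _ h; rewrite !h// muleA; congr (_ * _).
have fT : alpha setT \is a fin_num by rewrite fin_num_measure.
rewrite -[X in _ = _ * X](fineK fT) -EFinM /mass_ratio divfK; last by rewrite gt_eqF// alphaT_gt0.
by rewrite fineK// fin_num_measure.
Qed.

Lemma levy_integral_ratio (n n' : {measure set vec -> \bar R}) (c : R) lam :
  (0 <= c)%R -> nnegv lam -> (forall B, measurable B -> n' B = c%:E * n B) ->
  levy_exponent n' lam = c%:E * levy_exponent n lam.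
Proof.
move=> c0 l0 n'E; have mO := @measurable_Omega R d.
transitivity (levy_exponent (mscale (NngNum c0) n) lam).
  by apply: eq_measure_integral => B mB _; rewrite n'E.
rewrite /levy_exponent ge0_integral_mscale//.
- exact: measurable_one_sub_exp.
- by move=> s [s0 _]; rewrite lee_fin one_sub_exp_ge0.
Qed.

(** The form of homogeneity that [mu_co] and [mu_perp] inherit: their exponents are expressed by
    one-dimensional exponents of [mu], whereas [homogeneous] is stated for [mu] only. *)
Definition proportional dO' (Om' : measurableType dO') (P' : probability Om' R)
    (mu' : 'I_d -> R.-ftker Om' ~> borel X) : Prop :=
  forall A lam, measurable A -> nnegv lam ->
    exponent P' mu' A lam = (mass_ratio A * exponent P' mu' setT lam)%R.

Lemma homogeneous_proportional : proportional P mu.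
Proof.
move=> A lam mA l0; case: hcrv => _ _ dr.
have e1 := levy_exponentE mA l0 (levy_intensityP dr mA).
have e2 := levy_exponentE measurableT l0 (levy_intensityP dr measurableT).
apply: EFin_inj; rewrite EFinM; apply: (etrans (esym e1)).
apply: (etrans _ (congr1 (fun z => _ * z) e2)).
apply: levy_integral_ratio => //; first exact: mass_ratio_ge0.
by move=> B mB; exact: levy_homogeneous.
Qed.

Section Competitor.
Context {dO' : measure_display} {Om' : measurableType dO'}.
Variables (P' : probability Om' R) (mu' : 'I_d -> R.-ftker Om' ~> borel X).
Hypotheses (crv' : crv P' mu') (marg' : same_marginals P' mu' P mu).

Lemma exponent_coord A i a : measurable A -> (0 <= a)%R ->
  exponent P' mu' A (vunit i a) = exponent P mu A (vunit i0 a).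
Proof.
move=> mA a0; apply: (congr1 (fun z => - ln z)%R).
by rewrite (eq_law_laplace mA a0 (marg' i)) (eq_law_laplace mA a0 (heq i i0)).
Qed.

Lemma competitor_levy A : measurable A ->
  is_levy_intensity P' mu' A (levy_intensity P' mu' A).
Proof. by move=> mA; case: crv' => _ _ dr; exact: levy_intensityP. Qed.

Lemma competitor_on_Omega A : measurable A -> on_Omega (levy_intensity P' mu' A).
Proof. by move=> /competitor_levy[]. Qed.

Lemma competitor_exponent A lam : measurable A -> nnegv lam ->
  levy_exponent (levy_intensity P' mu' A) lam = (exponent P' mu' A lam)%:E.
Proof. by move=> mA l0; exact: (levy_exponentE mA l0 (competitor_levy mA)). Qed.

Lemma competitor_fin A lam : measurable A -> nnegv lam ->
  levy_exponent (levy_intensity P' mu' A) lam < +oo.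
Proof. by move=> mA l0; rewrite competitor_exponent// ltry. Qed.

Lemma competitor_scale A B : proportional P' mu' -> measurable A -> measurable B ->
  levy_intensity P' mu' A B = (mass_ratio A)%:E * levy_intensity P' mu' setT B.
Proof.
move=> prop mA mB; have mO := @measurable_Omega R d.
pose n : {measure set vec -> \bar R} :=
  mscale (NngNum (mass_ratio_ge0 A)) (levy_intensity P' mu' setT).
suff <- : n B = (mass_ratio A)%:E * levy_intensity P' mu' setT B.
  apply: eq_levy_measure => //.
  - exact: competitor_on_Omega.
  - have := competitor_on_Omega measurableT; rewrite /on_Omega /n /= /mscale /= => ->.
    by rewrite mule0.
  - by move=> lam l0; exact: competitor_fin.
  - move=> lam l0; rewrite -[LHS]/(levy_exponent (levy_intensity P' mu' A) lam).
    rewrite -[RHS]/(levy_exponent n lam) competitor_exponent// prop// EFinM.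
    rewrite -competitor_exponent//; apply/esym/levy_integral_ratio => //.
    exact: mass_ratio_ge0.
by [].
Qed.

(** Each one-dimensional exponent is that of [mu], hence 0 at such a set, so no coordinate can be
    nonzero on a set of positive mass. *)
Lemma competitor_null A B : measurable A -> measurable B -> mass_ratio A = 0%R ->
  levy_intensity P' mu' A B = 0.
Proof.
move=> mA mB A0; have n0 := competitor_on_Omega mA; have mO := @measurable_Omega R d.
rewrite -(measure_conegligible_setI mO mB n0).
have coord0 i : levy_intensity P' mu' A [set s | tnth s i != 0%R] = 0.
  apply: (Omega_integral_eq0 (f := fun s => (1 - expR (- (1 * tnth s i)))%R) n0).
  - apply: measurable_funB => //; apply: measurableT_comp => //; apply: measurable_funN.
    by apply: measurable_funM => //; exact: (measurable_coord i).
  - by move=> s [s0 _]; rewrite subr_ge0 expR_le1 oppr_le0 mul1r.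
  - apply: (etrans (esym (levy_exponent_coord _ i ler01))).
    rewrite competitor_exponent//; last exact: nnegv_unit.
    rewrite exponent_coord// homogeneous_proportional//; last exact: nnegv_unit.
    by rewrite A0 mul0r.
  - exact: measurable_coord_neq0.
  - move=> s _ /= si; rewrite mul1r subr_eq0 eq_sym.
    by apply: contra si; rewrite -[X in _ == X]expR0 => /eqP/expR_inj/eqP; rewrite oppr_eq0.
apply: (subset_measure0 (measurableI _ _ mO mB)
  (measurable_exists (@measurable_coord_neq0 R d)) _
  (measure_exists_null (@measurable_coord_neq0 R d) coord0)).
by move=> s [[]].
Qed.

End Competitor.

Section Comonotone.
Context {dOc : measure_display} {Omc : measurableType dOc}.
Variables (Pc : probability Omc R) (mu_co : 'I_d -> R.-ftker Omc ~> borel X).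
Hypotheses (hco_crv : crv Pc mu_co) (hco_marg : same_marginals Pc mu_co P mu)
  (hco : components_ae_equal Pc mu_co).
Local Notation K A := (levy_intensity Pc mu_co A).

Lemma exponent_co A lam : measurable A -> nnegv lam ->
  exponent Pc mu_co A lam = exponent P mu A (vunit i0 (vsum lam)).
Proof.
move=> mA l0; rewrite (exponent_components_equal mA i0 hco l0).
by rewrite (exponent_coord hco_marg)// vsum_ge0.
Qed.

Lemma co_proportional : proportional Pc mu_co.
Proof.
move=> A lam mA l0; rewrite !exponent_co// homogeneous_proportional//.
exact/nnegv_unit/vsum_ge0.
Qed.

(** The exponent of [mu_co] depends on lam only through the sum of its coordinates, which is 2 for
    each of 2 e_i, 2 e_j and e_i + e_j. *)
Lemma co_diag A i j : measurable A -> K A [set s | tnth s i != tnth s j] = 0.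
Proof.
move=> mA.
have vs (l : 'I_d) (a : R) : vsum (vunit l a) = a.
  rewrite /vsum (bigD1 l)//= tnth_mktuple eqxx big1 ?addr0// => l' /negbTE h.
  by rewrite tnth_mktuple h.
have vD (s t : vec) : vsum (vadd s t) = (vsum s + vsum t)%R.
  by rewrite /vsum -big_split; apply: eq_bigr => l _; rewrite tnth_mktuple.
have l0 : nnegv (vadd (vunit i 1) (vunit j 1) : vec).
  by apply: nnegvD; apply: nnegv_unit.
have l2 l : nnegv (vunit l 2 : vec) by apply: nnegv_unit.
have ke lam : nnegv lam ->
    levy_exponent (K A) lam = (exponent P mu A (vunit i0 (vsum lam)))%:E.
  by move=> lam0; rewrite -exponent_co//; exact: (competitor_exponent hco_crv).
apply: levy_exponent_diag.
- exact: (competitor_on_Omega hco_crv).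
- by move=> lam ?; exact: (competitor_fin hco_crv).
- apply: (etrans (ke _ (l2 i))); apply: (etrans _ (esym (ke _ l0))).
  by apply: (congr1 (fun a => (exponent P mu A (vunit i0 a))%:E)); rewrite vD !vs.
- apply: (etrans (ke _ (l2 j))); apply: (etrans _ (esym (ke _ l0))).
  by apply: (congr1 (fun a => (exponent P mu A (vunit i0 a))%:E)); rewrite vD !vs.
Qed.

Section Jumps.
Context {dO' : measure_display} {Om' : measurableType dO'}.
Variables (P' : probability Om' R) (mu' : 'I_d -> R.-ftker Om' ~> borel X).
Hypotheses (crv' : crv P' mu') (marg' : same_marginals P' mu' P mu).

Lemma competitor_jumps A i : measurable A ->
  same_jumps (levy_intensity P' mu' A) (K A) i i0.
Proof.
move=> mA; apply: same_jumps_levy.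
- exact: (competitor_on_Omega crv').
- exact: (competitor_on_Omega hco_crv).
- by move=> a a0; apply: (competitor_fin crv') => //; exact: nnegv_unit.
- move=> a a0; have l0 l : nnegv (vunit l a : vec) by apply: nnegv_unit.
  rewrite (competitor_exponent crv')// (competitor_exponent hco_crv)//.
  by rewrite (exponent_coord marg')// (exponent_coord hco_marg).
Qed.

End Jumps.

Lemma self_marginals : same_marginals P mu P mu.
Proof. by move=> i E _. Qed.

Lemma co_active A : measurable A -> (0 < mass_ratio A)%R ->
  K A [set s | (0 < tnth s i0)%R] = +oo.
Proof.
move=> mA A0; have e := competitor_jumps hcrv self_marginals i0 mA.
pose B : set R := `]0%R, +oo[%classic.
have Bpre : coord i0 @^-1` B = [set s : vec | (0 < tnth s i0)%R].
  by apply/seteqP; split => s; rewrite /B /= in_itv/= andbT.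
rewrite -Bpre -e//; last exact: measurable_itv.
have mB : measurable (coord i0 @^-1` B : set vec).
  by rewrite -[X in measurable X]setTI; apply: measurable_coord => //; exact: measurable_itv.
case: hhom => _ _ h; rewrite h//.
have := hact i0; rewrite /levy_marginal /pushforward setTI.
rewrite -[X in nu X = _]/(coord i0 @^-1` B) => ->.
rewrite gt0_muley// -[ltRHS](fineK (fin_num_measure alpha A mA)) lte_fin.
by move: A0; rewrite /mass_ratio pmulr_lgt0// invr_gt0 alphaT_gt0.
Qed.

Lemma co_second_moment A i : measurable A -> \int[K A]_s (tnth s i ^+ 2)%:E < +oo.
Proof.
move=> mA; apply: (levy_second_moment mA (competitor_levy hco_crv mA)).
have msq : measurable_fun setT (fun x : R => (x ^+ 2)%:E).
  by apply/measurable_EFinP; exact: measurable_funX.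
have sq0 (x : R) : 0 <= (x ^+ 2)%:E by rewrite lee_fin sqr_ge0.
rewrite (eq_law_coord mA (hco_marg i) msq sq0).
have := hmom mA; rewrite unlock; apply: le_lt_trans; apply: ge0_le_integral => //.
- by apply: (measurableT_comp msq); exact: measurable_fine_kernel.
- apply/measurable_EFinP; apply: (measurableT_comp measurable_sqnormv).
  exact: measurable_evalv.
- move=> w _; rewrite lee_fin /sqnormv (bigD1 i)//= tnth_mktuple lerDl.
  by apply: sumr_ge0 => j _; rewrite sqr_ge0.
Qed.

Lemma co_sqnorm A : measurable A -> \int[K A]_s (sqnormv s)%:E < +oo.
Proof.
move=> mA; rewrite integral_sqnormv; apply: lte_sum_pinfty => i _.
exact: co_second_moment.
Qed.

Lemma crv_distance_ge0 dO' (Om' : measurableType dO') (P' : probability Om' R)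
    (mu' : 'I_d -> R.-ftker Om' ~> borel X) : 0 <= crv_distance P' mu' Pc mu_co.
Proof.
apply: le_ereal_sup_tmp; exists (extended_wasserstein (levy_intensity P' mu' setT) (K setT)).
  by exists setT => //; exact: measurableT.
exact: sqrte_ge0.
Qed.

Section Perp.
Context {dOp : measure_display} {Omp : measurableType dOp}.
Variables (Pp : probability Omp R) (mu_perp : 'I_d -> R.-ftker Omp ~> borel X).
Hypotheses (hperp_crv : crv Pp mu_perp) (hperp_marg : same_marginals Pp mu_perp P mu)
  (hperp : components_independent Pp mu_perp).

Lemma exponent_perp A lam : measurable A -> nnegv lam ->
  exponent Pp mu_perp A lam = (\sum_(i < d) exponent P mu A (vunit i0 (tnth lam i)))%R.
Proof.
move=> mA l0; rewrite (exponent_components_independent mA hperp l0).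
by apply: eq_bigr => i _; rewrite (exponent_coord hperp_marg).
Qed.

Lemma perp_proportional : proportional Pp mu_perp.
Proof.
move=> A lam mA l0; rewrite !exponent_perp// mulr_sumr.
by apply: eq_bigr => i _; rewrite homogeneous_proportional//; exact: nnegv_unit.
Qed.

Lemma perp_off_axes A : measurable A -> levy_intensity Pp mu_perp A off_axes = 0.
Proof.
move=> mA; apply: off_axes_eq0 => i j ij.
have l0 : nnegv (vadd (vunit i 1) (vunit j 1) : vec).
  by apply: nnegvD; apply: nnegv_unit.
have l1 l : nnegv (vunit l 1 : vec) by apply: nnegv_unit.
apply: (levy_exponent_axes ij).
- exact: (competitor_on_Omega hperp_crv).
- by move=> lam ?; exact: (competitor_fin hperp_crv).
- rewrite !(competitor_exponent hperp_crv)// -EFinD; congr EFin.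
  rewrite exponent_perp// !(exponent_coord hperp_marg)//.
  rewrite (bigD1 i)//= (bigD1 j)/=; last by rewrite eq_sym.
  rewrite !tnth_mktuple !eqxx (negbTE ij) eq_sym (negbTE ij) addr0 add0r.
  (* All other coordinates of the argument are 0, where the exponent vanishes because the Laplace
     transform is 1. *)
  rewrite [X in (_ + (_ + X))%R]big1 ?addr0// => l /andP[li lj].
  rewrite !tnth_mktuple (negbTE li) (negbTE lj) addr0.
  have e (s : vec) : dotv (vunit i0 0%R) s = 0%R by rewrite dotv_unit mul0r.
  have [h _] := integral_laplace P mu mA (nnegv_unit i0 (lexx 0%R)).
  apply/eqP; rewrite oppr_eq0; apply/eqP; rewrite [X in ln X](_ : _ = 1%R) ?ln1//.
  apply: EFin_inj; rewrite -h; under eq_integral do rewrite e oppr0 expR0.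
  by rewrite integral_cst// mul1e; exact: probability_setT.
Qed.

(** A competitor may distribute its intensity differently over the sets A, so the comparison with
    [mu_perp] is made at each A, where extremality of the axes applies; the intensities of [mu_perp]
    and [mu_co] then scale up to the whole space. *)
Lemma competitor_distance dO' (Om' : measurableType dO') (P' : probability Om' R)
    (mu' : 'I_d -> R.-ftker Om' ~> borel X) : crv P' mu' -> same_marginals P' mu' P mu ->
  crv_distance P' mu' Pc mu_co <=
  sqrte (sq_wasserstein (levy_intensity Pp mu_perp setT) (K setT)).
Proof.
move=> crv' marg'; apply: ge_ereal_sup => _ [A mA <-].
rewrite -[leLHS]/(sqrte (sq_wasserstein (levy_intensity P' mu' A) (K A))).
rewrite lee_sqrt; last exact: sq_wasserstein_ge0.
have mT := @measurableT _ (borel X).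
(* Without base mass infinite activity fails at A, but there all intensities vanish and so does the
   distance. *)
have [A0|A0] := eqVneq (mass_ratio A) 0%R.
  rewrite sq_wasserstein_self ?sq_wasserstein_ge0//.
  - exact: (competitor_on_Omega hco_crv).
  - exact: co_sqnorm.
  - move=> B mB; rewrite (competitor_null crv' marg')//.
    by rewrite (competitor_null hco_crv hco_marg).
have A1 : (0 < mass_ratio A)%R by rewrite lt0r A0 mass_ratio_ge0.
apply: (@le_trans _ _ (sq_wasserstein (levy_intensity Pp mu_perp A) (K A))).
  apply: (sq_wasserstein_le_axes (i0 := i0)).
  - exact: (competitor_on_Omega hco_crv).
  - by move=> i j; exact: co_diag.
  - exact: co_active.
  - exact: co_second_moment.
  - exact: (competitor_on_Omega crv').
  - by move=> i; exact: competitor_jumps.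
  - exact: (competitor_on_Omega hperp_crv).
  - by move=> i; exact: competitor_jumps.
  - exact: perp_off_axes.
apply: (sq_wasserstein_scale (c := NngNum (mass_ratio_ge0 A))) => /=.
- exact: mass_ratio_le1.
- by move=> B mB; apply: (competitor_scale hperp_crv perp_proportional).
- by move=> B mB; apply: (competitor_scale hco_crv co_proportional).
Qed.

Lemma proportional_distance dO' (Om' : measurableType dO') (P' : probability Om' R)
    (mu' : 'I_d -> R.-ftker Om' ~> borel X) : crv P' mu' -> proportional P' mu' ->
  crv_distance P' mu' Pc mu_co =
  sqrte (sq_wasserstein (levy_intensity P' mu' setT) (K setT)).
Proof.
move=> crv' prop; apply/eqP; rewrite eq_le; apply/andP; split; last first.
  by apply: ereal_sup_ubound; exists setT => //; exact: measurableT.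
apply: ge_ereal_sup => _ [A mA <-].
rewrite -[leLHS]/(sqrte (sq_wasserstein (levy_intensity P' mu' A) (K A))).
rewrite lee_sqrt; last exact: sq_wasserstein_ge0.
apply: (sq_wasserstein_scale (c := NngNum (mass_ratio_ge0 A))) => /=.
- exact: mass_ratio_le1.
- by move=> B mB; apply: (competitor_scale crv' prop).
- by move=> B mB; apply: (competitor_scale hco_crv co_proportional).
Qed.

(** The bound of [competitor_distance] is attained, because [mu_perp] is itself an admissible
    competitor. *)
Lemma max_sq_distanceE : max_sq_distance P mu Pc mu_co =
  sq_wasserstein (levy_intensity Pp mu_perp setT) (K setT).
Proof.
apply/eqP; rewrite eq_le; apply/andP; split.
  apply: ge_ereal_sup => _ [dO' [Om' [P' [mu' [crv' marg' ->]]]]].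
  rewrite -[leRHS]sqr_sqrte ?sq_wasserstein_ge0//.
  rewrite lee_sqr ?sqrte_ge0 ?crv_distance_ge0//; exact: competitor_distance.
apply: ereal_sup_ubound; exists dOp, Omp, Pp, mu_perp; split => //.
by rewrite (proportional_distance hperp_crv perp_proportional) sqr_sqrte ?sq_wasserstein_ge0.
Qed.

End Perp.
End Comonotone.
End CompetitorJumps.

Lemma ereal_index (R : realType) (w W : \bar R) : 0 <= w -> w <= W -> 0 < W -> W < +oo ->
  [/\ 0 <= 1 - w / W <= 1, (1 - w / W = 1 <-> w = 0) & (1 - w / W = 0 <-> w = W)].
Proof.
case: w => [w||]//; case: W => [W||]//; rewrite ?leye_eq// ?lee_fin ?lte_fin => w0 wW W0 _.
have Wn0 : W != 0%R by rewrite gt_eqF.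
rewrite inver (negbTE Wn0) -EFinM -EFinB !lee_fin subr_ge0 ler_pdivrMr// mul1r wW/=.
rewrite gerBl divr_ge0//; last exact: ltW.
split => //; split => -[e]; congr EFin.
- have : (w / W = 0)%R by lra.
  by move/eqP; rewrite mulf_eq0 invr_eq0 (negbTE Wn0) orbF => /eqP.
- by rewrite e mul0r subr0.
- have : (w / W = 1)%R by lra.
  by move/(congr1 (fun z => z * W)%R); rewrite divfK// mul1r.
- by rewrite e divff// subrr.
Qed.

Theorem theorem1 (R : realType) (X : completePseudoMetricType R)
    (hX : polish X) (d : nat) (hd : (2 <= d)%N)
    (dO : measure_display) (Om : measurableType dO)
    (P : probability Om R) (mu : 'I_d -> R.-ftker Om ~> borel X)
    (dOc : measure_display) (Omc : measurableType dOc)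
    (Pc : probability Omc R) (mu_co : 'I_d -> R.-ftker Omc ~> borel X)
    (dOp : measure_display) (Omp : measurableType dOp)
    (Pp : probability Omp R) (mu_perp : 'I_d -> R.-ftker Omp ~> borel X)
    (alpha : {finite_measure set (borel X) -> \bar R})
    (nu : {measure set (d.-tuple R) -> \bar R})
    (hcrv : crv P mu)
    (hhom : homogeneous P mu alpha nu)
    (hact : infinitely_active nu)
    (heq : equal_marginals P mu)
    (hmom : finite_second_moments P mu)
    (hco_crv : crv Pc mu_co)
    (hco_marg : same_marginals Pc mu_co P mu)
    (hco : components_ae_equal Pc mu_co)
    (hperp_crv : crv Pp mu_perp)
    (hperp_marg : same_marginals Pp mu_perp P mu)
    (hperp : components_independent Pp mu_perp) :
  [/\ 0 <= wasserstein_index P mu Pc mu_co <= 1,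
      (wasserstein_index P mu Pc mu_co = 1 <-> same_law P mu Pc mu_co) &
      (wasserstein_index P mu Pc mu_co = 0 <-> same_law P mu Pp mu_perp)].
Proof.
pose i0 : 'I_d := Ordinal (ltnW hd); pose j0 : 'I_d := Ordinal hd.
have mT := @measurableT _ (borel X).
pose N := levy_intensity P mu setT; pose K := levy_intensity Pc mu_co setT.
pose Q := levy_intensity Pp mu_perp setT.
have self : same_marginals P mu P mu by exact: self_marginals.
have hcr : completely_random P mu by case: hcrv.
have cr_co : completely_random Pc mu_co by case: hco_crv.
have cr_perp : completely_random Pp mu_perp by case: hperp_crv.
have prop := homogeneous_proportional hcrv hhom.
have K0 : on_Omega K := competitor_on_Omega hco_crv mT.
have N0 : on_Omega N := competitor_on_Omega hcrv mT.
have Q0 : on_Omega Q := competitor_on_Omega hperp_crv mT.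
have Kdiag i j : K [set s | tnth s i != tnth s j] = 0.
  exact: (co_diag i0 heq hco_crv hco_marg hco).
have ratioT : (0 < mass_ratio alpha setT)%R by rewrite /mass_ratio divff ?gt_eqF ?(alphaT_gt0 hhom).
have Kinf : K [set s | (0 < tnth s i0)%R] = +oo.
  exact: (co_active i0 hcrv hhom hact heq hco_crv hco_marg).
have K2 : \int[K]_s (tnth s i0 ^+ 2)%:E < +oo.
  exact: (co_second_moment hmom hco_crv hco_marg).
have NK i : same_jumps N K i i0.
  exact: (competitor_jumps i0 heq hco_crv hco_marg hcrv self).
have QK i : same_jumps Q K i i0.
  exact: (competitor_jumps i0 heq hco_crv hco_marg hperp_crv hperp_marg).
have Qaxes : Q off_axes = 0.
  exact: (perp_off_axes i0 heq hperp_crv hperp_marg hperp).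
have DE : crv_distance P mu Pc mu_co ^+ 2 = sq_wasserstein N K.
  rewrite (proportional_distance i0 hcrv hhom heq hco_crv hco_marg hco hcrv prop).
  by rewrite sqr_sqrte// sq_wasserstein_ge0.
have le_perp : sq_wasserstein N K <= sq_wasserstein Q K.
  exact: (sq_wasserstein_le_axes K0 Kdiag Kinf K2 N0 NK Q0 QK Qaxes).
have W0 : 0 < sq_wasserstein Q K.
  by apply: (sq_wasserstein_axes_gt0 (j0 := j0) K0 Kdiag Kinf _ Q0 QK Qaxes).
have Wfin : sq_wasserstein Q K < +oo := sq_wasserstein_fin K0 Kdiag Kinf K2 Q0 QK.
have := ereal_index (sq_wasserstein_ge0 N K) le_perp W0 Wfin.
rewrite /wasserstein_index DE.
rewrite (max_sq_distanceE i0 hcrv hhom hact heq hmom hco_crv hco_marg hco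
  hperp_crv hperp_marg hperp).
rewrite -/K -/Q => -[I01 I1 I0]; split => //.
- apply: (iff_trans I1); split => [W_0|law].
    have Ndiag := sq_wasserstein_eq0 i0 K0 Kdiag N0 W_0.
    apply: same_law_of_laplace => // A lam mA l0; apply: laplace_exponent => //.
    have l0' : nnegv (vunit i0 (vsum lam)) by exact/nnegv_unit/vsum_ge0.
    (* Homogeneity moves the exponents from A to the whole space, where [N] is carried by the
       diagonal and its exponent depends on the sum of lam alone, as that of [mu_co] does. *)
    apply: (etrans (prop A lam mA l0)).
    apply: (etrans _ (esym (exponent_co i0 heq hco_marg hco mA l0))).
    apply: (etrans _ (esym (prop A _ mA l0'))).
    apply: (congr1 (fun z => mass_ratio alpha A * z)%R); apply: EFin_inj.
    apply: (etrans (esym (competitor_exponent hcrv mT l0))).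
    apply: (etrans _ (competitor_exponent hcrv mT l0')).
    by apply: diag_levy_exponent.
  apply: sq_wasserstein_self => //.
    exact: (co_sqnorm hmom hco_crv hco_marg).
  apply: (levy_eq mT mT (competitor_levy hcrv mT) (competitor_levy hco_crv mT)) => lam l0.
  by rewrite /exponent (same_law_laplace mT l0 law).
- apply: (iff_trans I0); split => [WE|law].
    have Naxes : N off_axes = 0.
      apply/eqP/negPn/negP => h.
      have := sq_wasserstein_lt_axes K0 Kdiag Kinf K2 N0 NK Q0 QK Qaxes h.
      by rewrite WE ltxx.
    apply: same_law_of_laplace => // A lam mA l0; apply: laplace_exponent => //.
    have li i : nnegv (vunit i (tnth lam i)) by exact: nnegv_unit.
    have li0 i : nnegv (vunit i0 (tnth lam i)) by exact: nnegv_unit.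
    (* The exponents are again moved to the whole space; there [N] is carried by the axes, so its
       exponent splits into one-dimensional ones, as that of [mu_perp] does. *)
    apply: (etrans (prop A lam mA l0)).
    apply: (etrans _ (esym (exponent_perp i0 heq hperp_marg hperp mA l0))).
    apply: (etrans _ (esym (eq_bigr _ (fun i _ => prop A _ mA (li0 i))))).
    apply: (etrans _ (mulr_sumr _ _ _ _)).
    apply: (congr1 (fun z => mass_ratio alpha A * z)%R); apply: EFin_inj.
    apply: (etrans (esym (competitor_exponent hcrv mT l0))).
    apply: (etrans (axes_levy_exponent N0 l0 Naxes)).
    apply: (etrans _ (sumEFin _ _ _)); apply: eq_bigr => i _.
    apply: (etrans (competitor_exponent hcrv mT (li i))).
    by apply: (congr1 EFin); exact: (exponent_coord i0 heq self).
  have NQ : forall B, measurable B -> N B = Q B.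
    apply: (levy_eq mT mT (competitor_levy hcrv mT) (competitor_levy hperp_crv mT)) => lam l0.
    by rewrite /exponent (same_law_laplace mT l0 law).
  have Naxes : N off_axes = 0 by rewrite NQ//; exact: measurable_off_axes.
  (* Now [N] lies on the axes too, so the extremality inequality holds with the roles of [N] and [Q]
     exchanged. *)
  apply/eqP; rewrite eq_le le_perp/=.
  exact: (sq_wasserstein_le_axes K0 Kdiag Kinf K2 Q0 QK N0 NK Naxes).
Qed.
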